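(* Let $N\ge 2$, $s\in(0,1)$, and let $\Omega\subset\mathbb{R}^N$ be a smooth, bounded domain. Let $g_0\in L^q(\Omega)$ with $q>\frac{N}{2s}$ and $g_0^+=\max\{g_0,0\}\not\equiv 0$, and let $V_0=0$. Let $\underline{g}\in\mathcal{E}(g_0)$ be a minimizing weight, i.e. $$\lambda_1(\underline{g},0)=\min\{\lambda_1(g,0): g\in\mathcal{E}(g_0)\},$$ and let $u$ be a first eigenfunction associated to $\underline{g}$ (with $V=0$). Assume that $\Omega$ is Steiner symmetric with respect to the hyperplane $\partial H$, where $H$ is an open affine half-space in $\mathbb{R}^N$ such that $0\in\overline{H}$. Then $u$ and $\underline{g}$ are Steiner symmetric in $\Omega$ with respect to $\partial H$.
   Context: $C_{N,s}$ is the normalization constant of the fractional Laplacian $(-\Delta)^s u(x)=C_{N,s}\,\mathrm{P.V.}\int_{\mathbb{R}^N}\frac{u(x)-u(y)}{|x-y|^{N+2s}}\,dy$. Put $[u]_s=\left(\int_{\mathbb{R}^N}\int_{\mathbb{R}^N}\frac{|u(x)-u(y)|^2}{|x-y|^{N+2s}}\,dx\,dy\right)^{1/2}$ and $H_0^s(\Omega)=\{u\in L^2(\mathbb{R}^N):[u]_s<\infty,\ u=0\text{ in }\mathbb{R}^N\setminus\Omega\}$. The eigenvalue problem is $(-\Delta)^s u+Vu=\lambda g u$ in $\Omega$, $u=0$ in $\mathbb{R}^N\setminus\Omega$ (understood weakly in $H_0^s(\Omega)$), here with $V=0$. Set $$\lambda_1(g,0)=\inf\left\{\frac{\frac{C_{N,s}}{2}[u]_s^2}{\int_\Omega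 g|u|^2dx}: u\in H_0^s(\Omega),\ \int_\Omega g|u|^2dx>0\right\}.$$ A first eigenfunction associated to $g$ is a function $u\in H_0^s(\Omega)$ at which this infimum is attained. For measurable $\phi:\Omega\to\mathbb{R}$, $\mathcal{E}(\phi)$ is the rearrangement class of $\phi$: the set of measurable $\psi:\Omega\to\mathbb{R}$ with $|\{x\in\Omega:\psi(x)>t\}|=|\{x\in\Omega:\phi(x)>t\}|$ for all $t\in\mathbb{R}$ ($|\cdot|$ = Lebesgue measure). Steiner symmetry. Write $x=(x',x_N)\in\mathbb{R}^{N-1}\times\mathbb{R}$; for measurable $A\subset\mathbb{R}^N$ put $A_{x'}=\{x_N\in\mathbb{R}:(x',x_N)\in A\}$, and let $\pi_{N-1}$ be the orthogonal projection $x\mapsto x'$. The Steiner symmetrization of $A$ with respect to $\{x_N=0\}$ is $A^\#=\{(x',x_N): |x_N|<\tfrac12|A_{x'}|_1,\ x'\in\pi_{N-1}(A)\}$, with $|\cdot|_1$ the one-dimensional Lebesgue measure. A domain $\Omega$ is Steiner symmetric with respect to $\{x_N=0\}$ if $\Omega=\Omega^\#$ (up to translation). For a nonnegative measurable $f:\Omega\to\mathbb{R}$, the Steiner symmetrization of $f$ is $f^\#(x)=\sup\{c\in\mathbb{R}: x\in\{y\in\Omega: f(y)\ge c\}^\#\}$ for $x\in\Omega^\#$; if $\Omega=\Omega^\#$, then $f$ is called Steiner symmetric with respect to $\{x_N=0\}$ if $f=f^\#$ in $\Omega$. For a general hyperplane the notions are obtained by applying an isometry that maps it to $\{x_N=0\}$.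 Functions equal a.e. are identified. *)

(* Defs.v *)
From HB Require Import structures.
From mathcomp Require Import all_boot all_order all_algebra.
From mathcomp Require Import all_classical all_reals all_analysis.

Set Implicit Arguments.
Unset Strict Implicit.
Unset Printing Implicit Defensive.

Import Order.TTheory GRing.Theory Num.Theory.
Import numFieldNormedType.Exports.

Local Open Scope classical_set_scope.
Local Open Scope ring_scope.

(* 'rV[T]_n carries the sigma-algebra generated by the coordinates, as the
   library does for n.-tuple T; for T = R this is the Borel sigma-algebra. *)
Section measurable_rV.
Context {d} {T : sigmaRingType d}.
Variable n : nat.

Let coord : 'I_n -> 'rV[T]_n -> T := fun i x => x ord0 i.

Let rV_set0 : g_sigma_preimage coord set0.
Proof. exact: sigma_algebra0. Qed.

Let rV_setC A : g_sigma_preimage coord A -> g_sigma_preimage coord (~` A).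
Proof. exact: sigma_algebraC. Qed.

Let rV_bigcup (F : _^nat) : (forall i, g_sigma_preimage coord (F i)) ->
  g_sigma_preimage coord (\bigcup_i (F i)).
Proof. exact: sigma_algebra_bigcup. Qed.

HB.instance Definition _ := @isMeasurable.Build (measure_tuple_display d)
  'rV[T]_n (g_sigma_preimage coord) rV_set0 rV_setC rV_bigcup.

End measurable_rV.

Lemma measurable_rV_coord d (T : sigmaRingType d) n (i : 'I_n) :
  measurable_fun [set: 'rV[T]_n] (fun x => x ord0 i).
Proof.
move=> _ Y mY; rewrite setTI; apply: sub_sigma_algebra => /=.
rewrite -bigcup_seq/=; exists i => /=; first by rewrite mem_index_enum.
by exists Y => //; rewrite setTI.
Qed.

Lemma measurable_fun_rVP d1 d2 (T1 : measurableType d1)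
    (T2 : measurableType d2) n (f : T1 -> 'rV[T2]_n) :
  (forall i, measurable_fun [set: T1] (fun t => f t ord0 i)) ->
  measurable_fun [set: T1] f.
Proof.
move=> mf.
have prefS : g_sigma_preimage (fun i t => f t ord0 i) `<=` measurable.
  apply: smallest_sub; first exact: sigma_algebra_measurable.
  case: n => [|n] in f mf *; first by rewrite big_ord0.
  rewrite -bigcup_mkord_ord; apply: bigcup_sub => i Ii.
  by move=> A [B mB <-]; exact: mf.
move=> _ A mA; apply: prefS.
rewrite (g_sigma_preimage_comp (fun i (x : 'rV[T2]_n) => x ord0 i) f).
by exists A.
Qed.

(* R^N = R^n x R with N = n.+1: x = snoc (x', x_N), x' = firsts x, x_N = lastc x *)
Definition snoc {T : Type} {n : nat} (p : 'rV[T]_n * T) : 'rV[T]_n.+1 :=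
  \row_i (if unlift ord_max i is Some j then p.1 ord0 j else p.2).

Definition firsts {T : Type} {n : nat} (x : 'rV[T]_n.+1) : 'rV[T]_n :=
  \row_j x ord0 (lift ord_max j).

Definition lastc {T : Type} {n : nat} (x : 'rV[T]_n.+1) : T := x ord0 ord_max.

Lemma firsts_snoc (T : Type) n (p : 'rV[T]_n * T) : firsts (snoc p) = p.1.
Proof. by apply/rowP => j; rewrite !mxE liftK. Qed.

Lemma lastc_snoc (T : Type) n (p : 'rV[T]_n * T) : lastc (snoc p) = p.2.
Proof. by rewrite /lastc mxE unlift_none. Qed.

Lemma snocK (T : Type) n (x : 'rV[T]_n.+1) : snoc (firsts x, lastc x) = x.
Proof.
apply/rowP => i; rewrite mxE; case: unliftP => [j ->|->] //=.
by rewrite mxE.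
Qed.

Lemma measurable_snoc d (T : measurableType d) n :
  measurable_fun [set: 'rV[T]_n * T] (@snoc T n).
Proof.
apply: measurable_fun_rVP => i; rewrite /snoc.
case: (unliftP ord_max i) => [j ->|->].
- under eq_fun do rewrite mxE liftK.
  exact: measurableT_comp (measurable_rV_coord j) measurable_fst.
- under eq_fun do rewrite mxE unlift_none.
  exact: measurable_snd.
Qed.

(* Lebesgue measure on R^n: iterated product of the one-dimensional Lebesgue
   measure, starting from the unit mass on the one-point space R^0. *)
Section lebesgue_step.
Context {R : realType} {n : nat}.
Variable m : {measure set 'rV[R]_n -> \bar R}.
Local Open Scope ereal_scope.

Definition leb_step : set 'rV[R]_n.+1 -> \bar R :=
  pushforward (m \x (@lebesgue_measure R)) (@snoc R n).

Let leb_step0 : leb_step set0 = 0.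
Proof. by rewrite /leb_step /pushforward preimage_set0 measure0. Qed.

Let leb_step_ge0 A : 0 <= leb_step A.
Proof. by apply: integral_ge0 => x _; exact: measure_ge0. Qed.

Let leb_step_sigma_additive : semi_sigma_additive leb_step.
Proof.
move=> F mF tF mUF; rewrite /leb_step /pushforward preimage_bigcup.
apply: measure_semi_sigma_additive.
- by move=> k; rewrite -[X in measurable X]setTI; exact: measurable_snoc.
- apply/trivIsetP => /= i j _ _ ij; rewrite -preimage_setI.
  by move/trivIsetP : tF => /(_ _ _ _ _ ij) ->//; rewrite preimage_set0.
- by rewrite -preimage_bigcup -[X in measurable X]setTI; exact: measurable_snoc.
Qed.

HB.instance Definition _ := isMeasure.Build _ _ _ leb_step
  leb_step0 leb_step_ge0 leb_step_sigma_additive.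

End lebesgue_step.

Fixpoint leb {R : realType} (n : nat) : {measure set 'rV[R]_n -> \bar R} :=
  if n is k.+1 then leb_step (leb k) else \d_ (0 : 'rV[R]_0).

Section euclidean.
Context {R : realType}.

Definition dot {n} (x y : 'rV[R]_n) : R := \sum_(i < n) x ord0 i * y ord0 i.

(* the library norm on 'rV[R]_n is the sup norm *)
Definition enorm {n} (x : 'rV[R]_n) : R := Num.sqrt (dot x x).

Definition isometry {n} (T : 'rV[R]_n -> 'rV[R]_n) :=
  forall x y, enorm (T x - T y) = enorm (x - y).

Definition boundary {T : topologicalType} (A : set T) := closure A `\` A°.

Definition open_half_space {n} (H : set 'rV[R]_n) :=
  exists e : 'rV[R]_n, exists b : R, e != 0 /\ H = [set x | b < dot e x].

Fixpoint iter_derive {V : normedModType R} (vs : seq V) (f : V -> R) : V -> R :=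
  if vs is v :: vs' then 'D_v (iter_derive vs' f) else f.

(* C^oo: directional derivatives of all orders exist and are continuous *)
Definition smooth {V : normedModType R} (f : V -> R) :=
  forall vs : seq V, continuous (iter_derive vs f) /\
    forall v x, derivable (iter_derive vs f) x v.

(* near every boundary point, and after an isometry, A is the open region lying
   strictly above the graph of a C^oo function of n variables *)
Definition smooth_boundary {n} (A : set 'rV[R]_n.+1) :=
  forall p, boundary A p ->
    exists T : 'rV[R]_n.+1 -> 'rV[R]_n.+1, exists gam : 'rV[R]_n -> R,
      [/\ isometry T, smooth gam &
        \forall x \near p, A x <-> gam (firsts (T x)) < lastc (T x)].

Definition smooth_bounded_domain {n} (A : set 'rV[R]_n.+1) :=
  [/\ open A, connected A, A !=set0, bounded_set A & smooth_boundary A].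

End euclidean.

Section steiner.
Context {R : realType} {n : nat}.
Local Notation E := 'rV[R]_n.+1.
Implicit Types (A P Omega : set E) (f : E -> R).

Definition hyper0 : set E := [set x | lastc x = 0].

Definition line_section A (x' : 'rV[R]_n) : set R := [set t | A (snoc (x', t))].

Definition steiner_set A : set E := [set x |
  (firsts @` A) (firsts x) /\
  (`|lastc x|%:E < 2^-1%:E * lebesgue_measure (line_section A (firsts x)))%E].

(* Defined for real-valued f by the formula used for nonnegative f; the
   supremum is taken in the extended reals, since it may be +oo on hyper0. *)
Definition steiner_fun Omega f (x : E) : \bar R :=
  ereal_sup [set c%:E | c in
    [set c : R | steiner_set [set y | Omega y /\ c <= f y] x]].

Definition steiner_sym_set0 A := A = steiner_set A.

Definition steiner_sym_fun0 Omega f :=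
  {ae leb n.+1, forall x, Omega x -> (f x)%:E = steiner_fun Omega f x}.

(* T is an isometry, with inverse Ti, mapping P onto hyper0. Such T is unique up
   to isometries preserving hyper0, which commute with Steiner symmetrization. *)
Definition flattens P (T Ti : E -> E) :=
  [/\ cancel T Ti, cancel Ti T, isometry T & T @` P = hyper0].

Definition steiner_sym_set P A :=
  exists T Ti, flattens P T Ti /\ steiner_sym_set0 (T @` A).

Definition steiner_sym_fun P Omega f :=
  exists T Ti, [/\ flattens P T Ti, steiner_sym_set0 (T @` Omega) &
    steiner_sym_fun0 (T @` Omega) (f \o Ti)].

End steiner.

Section fractional.
Context {R : realType} {n : nat}.
Local Notation E := 'rV[R]_n.+1.
Local Notation mu := (@leb R n.+1).
Implicit Types (Omega : set E) (g u : E -> R) (s : R).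

(* |x - y|^(N + 2s), N = n.+1 *)
Definition kernel_denom s (z : E) : R := enorm z `^ (n.+1%:R + 2 * s).

(* With this value (-Delta)^s has Fourier symbol |xi|^(2s):
   C_{N,s} = (\int (1 - cos z_1) / |z|^(N + 2s) dz)^-1. *)
Definition frac_const s : R :=
  (\int[mu]_z ((1 - cos (z ord0 ord0)) / kernel_denom s z))^-1.

Definition gagliardo s u : \bar R :=
  ((\int[mu]_x \int[mu]_y
     (`|u x - u y| ^+ 2 / kernel_denom s (x - y))%:E) `^ 2^-1)%E.

Definition H0s Omega s u :=
  [/\ u \in Lfun mu 2%:E, (gagliardo s u < +oo)%E &
      {ae mu, forall x, ~ Omega x -> u x = 0}].

Definition weighted_mass Omega g u : R :=
  \int[mu]_(x in Omega) (g x * `|u x| ^+ 2).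

Definition admissible Omega s g u :=
  H0s Omega s u /\ 0 < weighted_mass Omega g u.

Definition rayleigh Omega s g u : R :=
  (frac_const s / 2 * fine (gagliardo s u) ^+ 2) / weighted_mass Omega g u.

Definition lambda1 Omega s g : \bar R :=
  ereal_inf [set (rayleigh Omega s g u)%:E | u in admissible Omega s g].

Definition first_eigenfunction Omega s g u :=
  admissible Omega s g u /\ (rayleigh Omega s g u)%:E = lambda1 Omega s g.

(* functions on Omega are total functions whose values off Omega are ignored *)
Definition rearrangement_class Omega (phi : E -> R) : set (E -> R) :=
  [set psi | measurable_fun Omega psi /\ forall t : R,
     mu [set x | Omega x /\ t < psi x] = mu [set x | Omega x /\ t < phi x]].

Definition minimizing_weight Omega s g0 g :=
  rearrangement_class Omega g0 g /\
  forall g', rearrangement_class Omega g0 g' ->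
    (lambda1 Omega s g <= lambda1 Omega s g')%E.

Definition ae_nonneg Omega u := {ae mu, forall x, Omega x -> 0 <= u x}.

End fractional.

(* Main.v *)
Require Import Defs.
From HB Require Import structures.
From mathcomp Require Import all_boot all_order all_algebra.
From mathcomp Require Import all_classical all_reals all_analysis.
From mathcomp Require Import measurable_realfun.
From mathcomp Require Import ring lra.
Import Order.TTheory GRing.Theory Num.Theory.
Import numFieldNormedType.Exports.

(** Write [u] for the first eigenfunction, [g] for the minimizing weight, [lam] for the
    eigenvalue, [c] for half of the constant of the fractional Laplacian, and [En] for
    the double integral of the squared increments against the kernel. Minimality gives
        lam * int h w^2 <= c * En w
    for every bounded test function [w] and every rearrangement [h] of [g], and equality
    for [h = g] and [w = u]. Up to a sign [u] is nonnegative, since the modulus has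
    strictly smaller energy if [u] changes sign ([energy_abs_lt]); and it is positive in
    the domain, since adding a small multiple of a bump to a zero set of positive measure
    lowers the energy at first order and changes the mass only at second order
    ([optimal_pair_gt0]).

    Consider a hyperplane parallel to the hyperplane of symmetry, and the half-space [X]
    bounded by it that contains the latter. Polarization moves the larger of the two
    values at mirror-symmetric points into [X]. Polarizing [u] does not increase the
    energy, because close pairs of points carry the larger kernel value, and polarizing
    [u] and [g] simultaneously does not decrease the mass; moreover the energy decreases
    strictly unless [u] is already polarized or is polarized in the reverse sense. The
    reverse sense is excluded because some points of the domain have their mirror image
    outside, where [u] vanishes ([eigenfunction_polarized]).

    For the weight, let [h] be obtained from [g] by exchanging the values at those pairs
    of points where [g] is in the wrong order. The mass of [u] does not decrease, so [u] is
    optimal for [h] as well, with the same eigenvalue. Both weights thus satisfy the same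
    linear equation, which gives [(g - h) u = 0], and [g = h] as [u] is positive
    ([weight_polarized]). The equation is used in variational form, and all steps are
    carried out with the bounded truncations of [u], for which the mass of every
    integrable weight is finite.

    Finally a function that is polarized with respect to all these hyperplanes is, on
    almost every line orthogonal to them, a decreasing function of the distance to the
    hyperplane of symmetry, because any two points of the line at different distances
    are exchanged by one of the reflections. Fubini's theorem turns the null sets of the single reflections into
    one null set of pairs of points ([null_slices]), and a function that is sorted in this
    sense coincides with its rearrangement ([rearranged_value], [steiner_of_sorted]). *)

Set Implicit Arguments.
Unset Strict Implicit.
Unset Printing Implicit Defensive.
Local Open Scope classical_set_scope.
Local Open Scope ring_scope.

(** * Lebesgue measure on row vectors *)
Section leb_basic.
Context {R : realType}.

Definition cube n (r : R) : set 'rV[R]_n :=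
  [set x | forall i, `|x ord0 i| < r].

Arguments cube n r : clear implicits.

Lemma snoc_preimage_cube n r :
  @snoc R n @^-1` (cube n.+1 r) = cube n r `*` ball (0 : R) r.
Proof.
apply/seteqP; split => -[x t] /=.
- move=> h; split => /=.
    by move=> i; have := h (lift ord_max i); rewrite mxE liftK.
  by have := h ord_max; rewrite mxE unlift_none /ball/= sub0r normrN.
- move=> [h1 h2] i; rewrite mxE; case: unliftP => [j _|_] /=; first exact: h1.
  by move: h2; rewrite /ball/= sub0r normrN.
Qed.

Lemma measurable_cube n r : measurable (cube n r).
Proof.
have -> : cube n r = \bigcap_(i in [set: 'I_n])
    ((fun x : 'rV[R]_n => x ord0 i) @^-1` (ball (0 : R) r)).
  apply/seteqP; split => x /= h i; last first.
    by have := h i I; rewrite /ball/= sub0r normrN.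
  by move=> _; have := h i; rewrite /ball/= sub0r normrN.
apply: fin_bigcap_measurable => // i _.
by rewrite -[X in measurable X]setTI; apply: measurable_rV_coord => //;
  exact: measurable_ball.
Qed.

Lemma leb_cube n r : 0 <= r -> leb n (cube n r) = ((r *+ 2) ^+ n)%:E.
Proof.
move=> r0; elim: n => [|n IH].
  rewrite /= diracE mem_set// => i; by case: i.
rewrite /= /leb_step /pushforward snoc_preimage_cube.
rewrite product_measure1E//; last 2 first.
- exact: measurable_cube.
- exact: measurable_ball.
rewrite exprSr EFinM; congr (_ * _)%E; first exact: IH.
exact: lebesgue_measure_ball.
Qed.

Lemma cube_cover n : \bigcup_k cube n (k%:R : R) = setT.
Proof.
apply/seteqP; split => // x _.
pose M := \sum_i `|x ord0 i|.
exists (Num.truncn M).+1 => //= i.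
apply: le_lt_trans (truncnS_gt _).
by rewrite /M (bigD1 i)//= lerDl sumr_ge0.
Qed.

Lemma leb_sigma_finite n : sigma_finite setT (@leb R n).
Proof.
exists (fun k => cube n k%:R) => [|k]; first by rewrite cube_cover.
by split; [exact: measurable_cube|rewrite leb_cube// ltry].
Qed.

(** The same measure, carrying in addition the sigma-finite structure that the
    theorems on iterated integrals require. *)
Definition lebs n : set 'rV[R]_n -> \bar R := leb n.

HB.instance Definition _ n := isMeasure.Build _ _ _ (@lebs n)
  (measure0 (leb n)) (measure_ge0 (leb n))
  (@measure_semi_sigma_additive _ _ _ (leb n)).

HB.instance Definition _ n := Measure_isSigmaFinite.Build _ _ _ (@lebs n)
  (@leb_sigma_finite n).

Arguments lebs n : clear implicits.

Lemma lebs_snoc n (A : set 'rV[R]_n.+1) : lebs n.+1 A =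
  (\int[lebs n]_x lebesgue_measure [set t | A (snoc (x, t))])%E.
Proof.
apply: eq_integral => x _ /=; congr (lebesgue_measure _).
by rewrite xsectionE.
Qed.

End leb_basic.
Arguments lebs {R} n.
Arguments cube {R} n r.

Section measure_preserving.
Context d (T : measurableType d) (R : realType).
Variable m : {measure set T -> \bar R}.

Definition mpres (phi : T -> T) := measurable_fun setT phi /\
  forall A, measurable A -> m (phi @^-1` A) = m A.

Lemma mpres_integral phi (f : T -> \bar R) : mpres phi ->
  measurable_fun setT f -> (forall x, 0 <= f x)%E ->
  (\int[m]_x f (phi x) = \int[m]_x f x)%E.
Proof.
move=> [mphi pphi] mf f0.
transitivity (\int[pushforward m phi]_x f x)%E.
  by rewrite (ge0_integral_pushforward mphi m measurableT).
by apply: eq_measure_integral => A mA _; exact: pphi.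
Qed.

Lemma mpres_negligible phi A : mpres phi ->
  m.-negligible A -> m.-negligible (phi @^-1` A).
Proof.
move=> [mphi pphi] [B [mB B0 AB]]; exists (phi @^-1` B); split.
- by rewrite -[X in measurable X]setTI; exact: mphi.
- by rewrite pphi.
- by move=> x; exact: AB.
Qed.

End measure_preserving.

Section translation.
Context {R : realType}.

(** The translate has the same values on intervals, and these determine the measure. *)
Lemma lebesgue_measure_shift (a : R) (A : set R) : measurable A ->
  lebesgue_measure [set t | A (t + a)] = lebesgue_measure A.
Proof.
move=> mA; apply/esym.
have ms : measurable_fun setT ((fun t => t + a) : R -> measurableTypeR R).
  exact: measurable_funD.
rewrite -[RHS]/(pushforward lebesgue_measure
  ((fun t => t + a) : R -> measurableTypeR R) A).
apply: lebesgue_measure_unique => //= _ [[x y]] _ <-.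
rewrite /pushforward.
rewrite [X in _ = lebesgue_measure X](_ : _ = `]x - a, y - a]%classic).
  rewrite !lebesgue_measure_itv/= !lte_fin ltrD2r.
  by case: ifP => // _; rewrite -!EFinD; congr (_%:E); lra.
by apply/seteqP; split => t /=; rewrite !in_itv/= ltrBlDr lerBrDr.
Qed.

Lemma mpres_shift_lebesgue (a : R) : mpres lebesgue_measure (fun t : R => t + a).
Proof.
split; first exact: measurable_funD.
by move=> A mA; exact: lebesgue_measure_shift.
Qed.

Lemma measurable_fun_rVD n (v : 'rV[R]_n) :
  measurable_fun setT (fun x : 'rV[R]_n => x + v).
Proof.
apply: measurable_fun_rVP => i; under eq_fun do rewrite mxE.
by apply: measurable_funD => //; exact: measurable_rV_coord.
Qed.

Lemma mpres_shift n (v : 'rV[R]_n) : mpres (lebs n) (fun x => x + v).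
Proof.
elim: n v => [|n IH] v; split; try exact: measurable_fun_rVD.
  move=> A mA; congr (lebs 0 _); apply/seteqP; split => x /=;
  by rewrite (_ : x + v = x)//; apply/rowP => -[].
move=> A mA; rewrite [LHS](lebs_snoc ((fun x => x + v) @^-1` A)) [RHS](lebs_snoc A).
pose F (x : 'rV[R]_n) : \bar R := lebesgue_measure [set t | A (snoc (x, t))].
have mA' : measurable (@snoc R n @^-1` A).
  by rewrite -[X in measurable X]setTI; apply: measurable_snoc.
have mF : measurable_fun setT F.
  have := measurable_fun_xsection (lebesgue_measure) mA'.
  by apply: eq_measurable_fun => x _ /=; rewrite xsectionE.
rewrite -(mpres_integral (IH (firsts v)) mF)//.
apply: eq_integral => x _.
rewrite /F -[RHS](lebesgue_measure_shift (lastc v)); last first.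
  rewrite (_ : [set t | _] = xsection (@snoc R n @^-1` A) (x + firsts v)).
    exact: measurable_xsection.
  by rewrite xsectionE.
congr (lebesgue_measure _); apply/seteqP; split => t /=;
  rewrite (_ : snoc (x, t) + v = snoc (x + firsts v, t + lastc v)) //;
  by apply/rowP => i; rewrite !mxE; case: unliftP => [j ->|->] /=; rewrite ?mxE.
Qed.

End translation.

Section borel_rV.
Context {R : realType} {n : nat}.
Local Notation E := 'rV[R]_n.

Lemma ball_rVP (x y : E) (e : R) : 0 < e ->
  ball x e y <-> forall i, `|x ord0 i - y ord0 i| < e.
Proof.
move=> e0; split => [[_ h] i|h]; first exact: h.
by split => // i j; rewrite (ord1 i); exact: h.
Qed.

(** Rational boxes form a countable base of the topology, which is what makes open
    sets measurable for the product sigma-algebra. *)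
Definition qbox (q : 'rV[rat]_n) (k : nat) : set E :=
  [set y | forall i, `|y ord0 i - ratr (q ord0 i)| < k.+1%:R^-1].

Lemma measurable_qbox q k : measurable (qbox q k).
Proof.
have -> : qbox q k = \bigcap_(i in [set: 'I_n])
    ((fun x : E => x ord0 i) @^-1` (ball (ratr (q ord0 i) : R) k.+1%:R^-1)).
  by apply/seteqP; split => x /= h i; [move=> _|]; have := h i; rewrite /ball/= distrC //; exact.
apply: fin_bigcap_measurable => // i _.
by rewrite -[X in measurable X]setTI; apply: measurable_rV_coord => //;
  exact: measurable_ball.
Qed.

Lemma open_measurable_rV (A : set E) : open A -> measurable A.
Proof.
move=> oA.
have -> : A = \bigcup_(p : 'rV[rat]_n * nat)
    (if `[< qbox p.1 p.2 `<=` A >] then qbox p.1 p.2 else set0).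
  apply/seteqP; split => [x Ax|x [p _]]; last first.
    by case: asboolP => // h /h.
  have /nbhs_ballP[e /= e0 xeA] : nbhs x A by exact: open_nbhs_nbhs.
  pose k := Num.truncn (2 / e).
  have ke : k.+1%:R^-1 * 2 < e.
    by rewrite mulrC ltr_pdivrMr// -ltr_pdivrMl// mulrC truncnS_gt.
  have hq i : exists q : rat, `|x ord0 i - ratr q| < k.+1%:R^-1.
    have /rat_in_itvoo[q] : x ord0 i - k.+1%:R^-1 < x ord0 i + k.+1%:R^-1 :> R.
      by rewrite ltrD2l gtrN// invr_gt0 ltr0Sn.
    rewrite in_itv/= => /andP[q1 q2]; exists q.
    by rewrite ltr_norml; apply/andP; split; move: q1 q2; set a := _^-1; lra.
  pose q : 'rV[rat]_n := \row_i projT1 (cid (hq i)).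
  have xq : qbox q k x by move=> i; rewrite mxE; exact: (projT2 (cid (hq i))).
  exists (q, k) => //; case: asboolP => // -[] y yq; apply: xeA.
  apply/(ball_rVP _ _ e0) => i.
  apply: le_lt_trans (ler_distD (ratr (q ord0 i)) _ _) _.
  apply: lt_trans ke; rewrite mulr_natr mulr2n; apply: ltrD.
    exact: (xq i).
  by rewrite distrC; exact: (yq i).
apply: countable_bigcupT_measurable => [|p].
  exact: countableP.
by case: asboolP => // _; exact: measurable_qbox.
Qed.

Lemma measurable_rV_opens :
  @measurable _ E = <<s [set A : set E | open A] >>.
Proof.
apply/seteqP; split => A.
  apply: smallest_sub; first exact: smallest_sigma_algebra.
  rewrite -bigcup_seq => B [i _] [C mC <-].
  have := @measurability _ _ (g_sigma_algebraType [set A : set E | open A])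
    R setT (fun x => x ord0 i) _ (RGenOpens.measurableE R).
  apply => // _ [_ [a [b ->] <-]]; rewrite setTI.
  apply: sub_sigma_algebra; apply: open_comp; last exact: interval_open.
  by move=> x _; exact: coord_continuous.
apply: smallest_sub; first exact: sigma_algebra_measurable.
by move=> B; exact: open_measurable_rV.
Qed.

Lemma continuous_measurable_rV (f : E -> R) :
  continuous f -> measurable_fun setT f.
Proof.
move=> /continuousP cf; apply: (measurability _ (RGenOpens.measurableE R)).
move=> _ [_ [a [b ->] <-]]; rewrite setTI.
by apply: open_measurable_rV; apply: cf; exact: interval_open.
Qed.

End borel_rV.

(** * Isometries preserve Lebesgue measure *)
Section euclid.
Context {R : realType} {n : nat}.
Implicit Types x y z : 'rV[R]_n.

Lemma dotC x y : dot x y = dot y x.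
Proof. by apply: eq_bigr => i _; rewrite mulrC. Qed.

Lemma dotDl x y z : dot (x + y) z = dot x z + dot y z.
Proof. by rewrite -big_split/=; apply: eq_bigr => i _; rewrite mxE mulrDl. Qed.

Lemma dotNl x z : dot (- x) z = - dot x z.
Proof. by rewrite -sumrN; apply: eq_bigr => i _; rewrite mxE mulNr. Qed.

Lemma dotDr x y z : dot z (x + y) = dot z x + dot z y.
Proof. by rewrite dotC dotDl !(dotC z). Qed.

Lemma dotNr x z : dot z (- x) = - dot z x.
Proof. by rewrite dotC dotNl (dotC z). Qed.

Lemma dot_ge0 x : 0 <= dot x x.
Proof. by apply: sumr_ge0 => i _; rewrite -expr2 sqr_ge0. Qed.

Lemma enorm_ge0 x : 0 <= enorm x. Proof. exact: sqrtr_ge0. Qed.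

Lemma enormE2 x : enorm x ^+ 2 = dot x x.
Proof. by rewrite sqr_sqrtr// dot_ge0. Qed.

Lemma enormN x : enorm (- x) = enorm x.
Proof. by rewrite /enorm dotNl dotNr opprK. Qed.

Lemma enormB x y : enorm (x - y) = enorm (y - x).
Proof. by rewrite -enormN opprB. Qed.

Lemma dotBB x y : dot (x - y) (x - y) = dot x x - dot x y *+ 2 + dot y y.
Proof. by rewrite dotDl !dotDr !dotNl !dotNr (dotC y x) opprK mulr2n; ring. Qed.

Lemma coord_le_enorm x i : `|x ord0 i| <= enorm x.
Proof.
rewrite -sqrtr_sqr; apply: ler_wsqrtr.
by rewrite /dot (bigD1 i)//= expr2 lerDl; apply: sumr_ge0 => j _; rewrite -expr2 sqr_ge0.
Qed.

Lemma enorm_eq0 x : enorm x = 0 -> x = 0.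
Proof.
move=> x0; apply/rowP => i; rewrite mxE; apply/eqP; rewrite -normr_le0.
by rewrite -x0 coord_le_enorm.
Qed.

Lemma enorm0 : enorm (0 : 'rV[R]_n) = 0.
Proof. by rewrite /enorm /dot big1 ?sqrtr0// => i _; rewrite mxE mul0r. Qed.

Lemma enorm_lt_sup x r : 0 <= r -> (forall i, `|x ord0 i| <= r) ->
  dot x x <= n%:R * r ^+ 2.
Proof.
move=> r0 h; apply: (@le_trans _ _ (\sum_(i < n) r ^+ 2)); last first.
  by rewrite sumr_const card_ord mulr_natl.
apply: ler_sum => i _; rewrite -expr2 -real_normK ?num_real//.
by rewrite lerXn2r ?nnegrE ?normr_ge0//.
Qed.

Lemma measurable_dotr a : measurable_fun setT (fun x => dot x a).
Proof.
by apply: measurable_sum => i; apply: measurable_funM => //; exact: measurable_rV_coord.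
Qed.

Lemma measurable_dot d (T : measurableType d) (f g : T -> 'rV[R]_n) :
  measurable_fun setT f -> measurable_fun setT g ->
  measurable_fun setT (fun t => dot (f t) (g t)).
Proof.
move=> mf mg; apply: measurable_sum => i; apply: measurable_funM;
exact: (measurableT_comp (measurable_rV_coord i)).
Qed.

Lemma measurable_rVB d (T : measurableType d) (f g : T -> 'rV[R]_n) :
  measurable_fun setT f -> measurable_fun setT g ->
  measurable_fun setT (fun t => f t - g t).
Proof.
move=> mf mg; apply: measurable_fun_rVP => i; under eq_fun do rewrite !mxE.
by apply: measurable_funB; apply: (measurableT_comp (measurable_rV_coord i)).
Qed.

Lemma measurable_rVDf d (T : measurableType d) (f g : T -> 'rV[R]_n) :
  measurable_fun setT f -> measurable_fun setT g ->
  measurable_fun setT (fun t => f t + g t).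
Proof.
move=> mf mg; apply: measurable_fun_rVP => i; under eq_fun do rewrite !mxE.
by apply: measurable_funD; apply: (measurableT_comp (measurable_rV_coord i)).
Qed.

Lemma measurable_enorm d (T : measurableType d) (f : T -> 'rV[R]_n) :
  measurable_fun setT f -> measurable_fun setT (fun t => enorm (f t)).
Proof.
move=> mf; apply: (measurableT_comp (f := @Num.sqrt R)); last exact: measurable_dot.
by apply: continuous_measurable_fun; exact: sqrt_continuous.
Qed.

Definition eball : set 'rV[R]_n := [set x | enorm x < 1].

Lemma measurable_eball : measurable eball.
Proof.
have := @measurable_enorm _ _ (@id 'rV[R]_n) (@measurable_id _ _ _).
move=> /(_ measurableT `]-oo, 1[%classic (measurable_itv _)).
by rewrite setTI (_ : _ @^-1` _ = eball)//; apply/seteqP; split => x /=; rewrite in_itv.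
Qed.

Lemma eball_fin : (lebs n eball < +oo)%E.
Proof.
apply: (@le_lt_trans _ _ (lebs n (cube n 1))).
  apply: le_measure; rewrite ?inE//; [exact: measurable_eball|exact: measurable_cube|].
  by move=> x x1 i; apply: le_lt_trans x1; exact: coord_le_enorm.
by rewrite [X in (X < _)%E]leb_cube// ltry.
Qed.

Lemma eball_gt0 : (0 < lebs n eball)%E.
Proof.
have r0 : 0 < n.+1%:R^-1 :> R by rewrite invr_gt0 ltr0Sn.
apply: (@lt_le_trans _ _ (lebs n (cube n n.+1%:R^-1))).
  by rewrite [X in (_ < X)%E]leb_cube ?ltW// lte_fin exprn_gt0// mulrn_wgt0.
apply: le_measure; rewrite ?inE//; [exact: measurable_cube|exact: measurable_eball|].
move=> x /= h; rewrite /eball/= -sqrtr1 ltr_sqrt//.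
apply: le_lt_trans (enorm_lt_sup (ltW r0) (fun i => ltW (h i))) _.
rewrite exprVn ltr_pdivrMr ?exprn_gt0// mul1r -natrX ltr_nat.
by rewrite -mulnn mulSn ltn_addr.
Qed.

End euclid.

(** Two translation-invariant measures that agree on the Euclidean ball [A] agree
    everywhere: computing the integral of [\1_A x * \1_B (x + y)] in both orders gives
    [mu A * nu B = nu A * mu B]. The ball is used because it is symmetric, and because
    isometries map it to a translate of itself. *)
Section haar.
Context {R : realType} {n : nat}.
Variables mu nu : {sigma_finite_measure set 'rV[R]_n -> \bar R}.
Hypothesis mu_shift : forall v, mpres mu (fun x => x + v).
Hypothesis nu_shift : forall v, mpres nu (fun x => x + v).
Hypothesis mu_eball_gt0 : (0 < mu eball)%E.
Hypothesis mu_eball_fin : (mu eball < +oo)%E.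
Hypothesis nu_eball : nu eball = mu eball.

Lemma haar_unique B : measurable B -> nu B = mu B.
Proof.
move=> mB; pose A : set 'rV[R]_n := eball.
have mA : measurable A by exact: measurable_eball.
have AN x : \1_A (- x) = \1_A x :> R.
  rewrite !indicE; suff -> : (- x \in A) = (x \in A) by [].
  by apply/idP/idP => /set_mem h; apply/mem_set; move: h; rewrite /A /eball/= enormN.
have mI (C : set 'rV[R]_n) d (T : measurableType d) (f : T -> 'rV[R]_n) : measurable C ->
    measurable_fun setT f -> measurable_fun setT (fun t => \1_C (f t) : R).
  by move=> mC mf; exact: (measurableT_comp (measurable_indic mC) mf).
have intI (m : {measure set 'rV[R]_n -> \bar R}) C : measurable C ->
    (\int[m]_x (\1_C x)%:E = m C)%E.
  by move=> mC; rewrite integral_indic// setIT.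
pose f (p : 'rV[R]_n * 'rV[R]_n) : \bar R := (\1_A p.1 * \1_B (p.1 + p.2))%:E.
have f0 p : (0 <= f p)%E by rewrite lee_fin mulr_ge0.
have mf : measurable_fun setT f.
  apply/measurable_EFinP; apply: measurable_funM; apply: mI => //.
  exact: measurable_rVDf.
have L : (\int[mu]_x \int[nu]_y f (x, y) = nu B * mu A)%E.
  rewrite (eq_integral (fun x => nu B * (\1_A x)%:E)%E).
    by rewrite ge0_integralZl ?intI//; apply/measurable_EFinP; exact: mI.
  move=> x _; rewrite /f/=.
  under eq_integral do rewrite EFinM.
  rewrite ge0_integralZl//; last first.
    by apply/measurable_EFinP; apply: mI => //; exact: measurable_rVDf.
  rewrite muleC; congr (_ * _)%E.
  under eq_integral do rewrite addrC.
  rewrite (mpres_integral (f := fun y => (\1_B y)%:E) (nu_shift x)) ?intI//.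
  by apply/measurable_EFinP; exact: mI.
have S : (\int[nu]_y \int[mu]_x f (x, y) =
          \int[nu]_y \int[mu]_x (\1_B x * \1_A (y - x))%:E)%E.
  apply: eq_integral => y _.
  rewrite -(mpres_integral (mu_shift y) (f := fun x => (\1_B x * \1_A (y - x))%:E))//.
    apply: eq_integral => x _.
    by rewrite /f/= mulrC (_ : y - (x + y) = - x) ?AN// opprD addrCA subrr addr0.
  apply/measurable_EFinP; apply: measurable_funM; apply: mI => //.
  exact: measurable_rVB.
have S' : (\int[nu]_y \int[mu]_x (\1_B x * \1_A (y - x))%:E =
           \int[mu]_y \int[nu]_x (\1_B y * \1_A (x - y))%:E)%E.
  clear L S; rewrite (fubini_tonelli (m1 := nu) (m2 := mu)
    (fun p => (\1_B p.2 * \1_A (p.1 - p.2))%:E))//.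
  apply/measurable_EFinP; apply: measurable_funM; apply: mI => //.
  exact: measurable_rVB.
have Q : (\int[mu]_y \int[nu]_x (\1_B y * \1_A (x - y))%:E = nu A * mu B)%E.
  clear L S S'.
  rewrite (eq_integral (fun y => nu A * (\1_B y)%:E)%E).
    by rewrite ge0_integralZl ?intI//; apply/measurable_EFinP; exact: mI.
  move=> y _; under eq_integral do rewrite EFinM.
  rewrite ge0_integralZl//; last first.
    by apply/measurable_EFinP; apply: mI => //; exact: measurable_rVB.
  rewrite muleC; congr (_ * _)%E.
  rewrite (mpres_integral (f := fun y => (\1_A y)%:E) (nu_shift (- y))) ?intI//.
  by apply/measurable_EFinP; exact: mI.
have Afin : mu A \is a fin_num by rewrite ge0_fin_numE// mu_eball_fin.
have {S S' Q}L : (nu B * mu A = nu A * mu B)%E.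
  rewrite -L -Q -S' -S.
  exact: (fubini_tonelli (m1 := mu) (m2 := nu) f).
move: L; rewrite [nu A]nu_eball [RHS]muleC => L.
apply/eqP; rewrite eq_le -(lee_pmul2r Afin mu_eball_gt0) L lexx/=.
by rewrite -(lee_pmul2r Afin mu_eball_gt0) L lexx.
Qed.

End haar.

Section isometries.
Context {R : realType} {n : nat}.
Local Notation E := 'rV[R]_n.

Section one_isometry.
Variables T Ti : E -> E.
Hypotheses (TK : cancel T Ti) (TiK : cancel Ti T) (iT : Defs.isometry T).

Lemma isometry_dot x y : dot (T x - T 0) (T y - T 0) = dot x y.
Proof.
have h a b : dot (T a - T b) (T a - T b) = dot (a - b) (a - b).
  by rewrite -!enormE2 iT.
have := h x y; have := h x 0; have := h y 0.
rewrite !subr0 (_ : T x - T y = (T x - T 0) - (T y - T 0)); last first.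
  by rewrite opprB addrA subrK.
by rewrite [in X in _ -> _ -> X -> _]dotBB (dotBB x y); lra.
Qed.

Definition isometry_frame (i : 'I_n) : E := Ti (delta_mx ord0 i + T 0).

Lemma dot_delta (x : E) i : dot x (delta_mx ord0 i) = x ord0 i.
Proof.
rewrite /dot (bigD1 i)//= big1 ?addr0 => [|j ji]; first by rewrite mxE !eqxx mulr1.
by rewrite mxE eqxx (negbTE ji) mulr0.
Qed.

(** An isometry is affine: polarization of the norm recovers the scalar products, and
    hence the coordinates. *)
Lemma isometry_coord x i : T x ord0 i = dot x (isometry_frame i) + T 0 ord0 i.
Proof.
rewrite -(isometry_dot x) /isometry_frame TiK addrK dot_delta !mxE.
by rewrite subrK.
Qed.

Lemma measurable_isometry : measurable_fun setT T.
Proof.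
apply: measurable_fun_rVP => i; under eq_fun do rewrite isometry_coord.
by apply: measurable_funD => //; exact: measurable_dotr.
Qed.

Lemma isometryD x w : T (x + w) = T x + (T w - T 0).
Proof.
apply/rowP => i; rewrite !mxE (isometry_coord (x + w)) (isometry_coord x).
by rewrite (isometry_coord w) dotDl; lra. Qed.

End one_isometry.

Lemma isometry_inv (T Ti : E -> E) : cancel Ti T -> Defs.isometry T -> Defs.isometry Ti.
Proof. by move=> TiK iT x y; rewrite -iT !TiK. Qed.

Section push.
Variables T Ti : E -> E.
Hypotheses (TK : cancel T Ti) (TiK : cancel Ti T) (iT : Defs.isometry T).

Let mT : measurable_fun setT T := measurable_isometry TiK iT.
Let mTi : measurable_fun setT Ti :=
  measurable_isometry TK (isometry_inv TiK iT).

Let push : set E -> \bar R := pushforward (lebs n) T.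

Let pushE A : push A = lebs n (T @^-1` A). Proof. by []. Qed.

Let push0 : push set0 = 0%E.
Proof. by rewrite pushE preimage_set0 measure0. Qed.

Let push_ge0 A : (0 <= push A)%E.
Proof. exact: measure_ge0. Qed.

Let push_sigma_additive : semi_sigma_additive push.
Proof.
have mpre A : measurable A -> measurable (T @^-1` A).
  by move=> mA; rewrite -[X in measurable X]setTI; exact: mT.
move=> F mF tF mUF; rewrite pushE preimage_bigcup.
apply: (@measure_semi_sigma_additive _ _ _ (lebs n)).
- by move=> k; exact: mpre.
- apply/trivIsetP => /= i j _ _ ij; rewrite -preimage_setI.
  by move/trivIsetP : tF => /(_ _ _ _ _ ij) ->//; rewrite preimage_set0.
- by rewrite -preimage_bigcup; exact: mpre.
Qed.

HB.instance Definition _ := isMeasure.Build _ _ _ push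
  push0 push_ge0 push_sigma_additive.

Let push_sf : sigma_finite setT push.
Proof.
exists (fun k => Ti @^-1` (cube n k%:R)) => [|k].
  by rewrite -preimage_bigcup cube_cover.
have -> : push (Ti @^-1` (cube n k%:R)) = lebs n (cube n k%:R).
  rewrite pushE; congr (lebs n _); apply/seteqP.
  by split => x /=; rewrite TK.
split; last by rewrite [X in (X < _)%E]leb_cube// ltry.
by rewrite -[X in measurable X]setTI; apply: mTi => //; exact: measurable_cube.
Qed.

HB.instance Definition _ := Measure_isSigmaFinite.Build _ _ _ push push_sf.

(** The image measure is again translation invariant, and it has the same value on
    the Euclidean ball. *)
Lemma isometry_mpres : mpres (lebs n) T.
Proof.
split=> // B mB; have sh := @mpres_shift R n.
apply: (@haar_unique _ _ (lebs n) push) => //; last 3 first.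
- exact: eball_gt0.
- exact: eball_fin.
- have [_ /(_ eball measurable_eball) <-] := sh (- Ti 0).
  rewrite -[LHS]/(lebs n (T @^-1` eball)); congr (lebs n _); apply/seteqP.
  by split => x /=; rewrite /eball /= -(iT x) TiK subr0.
move=> v; split; first exact: measurable_fun_rVD.
move=> A mA.
rewrite -[LHS]/(lebs n (T @^-1` _)) -[RHS]/(lebs n (T @^-1` A)).
have mTA : measurable (T @^-1` A) by rewrite -[X in measurable X]setTI; exact: mT.
have [_ /(_ _ mTA) <-] := sh (Ti (v + T 0)).
congr (lebs n _); apply/seteqP; split => x /=;
by rewrite (isometryD TiK iT) TiK addrK.
Qed.

End push.

End isometries.

(** * The kernel and the normalization constant *)
Section measure_lemmas.
Context d (T : measurableType d) (R : realType).
Variable m : {measure set T -> \bar R}.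

Lemma ge0_integral_eq0 (f : T -> \bar R) : measurable_fun setT f ->
  (forall x, 0 <= f x)%E -> (\int[m]_x f x = 0)%E ->
  {ae m, forall x, f x = 0%E}.
Proof.
move=> mf f0 If0.
have /(ae_eq_integral_abs m measurableT mf) : (\int[m]_x `|f x| = 0)%E.
  by rewrite -{}If0; apply: eq_integral => x _; rewrite gee0_abs.
by apply: filterS => x /(_ I).
Qed.

Lemma integral_gt0 (f : T -> \bar R) (S : set T) : measurable_fun setT f ->
  (forall x, 0 <= f x)%E -> measurable S -> (0 < m S)%E ->
  (forall x, S x -> 0 < f x)%E -> (0 < \int[m]_x f x)%E.
Proof.
move=> mf f0 mS S0 fS; rewrite lt_neqAle integral_ge0 ?andbT//.
apply/eqP => /esym If; have := ge0_integral_eq0 mf f0 If => {If}[[N [mN N0 hN]]].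
move: S0; rewrite lt_neqAle => /andP[/eqP + _]; apply; apply/esym.
apply: (@subset_measure0 _ _ _ m S N) => //.
by move=> x Sx; apply: hN => /= fx; have := fS x Sx; rewrite fx ltxx.
Qed.

Lemma measurable_lt_set (f h : T -> R) : measurable_fun setT f ->
  measurable_fun setT h -> measurable [set x | f x < h x].
Proof.
move=> mf mh; have := measurable_fun_ltr mf mh => /(_ measurableT [set true]).
by rewrite setTI; apply.
Qed.

Lemma measurable_le_set (f h : T -> R) : measurable_fun setT f ->
  measurable_fun setT h -> measurable [set x | f x <= h x].
Proof.
move=> mf mh; have := measurable_fun_ler mf mh => /(_ measurableT [set true]).
by rewrite setTI; apply.
Qed.

End measure_lemmas.

Section one_minus_cos.
Context {R : realType}.

Lemma sin_le_id (x : R) : 0 <= x -> `|sin x| <= x.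
Proof.
rewrite le_eqVlt => /orP[/eqP <-|x0]; first by rewrite sin0 normr0.
have [|c _] := @MVT R sin cos 0 x x0 (fun y _ => is_derive_sin y).
  by apply: continuous_subspaceT => y; exact: continuous_sin.
rewrite sin0 !subr0 => ->; rewrite normrM (gtr0_norm x0).
by rewrite ler_piMl ?(ltW x0)// cos_max.
Qed.

Lemma one_minus_cosE (x : R) : 1 - cos x = 2 * sin (x / 2) ^+ 2.
Proof.
have {1}-> : x = (x / 2) *+ 2 by rewrite -mulr_natr divfK.
by rewrite cos_mulr2n cos2sin2 mulr2n; ring.
Qed.

Lemma one_minus_cos_le (x : R) : 1 - cos x <= 2 * Num.min 1 (x ^+ 2).
Proof.
rewrite minr_pMr ?ler0n// le_min; apply/andP; split.
  by have := cos_geN1 x; lra.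
have := sin_le_id (normr_ge0 (x / 2)).
have -> : 1 - cos x = 2 * `|sin `|x / 2| | ^+ 2.
  rewrite -[in LHS]cos_norm one_minus_cosE real_normK ?num_real//.
  by rewrite normrM (ger0_norm (_ : 0 <= 2^-1 :> R)).
move=> h; rewrite ler_pM2l//.
apply: le_trans (_ : `|x / 2| ^+ 2 <= _); first by rewrite lerXn2r ?nnegrE ?normr_ge0.
rewrite real_normK ?num_real// exprMn; have := sqr_ge0 x; lra.
Qed.

End one_minus_cos.

Section kernel.
Context {R : realType} {n : nat}.
Variable s : R.
Hypotheses (s0 : 0 < s) (s1 : s < 1).
Local Notation E := 'rV[R]_n.+1.
Local Notation p := (n.+1%:R + 2 * s : R).

(** At the origin [kern] is zero, like the power that it inverts. *)
Definition kern (z : E) : R := (kernel_denom s z)^-1.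

Let p_gt0 : 0 < p.
Proof. by rewrite ltr_wpDl ?mulr_gt0. Qed.

Lemma kernE z : kern z = enorm z `^ (- p).
Proof. by rewrite powRN. Qed.

Lemma kern_ge0 z : 0 <= kern z.
Proof. by rewrite kernE powR_ge0. Qed.

Lemma kern0 : kern 0 = 0.
Proof. by rewrite /kern /kernel_denom enorm0 powR0 ?invr0// gt_eqF. Qed.

Lemma kernN z : kern (- z) = kern z.
Proof. by rewrite /kern /kernel_denom enormN. Qed.

Lemma enorm_gt0 (z : E) : z != 0 -> 0 < enorm z.
Proof.
move=> z0; rewrite lt_neqAle enorm_ge0 andbT eq_sym.
by apply: contra z0 => /eqP /enorm_eq0 ->.
Qed.

Lemma kern_gt0 z : z != 0 -> 0 < kern z.
Proof. by move=> /enorm_gt0 z0; rewrite kernE powR_gt0. Qed.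

Lemma kern_le_pow z r : 0 < r -> r <= enorm z -> kern z <= r `^ (- p).
Proof.
move=> r0 rz; rewrite /kern /kernel_denom powRN lef_pV2 ?posrE ?powR_gt0//.
  by rewrite ge0_ler_powR ?nnegrE ?enorm_ge0 ?(ltW r0)// ltW.
exact: lt_le_trans rz.
Qed.

Lemma kern_le z w : z != 0 -> enorm z <= enorm w -> kern w <= kern z.
Proof. by move=> /enorm_gt0 z0 zw; rewrite [leRHS]kernE kern_le_pow. Qed.

Lemma kern_lt z w : z != 0 -> enorm z < enorm w -> kern w < kern z.
Proof.
move=> /enorm_gt0 z0 zw; rewrite /kern /kernel_denom.
have w0 : 0 < enorm w by exact: lt_trans zw.
by rewrite ltf_pV2 ?posrE ?powR_gt0// gt0_ltr_powR// nnegrE ltW.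
Qed.

Lemma measurable_kern d (T : measurableType d) (f : T -> E) :
  measurable_fun setT f -> measurable_fun setT (fun t => kern (f t)).
Proof.
move=> mf; under eq_fun do rewrite kernE.
by apply: (measurableT_comp (measurable_powR (- p))); exact: measurable_enorm.
Qed.

(** Both [1 - cos] and the squared increments of bounded Lipschitz functions are
    dominated by this density. *)
Definition trunc_moment (z : E) : R := Num.min 1 (dot z z) * kern z.

Lemma trunc_moment_ge0 z : 0 <= trunc_moment z.
Proof. by rewrite mulr_ge0 ?kern_ge0// le_min ler01 dot_ge0. Qed.

Lemma measurable_trunc_moment : measurable_fun setT trunc_moment.
Proof.
apply: measurable_funM; last exact: measurable_kern.
by apply: measurable_minr => //; exact: measurable_dot.
Qed.

(* On the dyadic shell of size 2^k the kernel is of order 2^(-kp) and the volume is of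
   order 2^(k(n+1)), so that the outer shells give a geometric series of ratio
   2^(-2s); the inner ones, with the factor |z|^2, one of ratio 2^(-(2-2s)). *)
Let outer k : set E := cube n.+1 (2 ^+ k.+1) `\` cube n.+1 (2 ^+ k).
Let inner k : set E := cube n.+1 (2 ^- k) `\` cube n.+1 (2 ^- k.+1).

Let Mo k : R := (2 ^+ k) `^ (- p).
Let Mi k : R := n.+1%:R * (2 ^- k) ^+ 2 * (2 ^- k.+1) `^ (- p).

Let mcube r : measurable (cube n.+1 r : set E) := @measurable_cube R n.+1 r.

Let mouter k : measurable (outer k). Proof. exact: measurableD. Qed.
Let minner k : measurable (inner k). Proof. exact: measurableD. Qed.

Let not_cube_le (z : E) r : 0 <= r -> ~ cube n.+1 r z -> r <= enorm z.
Proof.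
move=> r0; apply: contra_notT; rewrite -ltNge => zr i.
exact: le_lt_trans (coord_le_enorm _ _) zr.
Qed.

Let outer_bound k z : outer k z -> trunc_moment z <= Mo k.
Proof.
move=> [_ nz]; rewrite -[leRHS]mul1r; apply: ler_pM; rewrite ?kern_ge0//.
- by rewrite le_min ler01 dot_ge0.
- by rewrite ge_min lexx.
- by apply: kern_le_pow; rewrite ?exprn_gt0//; exact: not_cube_le.
Qed.

Let inner_bound k z : inner k z -> trunc_moment z <= Mi k.
Proof.
move=> [cz nz]; apply: ler_pM; rewrite ?kern_ge0//.
- by rewrite le_min ler01 dot_ge0.
- rewrite ge_min; apply/orP; right.
  by apply: enorm_lt_sup => [|i]; [|apply/ltW; exact: cz].
- by apply: kern_le_pow; rewrite ?invr_gt0 ?exprn_gt0//; exact: not_cube_le.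
Qed.

Let cover z : z != 0 -> exists k, outer k z \/ inner k z.
Proof.
move=> z0; have [cz|ncz] := pselect (cube n.+1 1 z).
  have ex : exists k, ~~ `[< cube n.+1 (2 ^- k) z >].
    have [i zi] : exists i, z ord0 i != 0.
      apply/existsP; apply: contraNT z0 => /existsPn h.
      by apply/eqP/rowP => i; rewrite mxE; apply/eqP; have := h i; rewrite negbK.
    exists (Num.truncn (`|z ord0 i|^-1)); apply/asboolPn => /(_ i).
    apply/negP; rewrite -leNgt invf_ple ?posrE ?exprn_gt0 ?normr_gt0//.
    apply: le_trans (ltW (truncnS_gt _)) _.
    by rewrite -natrX ler_nat ltn_expl.
  case: (ex_minnP ex) => -[|k] /asboolPn h mink; first by case: h; rewrite expr0 invr1.
  exists k; right; split => //.
  by apply: contrapT => /asboolPn /mink; rewrite ltnn.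
have ex : exists k, `[< cube n.+1 (2 ^+ k) z >].
  have [k _ zk] : (\bigcup_k cube n.+1 (k%:R : R)) z by rewrite cube_cover.
  exists k; apply/asboolP => i; apply: lt_le_trans (zk i) _.
  by rewrite -natrX ler_nat ltnW// ltn_expl.
case: (ex_minnP ex) => -[|k] /asboolP h mink; first by case: ncz; rewrite expr0 in h.
exists k; left; split => //.
by move/asboolP/mink; rewrite ltnn.
Qed.

Let powRX (a x : R) k : 0 <= a -> (a ^+ k) `^ x = (a `^ x) ^+ k.
Proof. by move=> a0; rewrite -(powR_mulrn k a0) powRAC powR_mulrn// powR_ge0. Qed.

Let ro : R := 2 `^ (- (2 * s)).
Let ri : R := 2^-1 `^ (2 - 2 * s).
Let Co : R := 4 ^+ n.+1.
Let Ci : R := n.+1%:R * 2^-1 `^ (- p) * 2 ^+ n.+1.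

Let outer_term k : Mo k * (2 ^+ k.+1 *+ 2) ^+ n.+1 = Co * ro ^+ k.
Proof.
rewrite /Mo /ro /Co -powRX//; set a := 2 ^+ k.
have a0 : 0 < a by rewrite exprn_gt0.
have -> : 2 ^+ k.+1 *+ 2 = a * 4 :> R by rewrite exprS -/a -mulr_natr; ring.
rewrite exprMn -[a ^+ n.+1]powR_mulrn ?(ltW a0)// mulrA -powRD; last first.
  by apply/implyP => _; rewrite gt_eqF.
by rewrite [LHS]mulrC; congr (_ * _ `^ _); ring.
Qed.

Let inner_term k : Mi k * (2 ^- k *+ 2) ^+ n.+1 = Ci * ri ^+ k.
Proof.
rewrite /Mi /ri /Ci -powRX// [2^-1 ^+ k]exprVn.
have -> : 2 ^- k.+1 = 2 ^- k * 2^-1 :> R by rewrite exprSr invfM.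
set a := 2 ^- k; have a0 : 0 < a by rewrite invr_gt0 exprn_gt0.
rewrite powRM ?(ltW a0)//.
rewrite -[a *+ 2]mulr_natr exprMn -[a ^+ n.+1]powR_mulrn ?(ltW a0)//.
rewrite -[a ^+ 2]powR_mulrn ?(ltW a0)//.
have -> : a `^ (2 - 2 * s) = a `^ 2 * a `^ (- p) * a `^ n.+1%:R.
  rewrite -!powRD; try by apply/implyP => _; rewrite gt_eqF.
  by congr (_ `^ _); ring.
ring.
Qed.

Let ro1 : 0 < ro < 1.
Proof.
rewrite powR_gt0//= /ro powRN invf_lt1 ?powR_gt0//.
by rewrite /powR gt_eqF// expR_gt1 !mulr_gt0// ln_gt0// ltr1n.
Qed.

Let ri1 : 0 < ri < 1.
Proof.
rewrite powR_gt0 ?invr_gt0//= /ri /powR gt_eqF ?invr_gt0// expR_lt1.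
rewrite pmulr_rlt0; last by rewrite subr_gt0 gtr_pMr.
by rewrite ln_lt0// invr_gt0 ltr0n/= invf_lt1// ltr1n.
Qed.

Let sum_geo (C r : R) : 0 <= C -> 0 < r < 1 ->
  (\sum_(0 <= k <oo) (C * r ^+ k)%:E < +oo)%E.
Proof.
move=> C0 /andP[r0 r1].
apply: (@le_lt_trans _ _ (C * (1 - r)^-1)%:E); last exact: ltry.
apply: lime_le.
  by apply: is_cvg_nneseries => k _ _; rewrite lee_fin mulr_ge0// exprn_ge0// ltW.
apply: nearW => k; rewrite sumEFin lee_fin.
have := @geometric_le_lim R k C r C0 r0; rewrite gtr0_norm// => /(_ r1).
by rewrite /series/=.
Qed.

Let mle (A : set E) r : measurable A -> 0 <= r -> A `<=` cube n.+1 r ->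
  (lebs n.+1 A <= ((r *+ 2) ^+ n.+1)%:E)%E.
Proof.
move=> mA r0 Ar; rewrite -(leb_cube n.+1 r0).
by apply: (@le_measure _ _ _ (lebs n.+1)); rewrite ?inE.
Qed.

Lemma trunc_moment_fin : (\int[lebs n.+1]_z (trunc_moment z)%:E < +oo)%E.
Proof.
pose h k z : \bar R := ((Mo k * \1_(outer k) z)%:E + (Mi k * \1_(inner k) z)%:E)%E.
have Mo0 k : 0 <= Mo k by exact: powR_ge0.
have Mi0 k : 0 <= Mi k by rewrite !mulr_ge0 ?powR_ge0// exprn_ge0.
have h0 k z : (0 <= h k z)%E by rewrite adde_ge0// lee_fin mulr_ge0.
have mI (A : set E) (c : R) : measurable A ->
    measurable_fun setT (fun z => (c * \1_A z)%:E).
  by move=> mA; apply/measurable_EFinP; apply: measurable_funM => //;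
    exact: measurable_indic.
have mh k : measurable_fun setT (h k) by apply: emeasurable_funD; exact: mI.
apply: (@le_lt_trans _ _ (\int[lebs n.+1]_z (\sum_(0 <= k <oo) h k z))%E).
  apply: ge0_le_integral => //.
  - by move=> z _; rewrite lee_fin trunc_moment_ge0.
  - by apply/measurable_EFinP; exact: measurable_trunc_moment.
  - apply: ge0_emeasurable_sum => // k z _ _; exact: h0.
  move=> z _; have [->|z0] := eqVneq z 0.
    by rewrite /trunc_moment kern0 mulr0 nneseries_ge0.
  have [k hk] := cover z0.
  apply: le_trans (nneseries_lim_ge k.+1 _); last by move=> *; exact: h0.
  rewrite big_nat_recr//= -[leLHS]add0e; apply: leeD; first exact: sume_ge0.
  rewrite /h; case: hk => hk; rewrite !indicE (mem_set hk) mulr1.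
    apply: (@le_trans _ _ ((Mo k)%:E + 0)%E).
      by rewrite adde0 lee_fin outer_bound.
    by rewrite leeD2l// lee_fin mulr_ge0.
  apply: (@le_trans _ _ (0 + (Mi k)%:E)%E).
    by rewrite add0e lee_fin inner_bound.
  by rewrite leeD2r// lee_fin mulr_ge0.
rewrite integral_nneseries//.
apply: (@le_lt_trans _ _ (\sum_(0 <= k <oo) ((Co * ro ^+ k)%:E + (Ci * ri ^+ k)%:E))%E).
  apply: lee_nneseries => [k _ _|k _]; first exact: integral_ge0.
  have iI (A : set E) (c : R) : measurable A -> 0 <= c ->
      (\int[lebs n.+1]_z (c * \1_A z)%:E = c%:E * lebs n.+1 A)%E.
    move=> mA c0; under eq_integral do rewrite EFinM.
    by rewrite ge0_integralZl// ?integral_indic ?setIT//;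
      apply/measurable_EFinP; exact: measurable_indic.
  rewrite ge0_integralD//; try exact: mI; try by move=> z _; rewrite lee_fin mulr_ge0.
  rewrite !iI// -outer_term -inner_term !EFinM.
  apply: leeD; apply: lee_wpmul2l; rewrite ?lee_fin//.
    by apply: mle => // z [].
  by apply: mle => // z [].
have ge0 (C r : R) : 0 <= C -> 0 < r < 1 -> forall k, (0 <= (C * r ^+ k)%:E)%E.
  by move=> C0 /andP[r0 _] k; rewrite lee_fin mulr_ge0// exprn_ge0// ltW.
have Co0 : 0 <= Co by exact: exprn_ge0.
have Ci0 : 0 <= Ci by rewrite !mulr_ge0 ?powR_ge0// exprn_ge0.
rewrite nneseriesD//; try by move=> *; apply: ge0.
by rewrite lte_add_pinfty// sum_geo.
Qed.

(** The integral that is inverted in the definition is finite by comparison with the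
    truncated second moment, and positive because its integrand is positive on a cube. *)
Lemma frac_const_gt0 : 0 < @frac_const R n s.
Proof.
rewrite /frac_const invr_gt0 /Rintegral.
pose f (z : E) : \bar R := ((1 - cos (z ord0 ord0)) * kern z)%:E.
rewrite -[X in fine X]/(\int[lebs n.+1]_z f z)%E.
have mc : measurable_fun setT (fun z : E => 1 - cos (z ord0 ord0)).
  apply: measurable_funB => //; apply: measurableT_comp.
    by apply: continuous_measurable_fun; exact: continuous_cos.
  exact: measurable_rV_coord.
have mf : measurable_fun setT f.
  by apply/measurable_EFinP; apply: measurable_funM => //; exact: measurable_kern.
have f0 z : (0 <= f z)%E.
  by rewrite lee_fin mulr_ge0 ?kern_ge0// subr_ge0 cos_le1.
apply: fine_gt0; apply/andP; split; last first.
  apply: (@le_lt_trans _ _ (\int[lebs n.+1]_z (2%:E * (trunc_moment z)%:E))%E).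
    apply: ge0_le_integral => //.
      apply: emeasurable_funM => //.
      by apply/measurable_EFinP; exact: measurable_trunc_moment.
    move=> z _; rewrite -EFinM lee_fin /trunc_moment mulrA ler_wpM2r ?kern_ge0//.
    apply: le_trans (one_minus_cos_le _) _; rewrite ler_pM2l//.
    rewrite le_min ge_min lexx/= ge_min; apply/orP; right.
    rewrite -enormE2 -real_normK ?num_real// lerXn2r ?nnegrE ?enorm_ge0//.
    exact: coord_le_enorm.
  rewrite ge0_integralZl//; last 2 first.
  - by apply/measurable_EFinP; exact: measurable_trunc_moment.
  - by move=> z _; rewrite lee_fin trunc_moment_ge0.
  by rewrite lte_mul_pinfty// trunc_moment_fin.
(* On the cube of half-side 1/4 about (3/4, .., 3/4) the sine of z_1 / 2 is positive. *)
pose v : E := const_mx (- (3 / 4)).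
have [msh vsh] := mpres_shift v.
apply: (integral_gt0 (S := (fun x => x + v) @^-1` (cube n.+1 (1 / 4)))) => //.
- by rewrite -[X in measurable X]setTI; apply: msh.
- rewrite vsh// [X in (_ < X)%E]leb_cube; last by lra.
  by rewrite lte_fin exprn_gt0//; lra.
move=> z /(_ ord0); rewrite !mxE => /ltr_normlP[h1 h2].
have z0 : z != 0 by apply/eqP => z0; move: h1; rewrite z0 mxE; lra.
rewrite lte_fin mulr_gt0 ?kern_gt0// one_minus_cosE mulr_gt0// exprn_gt0//.
apply: sin2_gt0; apply/andP; split; lra.
Qed.

End kernel.

(** * The energy *)
Section energy.
Context {R : realType} {n : nat}.
Variable s : R.
Hypotheses (s0 : 0 < s) (s1 : s < 1).
Local Notation E := 'rV[R]_n.+1.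
Local Notation mu := (@lebs R n.+1).
Local Notation mu2 := ((@lebs R n.+1) \x (@lebs R n.+1))%E.
Local Notation K := (kern s).
Implicit Types w v phi : E -> R.

Definition energy (w : E -> R) : \bar R :=
  (\int[mu]_x \int[mu]_y (`|w x - w y| ^+ 2 / kernel_denom s (x - y))%:E)%E.

Definition edens (w : E -> R) (p : E * E) : R :=
  (w p.1 - w p.2) ^+ 2 * K (p.1 - p.2).

Lemma edens_ge0 w p : 0 <= edens w p.
Proof. by rewrite mulr_ge0 ?sqr_ge0// kern_ge0. Qed.

Lemma measurable_diff : measurable_fun setT (fun p : E * E => p.1 - p.2).
Proof. exact: measurable_rVB. Qed.

Lemma measurable_edens w : measurable_fun setT w ->
  measurable_fun setT (edens w).
Proof.
move=> mw; apply: measurable_funM.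
  apply: measurable_funX; apply: measurable_funB;
  exact: (measurableT_comp mw).
by apply: measurable_kern; exact: measurable_diff.
Qed.

Lemma energyE w : measurable_fun setT w ->
  energy w = (\int[mu2]_p (edens w p)%:E)%E.
Proof.
move=> mw.
have me : measurable_fun setT (fun p => (edens w p)%:E).
  by apply/measurable_EFinP; exact: measurable_edens.
have e0 p : (0 <= (edens w p)%:E)%E by rewrite lee_fin edens_ge0.
rewrite (fubini_tonelli1 _ me e0).
apply: eq_integral => x _; apply: eq_integral => y _.
by rewrite real_normK ?num_real.
Qed.

Lemma energy_ge0 w : (0 <= energy w)%E.
Proof.
apply: integral_ge0 => x _; apply: integral_ge0 => y _.
by rewrite lee_fin divr_ge0 ?sqr_ge0// powR_ge0.
Qed.

Lemma energy_le w v : measurable_fun setT w -> measurable_fun setT v ->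
  (forall x y, `|w x - w y| <= `|v x - v y|) -> (energy w <= energy v)%E.
Proof.
move=> mw mv wv; rewrite !energyE//; apply: ge0_le_integral => //.
- by move=> p _; rewrite lee_fin edens_ge0.
- by apply/measurable_EFinP; exact: measurable_edens.
- by apply/measurable_EFinP; exact: measurable_edens.
move=> p _; rewrite lee_fin ler_wpM2r ?kern_ge0//.
by rewrite -(real_normK (num_real (w _ - _))) -(real_normK (num_real (v _ - _)))
  lerXn2r ?nnegrE ?normr_ge0.
Qed.

(** In additive form, because energies may be infinite and cannot be subtracted. *)
Lemma energy_addl_le w1 w2 (G F : E * E -> R) :
  measurable_fun setT w1 -> measurable_fun setT w2 ->
  measurable_fun setT G -> (forall p, 0 <= G p) ->
  measurable_fun setT F -> (forall p, 0 <= F p) ->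
  (forall p, edens w1 p + G p <= edens w2 p + F p) ->
  (energy w1 + \int[mu2]_p (G p)%:E <= energy w2 + \int[mu2]_p (F p)%:E)%E.
Proof.
move=> m1 m2 mG G0 mF F0 le; rewrite !energyE//.
have me w : measurable_fun setT w -> measurable_fun setT (fun p => (edens w p)%:E).
  by move=> mw; apply/measurable_EFinP; exact: measurable_edens.
have mGE : measurable_fun setT (fun p => (G p)%:E) by exact/measurable_EFinP.
have mFE : measurable_fun setT (fun p => (F p)%:E) by exact/measurable_EFinP.
have e0 w p : setT p -> (0 <= (edens w p)%:E)%E by rewrite lee_fin edens_ge0.
have G0E p : setT p -> (0 <= (G p)%:E)%E by rewrite lee_fin.
have F0E p : setT p -> (0 <= (F p)%:E)%E by rewrite lee_fin.
rewrite -(ge0_integralD mu2 measurableT (e0 w1) (me _ m1) G0E mGE).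
rewrite -(ge0_integralD mu2 measurableT (e0 w2) (me _ m2) F0E mFE).
apply: ge0_le_integral => //.
- by move=> p _; rewrite -EFinD lee_fin addr_ge0 ?edens_ge0.
- by apply: emeasurable_funD => //; exact: me.
- by apply: emeasurable_funD => //; exact: me.
- by move=> p _; rewrite -!EFinD lee_fin.
Qed.

Section double_invariance.
Variable sg : E -> E.
Hypothesis msg : mpres mu sg.
Variable f : E * E -> \bar R.
Hypotheses (mf : measurable_fun setT f) (f0 : forall p, (0 <= f p)%E).

Lemma mpres_integral2l :
  (\int[mu2]_p f (sg p.1, p.2) = \int[mu2]_p f p)%E.
Proof.
have m1 : measurable_fun setT (fun p : E * E => (sg p.1, p.2)).
  apply: measurable_fun_pair => //.
  by apply: (measurableT_comp (proj1 msg)).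
rewrite (fubini_tonelli1 (fun p => f (sg p.1, p.2)) (measurableT_comp mf m1)
  (fun p => f0 _)).
rewrite (fubini_tonelli1 f mf f0).
apply: (mpres_integral msg (f := fun x => \int[mu]_y f (x, y))%E).
  exact: measurable_fun_fubini_tonelli_F.
by move=> x; exact: integral_ge0.
Qed.

Lemma mpres_integral2r :
  (\int[mu2]_p f (p.1, sg p.2) = \int[mu2]_p f p)%E.
Proof.
have m1 : measurable_fun setT (fun p : E * E => (p.1, sg p.2)).
  apply: measurable_fun_pair => //.
  by apply: (measurableT_comp (proj1 msg)).
rewrite (fubini_tonelli1 (fun p => f (p.1, sg p.2)) (measurableT_comp mf m1)
  (fun p => f0 _)).
rewrite (fubini_tonelli1 f mf f0).
apply: eq_integral => x _.
apply: (mpres_integral msg (f := fun y => f (x, y))) => //.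
exact: (measurableT_comp mf).
Qed.

End double_invariance.

(** The squared increments are at most a multiple of the numerator of the truncated
    second moment, which bounds the contribution of each point of [Om] uniformly. *)
Lemma energy_lipschitz (Om : set E) (phi : E -> R) (L : R) :
  measurable Om -> (mu Om < +oo)%E -> measurable_fun setT phi ->
  (forall x, 0 <= phi x <= 1) -> (forall x, ~ Om x -> phi x = 0) ->
  0 <= L -> (forall x y, `|phi x - phi y| <= L * enorm (x - y)) ->
  (energy phi < +oo)%E.
Proof.
move=> mO fO mphi p01 pO L0 pL; rewrite energyE//.
pose C := Num.max 1 (L ^+ 2).
have C0 : 0 <= C by rewrite le_max ler01.
pose F (p : E * E) : \bar R := (C * trunc_moment s (p.1 - p.2))%:E.
have mtm : measurable_fun setT (fun p : E * E => trunc_moment s (p.1 - p.2)).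
  by apply: measurableT_comp; [exact: measurable_trunc_moment|exact: measurable_diff].
have mF : measurable_fun setT F.
  by apply/measurable_EFinP; exact: measurable_funM.
have F0 p : (0 <= F p)%E by rewrite lee_fin mulr_ge0// trunc_moment_ge0.
have dens_le p : ((edens phi p)%:E <= F p)%E.
  case: p => x y; rewrite lee_fin /edens /trunc_moment/= mulrA ler_wpM2r ?kern_ge0//.
  rewrite minr_pMr// mulr1 le_min; apply/andP; split.
    rewrite le_max; apply/orP; left; rewrite -real_normK ?num_real// exprn_ile1//.
    rewrite ler_norml; have /andP[? ?] := p01 x; have /andP[? ?] := p01 y.
    by apply/andP; split; lra.
  apply: (@le_trans _ _ (L ^+ 2 * dot (x - y) (x - y))); last first.
    by rewrite ler_wpM2r ?dot_ge0// le_max lexx orbT.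
  rewrite -enormE2 -exprMn -real_normK ?num_real// lerXn2r ?nnegrE//.
  by rewrite mulr_ge0// enorm_ge0.
have mI1 : measurable_fun setT (fun p : E * E => \1_Om p.1 : R).
  by apply: (measurableT_comp (measurable_indic mO)).
have mI2 : measurable_fun setT (fun p : E * E => \1_Om p.2 : R).
  by apply: (measurableT_comp (measurable_indic mO)).
apply: (@le_lt_trans _ _ (\int[mu2]_p (F p * (\1_Om p.1)%:E + F p * (\1_Om p.2)%:E))%E).
  apply: ge0_le_integral => //.
  - by move=> p _; rewrite lee_fin edens_ge0.
  - by apply/measurable_EFinP; exact: measurable_edens.
  - by apply: emeasurable_funD; apply: emeasurable_funM => //; exact/measurable_EFinP.
  case=> x y _; rewrite !indicE /=.
  have Fp : (0 <= F (x, y))%E by [].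
  have [Ox|nOx] := boolP (x \in Om).
    by rewrite mule1 (le_trans (dens_le _))// leeDl// mule_ge0// lee_fin.
  have [Oy|nOy] := boolP (y \in Om).
    by rewrite mule1 (le_trans (dens_le _))// leeDr// mule_ge0// lee_fin.
  rewrite notin_setE in nOx; rewrite notin_setE in nOy.
  by rewrite /edens/= !pO// subrr expr0n mul0r !mule0 adde0.
have FN (x y : E) : F (y, x) = F (x, y).
  by rewrite /F/= -opprB /trunc_moment dotNl dotNr opprK kernN.
have bd : (\int[mu]_x \int[mu]_y (F (x, y) * (\1_Om x)%:E) < +oo)%E.
  have tmN (z : E) : trunc_moment s (- z) = trunc_moment s z :> R.
    by rewrite /trunc_moment dotNl dotNr opprK kernN.
  pose I := (\int[mu]_z (trunc_moment s z)%:E)%E.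
  have I0 : (0 <= I)%E.
    by apply: integral_ge0 => z _; rewrite lee_fin trunc_moment_ge0.
  have CI0 : (0 <= C%:E * I)%E by rewrite mule_ge0.
  rewrite (eq_integral (fun x => (C%:E * I) * (\1_Om x)%:E)%E).
    have mO1 : measurable_fun setT (fun x => (\1_Om x)%:E : \bar R).
      by apply/measurable_EFinP; exact: measurable_indic.
    rewrite ge0_integralZl// integral_indic// setIT lte_mul_pinfty//.
    by rewrite fin_numM// ge0_fin_numE//; exact: trunc_moment_fin.
  move=> x _.
  have mtx : measurable_fun setT (fun y : E => (trunc_moment s (x - y))%:E).
    apply/measurable_EFinP; apply: measurableT_comp.
      exact: measurable_trunc_moment.
    exact: measurable_rVB.
  have mtz : measurable_fun setT (fun z : E => (trunc_moment s z)%:E).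
    by apply/measurable_EFinP; exact: measurable_trunc_moment.
  have t0 (z : E) : (0 <= (trunc_moment s z)%:E)%E by rewrite lee_fin trunc_moment_ge0.
  have Ix : (\int[mu]_y (trunc_moment s (x - y))%:E = I)%E.
    rewrite /I -(mpres_integral (mpres_shift (- x)) mtz t0).
    by apply: eq_integral => y _; rewrite -tmN opprB.
  transitivity (\int[mu]_y ((C * \1_Om x)%:E * (trunc_moment s (x - y))%:E))%E.
    apply: eq_integral => y _; rewrite /F -!EFinM/=; congr EFin; ring.
  have c0 : (0 <= (C * \1_Om x)%:E)%E by rewrite lee_fin mulr_ge0.
  rewrite (ge0_integralZl mu measurableT mtx (fun y _ => t0 _) c0) Ix EFinM.
  by rewrite -!muleA (muleC I).
have mFI1 : measurable_fun setT (fun p => F p * (\1_Om p.1)%:E)%E.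
  by apply: emeasurable_funM => //; exact/measurable_EFinP.
have mFI2 : measurable_fun setT (fun p => F p * (\1_Om p.2)%:E)%E.
  by apply: emeasurable_funM => //; exact/measurable_EFinP.
have FI1 p : (0 <= F p * (\1_Om p.1)%:E)%E by rewrite mule_ge0// lee_fin.
have FI2 p : (0 <= F p * (\1_Om p.2)%:E)%E by rewrite mule_ge0// lee_fin.
rewrite (ge0_integralD mu2 measurableT (fun p _ => FI1 p) mFI1 (fun p _ => FI2 p) mFI2).
rewrite (fubini_tonelli1 _ mFI1 FI1) (fubini_tonelli2 _ mFI2 FI2).
rewrite [X in (_ + X)%E](_ : _ = \int[mu]_x \int[mu]_y (F (x, y) * (\1_Om x)%:E))%E.
  exact: lte_add_pinfty.
apply: eq_integral => y _; apply: eq_integral => x _ /=.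
by rewrite FN.
Qed.

End energy.

(** * Real integrals and exchange of points *)
Section real_integrals.
Context d (T : measurableType d) (R : realType).
Variable m : {measure set T -> \bar R}.
Implicit Types f h b : T -> R.

Definition rintegrable f := m.-integrable setT (EFin \o f).

Lemma rintegrable_measurable f : rintegrable f -> measurable_fun setT f.
Proof. by move=> /measurable_int /measurable_EFinP. Qed.

Lemma rintegrable_le f h : measurable_fun setT f ->
  (forall x, `|f x| <= `|h x|) -> rintegrable h -> rintegrable f.
Proof.
move=> mf fh ih; apply: (le_integrable measurableT _ _ ih).
  exact/measurable_EFinP.
by move=> x _; rewrite /= lee_fin.
Qed.

Lemma rintegrableD f h : rintegrable f -> rintegrable h ->
  rintegrable (fun x => f x + h x).
Proof. by move=> fi hi; have := integrableD measurableT fi hi. Qed.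

Lemma rintegrableZ (k : R) f : rintegrable f -> rintegrable (fun x => k * f x).
Proof. by move=> fi; have := integrableZl measurableT k fi. Qed.

Lemma rintegrableM h b (M : R) : rintegrable h -> measurable_fun setT b ->
  (forall x, `|b x| <= M) -> rintegrable (fun x => h x * b x).
Proof.
move=> ih mb bM; apply: (rintegrable_le (h := fun x => M * h x)).
- by apply: measurable_funM => //; exact: rintegrable_measurable.
- move=> x; rewrite !normrM mulrC ler_wpM2r// (le_trans (bM x))//.
  exact: ler_norm.
- exact: rintegrableZ.
Qed.

Lemma rintegrable_mpres tau f : mpres m tau -> rintegrable f ->
  rintegrable (fun x => f (tau x)).
Proof.
move=> mt fi; have mf := rintegrable_measurable fi.
apply/integrableP; split.
  by apply/measurable_EFinP; apply: (measurableT_comp mf); exact: (proj1 mt).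
have mfn : measurable_fun setT (fun x => `|(f x)%:E|%E).
  by apply: measurableT_comp => //; exact/measurable_EFinP.
rewrite (mpres_integral mt mfn)//.
by have /integrableP[] := fi.
Qed.

Lemma Rintegral_mpres tau f : mpres m tau -> rintegrable f ->
  \int[m]_x f (tau x) = \int[m]_x f x.
Proof.
move=> mt fi; have mf := measurable_int _ fi; rewrite /Rintegral; congr fine.
rewrite integralE [RHS]integralE; congr (_ - _)%E.
  rewrite -[RHS](mpres_integral mt (measurable_funepos mf) (funepos_ge0 (EFin \o f))).
  by apply: eq_integral => x _; rewrite /= !funeposE.
rewrite -[RHS](mpres_integral mt (measurable_funeneg mf) (funeneg_ge0 (EFin \o f))).
by apply: eq_integral => x _; rewrite /= !funenegE.
Qed.

(** Both integrals are invariant under [tau], so that it suffices to compare the sums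
    over pairs of points. *)
Lemma le_Rintegral_sym tau f h : mpres m tau -> rintegrable f -> rintegrable h ->
  (forall x, f x + f (tau x) <= h x + h (tau x)) ->
  \int[m]_x f x <= \int[m]_x h x.
Proof.
move=> mt fi hi le; rewrite -(ler_pMn2r (ltn0Sn 1)) !mulr2n.
rewrite -{2}(Rintegral_mpres mt fi) -{2}(Rintegral_mpres mt hi).
rewrite -!RintegralD//; try exact: rintegrable_mpres.
by apply: le_Rintegral => //; apply: rintegrableD => //; exact: rintegrable_mpres.
Qed.

End real_integrals.

Section swapping.
Context d (T : measurableType d) (R : realType).
Variable m : {measure set T -> \bar R}.
Variables (sg : T -> T) (S : set T).
Hypotheses (msg : mpres m sg) (mS : measurable S).
Hypothesis S_sg : forall x, S (sg x) <-> S x.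

(** The competing weights are obtained by composition with these maps, which preserve
    the measure when [sg] does and [S] is invariant. *)
Definition swap (x : T) : T := if `[< S x >] then sg x else x.

Lemma swap_in x : S x -> swap x = sg x.
Proof. by move=> Sx; rewrite /swap asboolT. Qed.

Lemma swap_out x : ~ S x -> swap x = x.
Proof. by move=> Sx; rewrite /swap asboolF. Qed.

Let swap_preimage A : swap @^-1` A = sg @^-1` (A `&` S) `|` (A `\` S).
Proof.
apply/seteqP; split => x /=; have [Sx|nSx] := pselect (S x).
- by rewrite swap_in// => Ax; left; split => //; exact/S_sg.
- by rewrite swap_out// => Ax; right.
- by rewrite swap_in// => -[[]|[]].
- by rewrite swap_out// => -[[_ /S_sg]|[]].
Qed.

Lemma mpres_swap : mpres m swap.
Proof.
have mpre A : measurable A -> measurable (sg @^-1` A).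
  by move=> mA; rewrite -[X in measurable X]setTI; apply: (proj1 msg).
split=> [_ A mA|A mA].
  rewrite setTI swap_preimage; apply: measurableU; last exact: measurableD.
  by apply: mpre; exact: measurableI.
rewrite swap_preimage measureU//.
- rewrite (measureDI m mA mS) addeC; congr (_ + _)%E.
  by apply: (proj2 msg); exact: measurableI.
- by apply: mpre; exact: measurableI.
- exact: measurableD.
- by apply/seteqP; split => x //= [[_ /S_sg Sx] [_]].
Qed.

End swapping.

(** * Optimal pairs *)
Section optimal_pair.
Context {R : realType} {n : nat}.
Variable s : R.
Local Notation E := 'rV[R]_n.+1.
Local Notation mu := (@lebs R n.+1).
Local Notation mu2 := ((@lebs R n.+1) \x (@lebs R n.+1))%E.
Local Notation K := (kern s).

Definition mass (h w : E -> R) : R := \int[mu]_x (h x * w x ^+ 2).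

Definition en (w : E -> R) : R := fine (energy s w).

(** Boundedness makes the weighted mass finite for every integrable weight. *)
Record test_fun (Om : set E) (w : E -> R) : Prop := TestFun {
  tf_meas : measurable_fun setT w;
  tf_bnd : exists M, forall x, `|w x| <= M;
  tf_out : forall x, ~ Om x -> w x = 0;
  tf_fin : (energy s w < +oo)%E }.

Definition cutoff (u : E -> R) (k : nat) (x : E) : R := Num.min (u x) k%:R.

(** What minimality of the weight and of the Rayleigh quotient say about the pair
    [(g, u)]. The quotient bound holds for all weights [g \o tau] at once, because these
    are rearrangements of [g]; equality for [u] is recorded through its bounded
    truncations, on which the mass of every integrable weight is finite. *)
Record optimal_pair (Om : set E) (g u : E -> R) (lam c : R) : Prop := OptimalPair {
  op_mO : measurable Om;
  op_fO : (mu Om < +oo)%E;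
  op_ig : rintegrable mu g;
  op_gout : forall x, ~ Om x -> g x = 0;
  op_mu : measurable_fun setT u;
  op_u0 : forall x, 0 <= u x;
  op_uout : forall x, ~ Om x -> u x = 0;
  op_ufin : (energy s u < +oo)%E;
  op_lam : 0 < lam;
  op_c : 0 < c;
  op_min : forall tau, mpres mu tau -> (forall x, Om (tau x) <-> Om x) ->
    forall w, test_fun Om w -> lam * mass (fun x => g (tau x)) w <= c * en w;
  op_attained : forall e, 0 < e -> exists k0, forall k, (k0 <= k)%N ->
    c * en (cutoff u k) <= lam * mass g (cutoff u k) + e }.

End optimal_pair.

Lemma energy_cutoff_le {R : realType} {n : nat} (s : R) k (u : 'rV[R]_n.+1 -> R) :
  measurable_fun setT u -> (energy s (cutoff u k) <= energy s u)%E.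
Proof.
move=> mu_; apply: energy_le => //; first exact: measurable_minr.
move=> x y; rewrite /cutoff /Num.min.
by case: ifPn => h1; case: ifPn => h2; rewrite ?subrr ?normr0//;
  move: h1 h2; rewrite -?leNgt => h1 h2; rewrite ler_norml;
  (have := ler_norm (u x - u y); have := ler_norm (u y - u x));
  rewrite (distrC (u y)) => h3 h4; apply/andP; split; lra.
Qed.

Lemma fine_le_lincomb (R : realType) (a b k1 k2 : \bar R) (r1 r2 : R) :
  (0 <= a)%E -> (a < +oo)%E -> (0 <= k1)%E -> (k1 < +oo)%E ->
  (0 <= b)%E -> (b < +oo)%E -> (0 <= k2)%E -> (k2 < +oo)%E ->
  (a + r1%:E * k1 <= b + r2%:E * k2)%E ->
  fine a + r1 * fine k1 <= fine b + r2 * fine k2.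
Proof. by case: a => [a||]; case: b => [b||]; case: k1 => [k1||]; case: k2 => [k2||]. Qed.

Section positivity.
Context {R : realType} {n : nat}.
Variable s : R.
Local Notation E := 'rV[R]_n.+1.
Local Notation mu := (@lebs R n.+1).
Local Notation mu2 := ((@lebs R n.+1) \x (@lebs R n.+1))%E.
Local Notation K := (kern s).
Variables (Om : set E) (g u : E -> R) (lam c : R).
Hypothesis V : optimal_pair s Om g u lam c.
Local Notation uk := (cutoff u).
Implicit Types w : E -> R.

Lemma en_ge0 w : 0 <= en s w.
Proof. by rewrite fine_ge0// energy_ge0. Qed.

Lemma cutoff_ge0 k x : 0 <= uk k x.
Proof. by rewrite le_min ler0n (op_u0 V). Qed.

Lemma cutoff_le k x : uk k x <= k%:R.
Proof. by rewrite ge_min lexx orbT. Qed.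

Lemma cutoff_id k x : u x <= k%:R -> uk k x = u x.
Proof. by move=> h; apply/min_idPl. Qed.

Lemma measurable_cutoff k : measurable_fun setT (uk k).
Proof. by apply: measurable_minr => //; exact: (op_mu V). Qed.

Lemma cutoff_test k : test_fun s Om (uk k).
Proof.
split.
- exact: measurable_cutoff.
- by exists k%:R => x; rewrite ger0_norm ?cutoff_ge0// cutoff_le.
- by move=> x /(op_uout V) ux; rewrite /cutoff ux; apply/min_idPl.
exact: le_lt_trans (energy_cutoff_le _ _ (op_mu V)) (op_ufin V).
Qed.

Lemma rintegrable_mass h w : rintegrable mu h -> test_fun s Om w ->
  rintegrable mu (fun x => h x * w x ^+ 2).
Proof.
move=> hi [mw [M wM] _ _]; apply: (rintegrableM (M := M ^+ 2)) => //.
  exact: measurable_funX.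
move=> x; rewrite normrX lerXn2r ?nnegrE//.
exact: le_trans (normr_ge0 _) (wM x).
Qed.

(** An instance of submodularity: at pairs of points where the order of the two
    functions is reversed, taking the maximum saves energy. *)
Lemma max_energy_ineq (a b p q : R) :
  (Num.max a p - Num.max b q) ^+ 2 +
    2 * (Num.max (a - p) 0 * Num.max (q - b) 0) <=
  (a - b) ^+ 2 + (p - q) ^+ 2.
Proof.
have mr (x y : R) : x <= y -> Num.max (x - y) 0 = 0.
  by move=> xy; apply/max_idPr; rewrite subr_le0.
have ml (x y : R) : y <= x -> Num.max (x - y) 0 = x - y.
  by move=> yx; apply/max_idPl; rewrite subr_ge0.
have := (sqr_ge0 (a - b), sqr_ge0 (p - q), sqr_ge0 (a - q), sqr_ge0 (b - p)).
rewrite !expr2 => -[[[h3 h4] h5] h6].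
have [h1|/ltW h1] := leP a p; have [h2|/ltW h2] := leP b q.
- by rewrite (mr _ _ h1) mul0r mulr0 addr0; lra.
- rewrite (mr _ _ h1) mul0r mulr0 addr0.
  have : 0 <= (p - a) * (b - q) by rewrite mulr_ge0 ?subr_ge0.
  by lra.
- by rewrite (ml _ _ h1) (ml _ _ h2); lra.
- by rewrite (mr _ _ h2) !mulr0 addr0; lra.
Qed.

Lemma mpres_id : mpres mu id.
Proof. by split => [|A _]; [exact: measurable_id|rewrite preimage_id]. Qed.

Lemma op_min_id w : test_fun s Om w -> lam * mass g w <= c * en s w.
Proof. by move=> tw; apply: (op_min V (tau := id)) => //; exact: mpres_id. Qed.

Lemma product_gt0 (A B : set E) : measurable A -> measurable B ->
  (0 < mu A)%E -> (0 < mu B)%E -> (0 < mu2 (A `*` B))%E.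
Proof. by move=> mA mB A0 B0; rewrite product_measure1E// mule_gt0. Qed.

Section bump.
Variable eta : E -> R.
Hypothesis eta_test : test_fun s Om eta.
Hypothesis eta01 : forall x, 0 <= eta x <= 1.
Hypothesis eta_gt0 : forall x, Om x -> 0 < eta x.
Hypothesis u_nz : (0 < mu [set x | (0 < u x)%R])%E.

Let Z : set E := [set x | Om x /\ u x = 0].
Let S (i : nat) : set E := [set x | i.+1%:R^-1 < u x].

Let mS i : measurable (S i).
Proof.
rewrite (_ : S i = u @^-1` `]i.+1%:R^-1, +oo[%classic); last first.
  by apply/seteqP; split => x /=; rewrite in_itv/= andbT.
by rewrite -[X in measurable X]setTI; apply: (op_mu V) => //; exact: measurable_itv.
Qed.

Let mZ : measurable Z.
Proof.
rewrite (_ : Z = Om `&` u @^-1` [set 0])//; apply: measurableI; first exact: (op_mO V).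
by rewrite -[X in measurable X]setTI; apply: (op_mu V).
Qed.

Let S_gt0 : exists i, (0 < mu (S i))%E.
Proof.
apply: contrapT => /forallNP h; move: u_nz.
rewrite (_ : [set x | 0 < u x] = \bigcup_i S i); last first.
  apply/seteqP; split => x /=; last first.
    by move=> [i _]; apply: lt_trans; rewrite invr_gt0.
  move=> ux; exists (Num.truncn (u x)^-1) => //=.
  by rewrite /S/= invf_plt ?posrE// truncnS_gt.
rewrite (_ : mu _ = 0%E) ?ltxx//; apply/eqP; rewrite eq_le measure_ge0 andbT.
apply: le_trans (measure_sigma_subadditive _ _ _ (subset_refl _)) _ => //.
  exact: bigcup_measurable.
rewrite (eq_eseriesr (g := cst 0%E)) ?eseries0// => i _.
by have := h i; case: ltgtP (measure_ge0 mu (S i)) => // /esym.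
Qed.

(** Replacing [u] by the maximum of [u] and [e * eta] costs [O(e^2)] of energy and
    mass, but on a zero set of positive measure it gains a term of order [e]. *)
Lemma optimal_pair_gt0 : mu Z = 0%E.
Proof.
have [i Si] := S_gt0; apply: contrapT => /eqP Z0.
have {}Z0 : (0 < mu Z)%E by rewrite lt0e Z0 measure_ge0.
pose dl : R := i.+1%:R^-1.
have dl0 : 0 < dl by rewrite invr_gt0.
have dl1 : dl <= 1 by rewrite invf_le1// ler1n.
have [meta _ eta_out eta_fin] := eta_test.
pose k0 (p : E * E) : R := \1_(S i) p.1 * \1_Z p.2 * eta p.2 * K (p.1 - p.2).
have k0_ge0 p : 0 <= k0 p.
  by have /andP[? _] := eta01 p.2; rewrite /k0 !mulr_ge0// kern_ge0.
have mk0 : measurable_fun setT k0.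
  apply: measurable_funM; last by apply: measurable_kern; exact: measurable_diff.
  apply: measurable_funM; last exact: (measurableT_comp meta).
  apply: measurable_funM.
  - exact: (measurableT_comp (measurable_indic (mS i))).
  - exact: (measurableT_comp (measurable_indic mZ)).
pose kap := (\int[mu2]_p (k0 p)%:E)%E.
have kap_gt0 : (0 < kap)%E.
  apply: (integral_gt0 (S := S i `*` Z)).
  - exact/measurable_EFinP.
  - by move=> p; rewrite lee_fin.
  - by apply: measurableX.
  - exact: product_gt0.
  move=> [x y] [/= Sx [Oy uy]]; rewrite lte_fin /k0/= !indicE.
  have Zy : Z y by [].
  rewrite (mem_set Sx) (mem_set Zy)/= !mul1r mulr_gt0 ?eta_gt0//.
  apply: kern_gt0; rewrite subr_eq0; apply/eqP => xy.
  by move: Sx; rewrite /S/= xy uy ltNge ltW// invr_gt0.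
pose G := (\int[mu]_x `|g x|).
have ag : rintegrable mu (fun x => `|g x|).
  apply: (rintegrable_le (h := g)); last exact: (op_ig V).
    by apply: measurableT_comp => //; exact: rintegrable_measurable (op_ig V).
  by move=> x; rewrite normr_id.
pose A := c * en s eta + lam * G.
have main e : 0 < e -> e <= dl / 2 -> (kap < +oo)%E /\ c * (dl * fine kap) <= e * A.
  move=> e0 ed.
  have mee : measurable_fun setT (fun x => e * eta x) by exact: measurable_funM.
  pose w k x := Num.max (uk k x) (e * eta x).
  have mw k : measurable_fun setT (w k).
    by apply: measurable_maxr => //; exact: measurable_cutoff.
  have ee0 x : 0 <= e * eta x by have /andP[? _] := eta01 x; rewrite mulr_ge0// ltW.
  have ee1 x : e * eta x <= e by have /andP[_ ?] := eta01 x; rewrite ler_piMr// ltW.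
  have keyp k p : (0 < k)%N ->
      edens s (w k) p + (e * dl) * k0 p <= edens s (uk k) p + e ^+ 2 * edens s eta p.
    move=> kg0; case: p => x y; rewrite /edens /k0/=.
    set a := uk k x; set b := uk k y; set p := e * eta x; set q := e * eta y.
    have K0 : 0 <= K (x - y) by exact: kern_ge0.
    have := max_energy_ineq a b p q; rewrite -/(w k x) -/(w k y) => h.
    suff h2 : e * dl * (\1_(S i) x * \1_Z y * eta y) <=
        2 * (Num.max (a - p) 0 * Num.max (q - b) 0).
      have -> : e ^+ 2 * ((eta x - eta y) ^+ 2 * K (x - y)) =
        (p - q) ^+ 2 * K (x - y) by rewrite /p /q; ring.
      rewrite !mulrA -!mulrDl ler_wpM2r//; move: h h2; rewrite !mulrA; lra.
    have M0 : 0 <= 2 * (Num.max (a - p) 0 * Num.max (q - b) 0).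
      by rewrite !mulr_ge0// le_max lexx orbT.
    rewrite !indicE; have [/set_mem Sx|_] := boolP (x \in S i); last first.
      by rewrite !mul0r mulr0.
    have [/set_mem [Oy uy]|_] := boolP (y \in Z); last by rewrite mulr0 mul0r mulr0.
    rewrite /= !mul1r.
    have b0 : b = 0 by rewrite /b /cutoff uy; apply/min_idPl.
    have da : dl <= a.
      by rewrite /a /cutoff le_min (ltW Sx)/= (le_trans dl1)// ler1n.
    have ap : dl / 2 <= Num.max (a - p) 0.
      by rewrite le_max; apply/orP; left; have := ee1 x; rewrite -/p; lra.
    have -> : Num.max (q - b) 0 = q by rewrite b0 subr0; apply/max_idPl; exact: ee0.
    have -> : e * dl * eta y = 2 * (dl / 2 * q) by rewrite /q; field.
    by rewrite ler_pM2l// ler_wpM2r// ee0.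
  have en_le k : (0 < k)%N ->
    (energy s (w k) + (e * dl)%:E * kap <= energy s (uk k) + (e ^+ 2)%:E * energy s eta)%E.
    move=> kg0.
    have ed0 : 0 <= e * dl by rewrite mulr_ge0// ltW.
    have := @energy_addl_le _ _ s (w k) (uk k) (fun p => (e * dl) * k0 p)
      (fun p => e ^+ 2 * edens s eta p) (mw k) (measurable_cutoff k).
    move=> /(_ (measurable_funM (measurable_cst _) mk0)).
    move=> /(_ (fun p => mulr_ge0 ed0 (k0_ge0 p))).
    move=> /(_ (measurable_funM (measurable_cst _) (measurable_edens s meta))).
    move=> /(_ (fun p => mulr_ge0 (sqr_ge0 _) (edens_ge0 _ _ _))).
    move=> /(_ (fun p => keyp k p kg0)).
    under eq_integral do rewrite EFinM.
    rewrite (ge0_integralZl mu2 measurableT); last 3 first.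
    - exact/measurable_EFinP.
    - by move=> p _; rewrite lee_fin.
    - by rewrite lee_fin.
    under [X in (_ <= _ + X)%E]eq_integral do rewrite EFinM.
    rewrite (ge0_integralZl mu2 measurableT); last 3 first.
    - by apply/measurable_EFinP; exact: measurable_edens.
    - by move=> p _; rewrite lee_fin edens_ge0.
    - by rewrite lee_fin sqr_ge0.
    by rewrite -(energyE s meta).
  have eee : ((e ^+ 2)%:E * energy s eta < +oo)%E.
    by rewrite lte_mul_pinfty// lee_fin sqr_ge0.
  have rhs_fin k : (energy s (uk k) + (e ^+ 2)%:E * energy s eta < +oo)%E.
    exact: (lte_add_pinfty (tf_fin (cutoff_test k)) eee).
  have ek_ge0 : (0 <= (e * dl)%:E * kap)%E.
    by rewrite mule_ge0 ?(ltW kap_gt0)// lee_fin mulr_ge0// ltW.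
  have kap_fin : (kap < +oo)%E.
    have := le_lt_trans (en_le 1%N isT) (rhs_fin 1%N).
    have := kap_gt0; case: (kap) => [r _ _||]; rewrite ?ltry//.
    move=> _; rewrite gt0_muley ?lte_fin ?mulr_gt0//.
    by rewrite addey// gt_eqF// (lt_le_trans _ (energy_ge0 _ _)).
  have tw k : (0 < k)%N -> test_fun s Om (w k).
    move=> kg0; split.
    - exact: mw.
    - exists (k%:R + e) => x; rewrite ger0_norm; last first.
        by rewrite le_max ee0 orbT.
      rewrite ge_max; apply/andP; split.
        by rewrite (le_trans (cutoff_le _ _))// lerDl ltW.
      by rewrite (le_trans (ee1 x))// lerDr.
    - move=> x nx; rewrite /w eta_out// mulr0 /cutoff (op_uout V nx).
      by rewrite (min_idPl (ler0n _ _)) maxxx.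
    - apply: le_lt_trans (rhs_fin k); apply: le_trans (en_le k kg0).
      by rewrite leeDl.
  split => //.
  have real_le k : (0 < k)%N ->
      en s (w k) + e * dl * fine kap <= en s (uk k) + e ^+ 2 * en s eta.
    move=> kg0; apply: fine_le_lincomb (en_le k kg0).
    - exact: energy_ge0.
    - exact: tf_fin (tw k kg0).
    - exact: ltW kap_gt0.
    - exact: kap_fin.
    - exact: energy_ge0.
    - exact: tf_fin (cutoff_test k).
    - exact: energy_ge0.
    - exact: eta_fin.
  clear en_le.
  have mass_le k : (0 < k)%N -> mass g (uk k) - e ^+ 2 * G <= mass g (w k).
    move=> kg0.
    have i1 := rintegrable_mass (op_ig V) (cutoff_test k).
    have i2 := rintegrable_mass (op_ig V) (tw k kg0).
    rewrite lerBlDr /G -RintegralZl// /mass -RintegralD//; last exact: rintegrableZ.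
    apply: le_Rintegral => //; first by apply: rintegrableD => //; exact: rintegrableZ.
    move=> x _.
    have h : 0 <= w k x ^+ 2 - uk k x ^+ 2 <= e ^+ 2.
      rewrite /w; have := cutoff_ge0 k x; set a := uk k x => a0.
      have p0 := ee0 x; have p1 := ee1 x; set q := e * eta x in p0 p1 *.
      have [h|h] := leP a q; last by rewrite subrr lexx sqr_ge0.
      rewrite subr_ge0 lerXn2r ?nnegrE//= lerBlDr.
      apply: (@le_trans _ _ (e ^+ 2)); last by rewrite lerDl sqr_ge0.
      by rewrite lerXn2r ?nnegrE// ltW.
    move: h => /andP[]; rewrite subr_ge0 lerBlDr.
    move: (w k x ^+ 2) (uk k x ^+ 2) (e ^+ 2) => W U e2 h1 h2.
    have hg : - g x <= `|g x| by rewrite -normrN ler_norm.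
    have h3 : 0 <= (`|g x| + g x) * (W - U) by rewrite mulr_ge0 ?subr_ge0//; lra.
    have h4 : 0 <= `|g x| * (e2 - (W - U)) by rewrite mulr_ge0//; lra.
    by lra.
  have step : c * (e * (dl * fine kap)) <= e * (e * A).
    apply/ler_addgt0Pr => e' e'0.
    have [k1 hk1] := op_attained V e'0.
    pose k := (maxn k1 1)%N.
    have kg0 : (0 < k)%N by rewrite leq_max orbT.
    have := hk1 k (leq_maxl _ _); have := op_min_id (tw k kg0).
    have h2 := mass_le k kg0; have h1 := real_le k kg0.
    have {}h1 : c * (en s (w k) + e * dl * fine kap) <= c * (en s (uk k) + e ^+ 2 * en s eta).
      by rewrite ler_pM2l// (op_c V).
    have {}h2 : lam * (mass g (uk k) - e ^+ 2 * G) <= lam * mass g (w k).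
      by rewrite ler_pM2l// (op_lam V).
    move: h1 h2; rewrite /A; clear.
    move: (en s (w k)) (en s (uk k)) (mass g (w k)) (mass g (uk k)) (en s eta) (fine kap).
    move=> *; lra.
  by move: step; rewrite mulrCA ler_pM2l.
have dl20 : 0 < dl / 2 by rewrite divr_gt0.
have [kfin _] := main _ dl20 (lexx _).
have kap0 : 0 < fine kap by rewrite fine_gt0// kap_gt0.
have B0 : 0 < c * (dl * fine kap) by rewrite !mulr_gt0// (op_c V).
have A0 : 0 < A.
  by have [_ h] := main _ dl20 (lexx _); rewrite -(pmulr_rgt0 _ dl20) (lt_le_trans B0).
pose e := Num.min (dl / 2) (c * (dl * fine kap) / (2 * A)).
have e0 : 0 < e by rewrite lt_min dl20 divr_gt0// mulr_gt0.
have [|_] := main e e0; first by rewrite ge_min lexx.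
apply/negP; rewrite -ltNge.
apply: (@le_lt_trans _ _ (c * (dl * fine kap) / (2 * A) * A)).
  by rewrite ler_wpM2r// ?(ltW A0)// ge_min lexx orbT.
have -> : c * (dl * fine kap) / (2 * A) * A = c * (dl * fine kap) / 2.
  by field; rewrite gt_eqF.
by rewrite ltr_pdivrMr// ltr_pMr// ltr1n.
Qed.

End bump.

End positivity.

(** * Polarization *)

(** The properties of a reflection about the boundary of an open half-space [X] that
    the polarization argument uses. By [rf_Om] the domain leans towards [X], and by
    [rf_gt0] it is not symmetric. Boundary points are fixed and lie outside of [X]. *)
Record reflection {R : realType} {n : nat} (Om X : set 'rV[R]_n)
    (sg : 'rV[R]_n -> 'rV[R]_n) : Prop := Reflection {
  rf_K : involutive sg;
  rf_mpres : mpres (lebs n) sg;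
  rf_iso : forall x y, enorm (sg x - sg y) = enorm (x - y);
  rf_mX : measurable X;
  rf_X : forall x, X x -> ~ X (sg x);
  rf_nX : forall x, ~ X x -> X (sg x) \/ sg x = x;
  rf_lt : forall x y, X x -> X y -> enorm (x - y) < enorm (x - sg y);
  rf_Om : forall x, Om x -> ~ X x -> Om (sg x);
  rf_gt0 : (0 < lebs n [set x | X x /\ Om x /\ ~ Om (sg x)])%E }.

Section two_point.
Context {R : realType}.

Let S (a b c d k1 k2 : R) :=
  (a - c) ^+ 2 * k1 + (b - d) ^+ 2 * k1 + (b - c) ^+ 2 * k2 + (a - d) ^+ 2 * k2.

(** The rearranged cross terms are the largest ones; the closer pairs carry the
    larger kernel value. *)
Lemma two_point_energy (a b c d k1 k2 : R) : k2 <= k1 ->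
  S (Num.max a b) (Num.min a b) (Num.max c d) (Num.min c d) k1 k2 +
    2 * (k1 - k2) * (Num.max (a - b) 0 * Num.max (d - c) 0) <= S a b c d k1 k2.
Proof.
move=> k12; rewrite /S.
have mr (x y : R) : x <= y -> Num.max (x - y) 0 = 0.
  by move=> xy; apply/max_idPr; rewrite subr_le0.
have ml (x y : R) : y <= x -> Num.max (x - y) 0 = x - y.
  by move=> yx; apply/max_idPl; rewrite subr_ge0.
have [h1|/ltW h1] := leP a b; have [h2|/ltW h2] := leP c d.
- by rewrite (mr _ _ h1) mul0r mulr0 addr0 !expr2; lra.
- rewrite (mr _ _ h1) mul0r mulr0 addr0.
  have : 0 <= (k1 - k2) * ((b - a) * (c - d)) by rewrite !mulr_ge0 ?subr_ge0.
  by rewrite !expr2; lra.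
- by rewrite (ml _ _ h1) (ml _ _ h2) !expr2; lra.
- by rewrite (mr _ _ h2) !mulr0 addr0.
Qed.

(** Rearrangement inequality: the larger weight meets the larger value. *)
Lemma two_point_mass (a b g1 g2 : R) : 0 <= a -> 0 <= b ->
  g1 * a ^+ 2 + g2 * b ^+ 2 <=
  Num.max g1 g2 * Num.max a b ^+ 2 + Num.min g1 g2 * Num.min a b ^+ 2.
Proof.
move=> a0 b0.
have [h1|/ltW h1] := leP g1 g2; have [h2|/ltW h2] := leP a b.
- by rewrite addrC.
- have : 0 <= (g2 - g1) * ((a - b) * (a + b)) by rewrite !mulr_ge0 ?subr_ge0 ?addr_ge0.
  by rewrite !expr2; lra.
- have : 0 <= (g1 - g2) * ((b - a) * (a + b)) by rewrite !mulr_ge0 ?subr_ge0 ?addr_ge0.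
  by rewrite !expr2; lra.
- by [].
Qed.

End two_point.

Section polarization.
Context {R : realType} {n : nat}.
Variable s : R.
Hypothesis s0 : 0 < s.
Local Notation E := 'rV[R]_n.+1.
Local Notation mu := (@lebs R n.+1).
Local Notation mu2 := ((@lebs R n.+1) \x (@lebs R n.+1))%E.
Local Notation K := (kern s).
Variables (Om X : set E) (sg : E -> E).
Hypothesis F : reflection Om X sg.
Implicit Types w : E -> R.

Definition polarize w (x : E) : R :=
  if `[< X x >] then Num.max (w x) (w (sg x)) else Num.min (w x) (w (sg x)).

Lemma polarize_in w x : X x -> polarize w x = Num.max (w x) (w (sg x)).
Proof. by move=> Xx; rewrite /polarize asboolT. Qed.

Lemma polarize_out w x : ~ X x -> polarize w x = Num.min (w x) (w (sg x)).
Proof. by move=> Xx; rewrite /polarize asboolF. Qed.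

Lemma measurable_comp_sg w : measurable_fun setT w ->
  measurable_fun setT (fun x => w (sg x)).
Proof. by move=> mw; exact: (measurableT_comp mw (proj1 (rf_mpres F))). Qed.

Lemma measurable_polarize w : measurable_fun setT w ->
  measurable_fun setT (polarize w).
Proof.
move=> mw; have mws := measurable_comp_sg mw.
rewrite (_ : polarize w = fun x => \1_X x * Num.max (w x) (w (sg x)) +
    (1 - \1_X x) * Num.min (w x) (w (sg x))); last first.
  apply/funext => x; rewrite indicE; have [Xx|nXx] := pselect (X x).
    by rewrite polarize_in// mem_set// subrr mul0r mul1r addr0.
  by rewrite polarize_out// memNset// subr0 mul0r mul1r add0r.
have mI : measurable_fun setT (\1_X : E -> R) by exact: measurable_indic (rf_mX F).
apply: measurable_funD; apply: measurable_funM => //.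
- exact: measurable_maxr.
- exact: measurable_funB.
- exact: measurable_minr.
Qed.

Let closed_half x := X x \/ sg x = x.

Let polarize_max w x : closed_half x -> polarize w x = Num.max (w x) (w (sg x)).
Proof.
have [Xx _|nXx [//|sx]] := pselect (X x); first by rewrite polarize_in.
by rewrite polarize_out// sx minxx maxxx.
Qed.

Let polarize_min w x : closed_half x -> polarize w (sg x) = Num.min (w x) (w (sg x)).
Proof.
have [Xx _|nXx [//|sx]] := pselect (X x).
  by rewrite (polarize_out _ (rf_X F Xx)) (rf_K F) minC.
by rewrite sx polarize_out// sx.
Qed.

Let closed_halfP x : closed_half x \/ closed_half (sg x).
Proof.
have [Xx|/(rf_nX F)[Xsx|sx]] := pselect (X x).
- by left; left.
- by right; left.
- by left; right.
Qed.

Lemma kern_sg x y : K (sg x - sg y) = K (x - y).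
Proof. by rewrite /kern /kernel_denom (rf_iso F). Qed.

Lemma kern_sgl x y : K (sg x - y) = K (x - sg y).
Proof. by rewrite -{1}(rf_K F y) kern_sg. Qed.

Let kern_closer x y : closed_half x -> closed_half y -> x != y ->
  K (x - sg y) <= K (x - y).
Proof.
move=> hx hy xy; case: hy => [Xy|->//]; case: hx => [Xx|sx].
  by apply: kern_le; rewrite ?subr_eq0// ltW// (rf_lt F).
by rewrite -{1}sx kern_sg.
Qed.

(** Since the reflection preserves the measure, an integral over pairs of points may
    be computed from sums over the orbit of a pair under reflecting each point; the
    effect of polarization on the energy density is visible only on such orbits. *)
Definition orbit_sum (f : E * E -> R) (p : E * E) : R :=
  f p + f (sg p.1, sg p.2) + f (sg p.1, p.2) + f (p.1, sg p.2).

Let orbit_sum_edens w x y : orbit_sum (edens s w) (x, y) =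
  (w x - w y) ^+ 2 * K (x - y) + (w (sg x) - w (sg y)) ^+ 2 * K (x - y) +
  (w (sg x) - w y) ^+ 2 * K (x - sg y) + (w x - w (sg y)) ^+ 2 * K (x - sg y).
Proof. by rewrite /orbit_sum /edens/= kern_sg kern_sgl. Qed.

Let orbit_sum_sgl f x y : orbit_sum f (sg x, y) = orbit_sum f (x, y).
Proof. by rewrite /orbit_sum/= (rf_K F); ring. Qed.

Let orbit_sum_sgr f x y : orbit_sum f (x, sg y) = orbit_sum f (x, y).
Proof. by rewrite /orbit_sum/= (rf_K F); ring. Qed.

Lemma polarize_orbit_half w x y : closed_half x -> closed_half y -> x != y ->
  orbit_sum (edens s (polarize w)) (x, y) +
    2 * (K (x - y) - K (x - sg y)) *
      (Num.max (w x - w (sg x)) 0 * Num.max (w (sg y) - w y) 0) <=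
  orbit_sum (edens s w) (x, y).
Proof.
move=> hx hy xy; rewrite !orbit_sum_edens.
rewrite (polarize_max w hx) (polarize_min w hx) (polarize_max w hy) (polarize_min w hy).
exact: two_point_energy (kern_closer hx hy xy).
Qed.

Lemma polarize_orbit w x y :
  orbit_sum (edens s (polarize w)) (x, y) <= orbit_sum (edens s w) (x, y).
Proof.
wlog hx : x / closed_half x.
  move=> h; have [/h//|/h] := closed_halfP x; by rewrite !orbit_sum_sgl.
wlog hy : y / closed_half y.
  move=> h; have [/h//|/h] := closed_halfP y; by rewrite !orbit_sum_sgr.
have [<-|xy] := eqVneq x y.
  rewrite !orbit_sum_edens (polarize_max w hx) (polarize_min w hx).
  move: (w x) (w (sg x)) (K _) (K _) => a b k1 k2.
  by have [_|_] := leP a b; rewrite !expr2; lra.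
apply: le_trans (polarize_orbit_half w hx hy xy).
rewrite lerDl !mulr_ge0// ?subr_ge0 ?kern_closer// le_max lexx orbT//.
Qed.

Lemma integral_orbit_sum (f : E * E -> R) : measurable_fun setT f ->
  (forall p, 0 <= f p) ->
  (\int[mu2]_p (orbit_sum f p)%:E = 4%:E * \int[mu2]_p (f p)%:E)%E.
Proof.
move=> mf f0.
pose f1 (p : E * E) := (f (sg p.1, sg p.2))%:E.
pose f2 (p : E * E) := (f (sg p.1, p.2))%:E.
pose f3 (p : E * E) := (f (p.1, sg p.2))%:E.
pose f4 (p : E * E) := (f p)%:E.
have msg := proj1 (rf_mpres F).
have m4 : measurable_fun setT f4 by exact/measurable_EFinP.
have p4 p : (0 <= f4 p)%E by rewrite lee_fin.
have m3 : measurable_fun setT f3.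
  apply: (measurableT_comp m4); apply: measurable_fun_pair => //.
  exact: (measurableT_comp msg).
have m2 : measurable_fun setT f2.
  apply: (measurableT_comp m4); apply: measurable_fun_pair => //.
  exact: (measurableT_comp msg).
have m1 : measurable_fun setT f1.
  by apply: (measurableT_comp m4); apply: measurable_fun_pair;
  exact: (measurableT_comp msg).
have p3 p : (0 <= f3 p)%E by rewrite lee_fin.
have p2 p : (0 <= f2 p)%E by rewrite lee_fin.
have p1 p : (0 <= f1 p)%E by rewrite lee_fin.
have I3 : (\int[mu2]_p f3 p = \int[mu2]_p f4 p)%E.
  exact: (mpres_integral2r (rf_mpres F) m4 p4).
have I2 : (\int[mu2]_p f2 p = \int[mu2]_p f4 p)%E.
  exact: (mpres_integral2l (rf_mpres F) m4 p4).
have I1 : (\int[mu2]_p f1 p = \int[mu2]_p f4 p)%E.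
  by rewrite -I3; exact: (mpres_integral2l (rf_mpres F) m3 p3).
transitivity (\int[mu2]_p (f4 p + f1 p + f2 p + f3 p))%E; first by [].
rewrite (ge0_integralD mu2 measurableT _ _ (fun p _ => p3 p) m3); last 2 first.
- by move=> p _; rewrite !adde_ge0.
- by do 2 apply: emeasurable_funD => //.
rewrite (ge0_integralD mu2 measurableT _ _ (fun p _ => p2 p) m2); last 2 first.
- by move=> p _; rewrite !adde_ge0.
- by apply: emeasurable_funD => //.
rewrite (ge0_integralD mu2 measurableT (fun p _ => p4 p) m4 (fun p _ => p1 p) m1).
have : (0 <= \int[mu2]_p f4 p)%E by exact: integral_ge0.
rewrite I1 I2 I3; move: (\int[mu2]_p f4 p)%E.
case=> [r _||//]; first by rewrite -EFinM -!EFinD; congr EFin; ring.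
by rewrite !addye// gt0_muley.
Qed.

End polarization.

(** * The eigenfunction is polarized *)
Section exchange.
Context {R : realType} {n : nat}.
Local Notation E := 'rV[R]_n.+1.
Local Notation mu := (@lebs R n.+1).
Variables (Om X : set E) (sg : E -> E) (A : set E).
Hypothesis F : reflection Om X sg.
Hypothesis mA : measurable A.
Hypothesis AE : forall x, A x -> [/\ X x, Om x & Om (sg x)].

Let S : set E := [set x | A x \/ A (sg x)].

Definition exchange : E -> E := swap sg S.

Let S_sg x : S (sg x) <-> S x.
Proof. by rewrite /S/= (rf_K F); split=> -[]; [right|left|right|left]. Qed.

Let mS : measurable S.
Proof.
apply: measurableU => //; rewrite -[X in measurable X]setTI.
exact: (proj1 (rf_mpres F)).
Qed.

Lemma mpres_exchange : mpres mu exchange.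
Proof. exact: mpres_swap (rf_mpres F) mS S_sg. Qed.

Lemma exchange_Om x : Om (exchange x) <-> Om x.
Proof.
have [Sx|nS] := pselect (S x); last by rewrite /exchange swap_out.
rewrite /exchange swap_in//; case: Sx => /AE; first by case.
by rewrite (rf_K F) => -[].
Qed.

Lemma exchange_in x : A x -> exchange x = sg x /\ exchange (sg x) = x.
Proof.
move=> Ax; rewrite /exchange !swap_in ?(rf_K F)//; first by right; rewrite (rf_K F).
by left.
Qed.

Lemma exchange_out x : ~ A x -> ~ A (sg x) -> exchange x = x /\ exchange (sg x) = sg x.
Proof. by move=> nA nA'; rewrite /exchange !swap_out//; rewrite /S/= ?(rf_K F) => -[]. Qed.

Lemma exchange_half x : X x -> ~ A (sg x).
Proof. by move=> Xx /AE[Xsx]; case: (rf_X F Xx). Qed.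

End exchange.

Lemma gain_contradiction (R : realType) (c G ep ek lm lm' : R) :
  0 < c -> 0 < G -> G + 4 * ep <= 0 + 4 * ek -> lm' <= c * ep ->
  c * ek <= lm + c * G / 8 -> lm <= lm' -> False.
Proof.
move=> c0 G0; rewrite add0r -(ler_pM2l c0) => h1 h2 h3 h4.
have cG : 0 < c * G by rewrite mulr_gt0.
lra.
Qed.

Section polarized_eigenfunction.
Context {R : realType} {n : nat}.
Variable s : R.
Hypothesis s0 : 0 < s.
Local Notation E := 'rV[R]_n.+1.
Local Notation mu := (@lebs R n.+1).
Local Notation mu2 := ((@lebs R n.+1) \x (@lebs R n.+1))%E.
Local Notation K := (kern s).
Variables (Om : set E) (g u : E -> R) (lam c : R).
Hypothesis V : optimal_pair s Om g u lam c.
Variables (X : set E) (sg : E -> E).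
Hypothesis F : reflection Om X sg.
Local Notation uk := (cutoff u).

Let mg : measurable_fun setT g := rintegrable_measurable (op_ig V).
Let mu_ : measurable_fun setT u := op_mu V.
Let msg := proj1 (rf_mpres F).

Let mOsg : measurable (sg @^-1` Om).
Proof. by rewrite -[X in measurable X]setTI; apply: msg => //; exact: (op_mO V). Qed.

Definition wrong_order : set E :=
  [set x | [/\ X x, Om x, Om (sg x) & g x < g (sg x)]].

Lemma measurable_wrong_order : measurable wrong_order.
Proof.
rewrite (_ : wrong_order = X `&` Om `&` sg @^-1` Om `&` [set x | g x < g (sg x)]).
  apply: measurableI; last first.
    by apply: measurable_lt_set => //; exact: (measurable_comp_sg F mg).
  apply: measurableI => //; apply: measurableI; first exact: (rf_mX F).
  exact: (op_mO V).
by apply/seteqP; split => x /=; [case|case=> -[[]]].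
Qed.

Let wrongE x : wrong_order x -> [/\ X x, Om x & Om (sg x)].
Proof. by case. Qed.

Let tau := exchange sg wrong_order.

Let tau_out x : ~ wrong_order x -> ~ wrong_order (sg x) ->
  tau x = x /\ tau (sg x) = sg x.
Proof. exact: (exchange_out F). Qed.

Let tau_in x : wrong_order x -> tau x = sg x /\ tau (sg x) = x.
Proof. exact: (exchange_in F). Qed.

(** The weight and the function are polarized together, the weight by a
    measure-preserving map; this keeps it in the rearrangement class. *)
Lemma mass_polarize w : test_fun s Om w -> (forall x, 0 <= w x) ->
  rintegrable mu (fun x => g (tau x) * polarize X sg w x ^+ 2) ->
  mass g w <= mass (fun x => g (tau x)) (polarize X sg w).
Proof.
move=> tw w0 ih; have wout := tf_out tw.
apply: (le_Rintegral_sym (rf_mpres F)) => //.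
  exact: rintegrable_mass (op_ig V) tw.
have half x : X x ->
  g x * w x ^+ 2 + g (sg x) * w (sg x) ^+ 2 <=
  g (tau x) * polarize X sg w x ^+ 2 + g (tau (sg x)) * polarize X sg w (sg x) ^+ 2.
  move=> Xx; have nA' := exchange_half F wrongE Xx.
  rewrite (polarize_in _ _ Xx) (polarize_out _ _ (rf_X F Xx)) (rf_K F).
  rewrite [Num.min (w (sg x)) _]minC.
  have [Ox|nOx] := pselect (Om x); last first.
    have nOsx : ~ Om (sg x).
      by move=> /(rf_Om F) /(_ (rf_X F Xx)); rewrite (rf_K F).
    have [||-> ->] := @tau_out x; try by case.
    by rewrite !wout// maxxx minxx.
  have [Osx|nOsx] := pselect (Om (sg x)); last first.
    have [||-> ->] := @tau_out x; try by case.
    rewrite (wout _ nOsx) (op_gout V nOsx) !mul0r.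
    by rewrite (max_idPl (w0 x)).
  have [lt|le] := ltP (g x) (g (sg x)).
    have [|-> ->] := @tau_in x; first by [].
    have := two_point_mass (g x) (g (sg x)) (w0 x) (w0 (sg x)).
    by rewrite (max_idPr (ltW lt)) (min_idPl (ltW lt)).
  have [||-> ->] := @tau_out x => //.
    by case=> _ _ _; rewrite ltNge le.
  have := two_point_mass (g x) (g (sg x)) (w0 x) (w0 (sg x)).
  by rewrite (max_idPl le) (min_idPr le).
move=> x; have [/half//|nXx] := pselect (X x).
have [Xsx|sx] := rf_nX F nXx.
  by have := half _ Xsx; rewrite !(rf_K F) addrC [leRHS]addrC.
have [||-> ->] := @tau_out x; rewrite ?sx; try by case.
by rewrite (polarize_out _ _ nXx) sx minxx.
Qed.

(* Bounding the values by M makes the gain independent of the truncation level. *)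
Let P (M : nat) : set E := [set x | [/\ X x, u (sg x) < u x & u x <= M%:R]].
Let Q (M : nat) : set E := [set x | [/\ X x, u x < u (sg x) & u (sg x) <= M%:R]].

Let musg := measurable_comp_sg F mu_.

Let mP M : measurable (P M).
Proof.
rewrite (_ : P M = X `&` [set x | u (sg x) < u x] `&` [set x | u x <= M%:R]).
  apply: measurableI; last exact: measurable_le_set.
  by apply: measurableI; [exact: (rf_mX F)|exact: measurable_lt_set].
by apply/seteqP; split => x /=; [case|case=> -[]].
Qed.

Let mQ M : measurable (Q M).
Proof.
rewrite (_ : Q M = X `&` [set x | u x < u (sg x)] `&` [set x | u (sg x) <= M%:R]).
  apply: measurableI; last exact: measurable_le_set.
  by apply: measurableI; [exact: (rf_mX F)|exact: measurable_lt_set].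
by apply/seteqP; split => x /=; [case|case=> -[]].
Qed.

Let gain M (p : E * E) : R := \1_(P M) p.1 * \1_(Q M) p.2 *
  (2 * (K (p.1 - p.2) - K (p.1 - sg p.2)) *
    ((u p.1 - u (sg p.1)) * (u (sg p.2) - u p.2))).

Let PQ_neq M x y : P M x -> Q M y -> x != y.
Proof. by move=> [_ h1 _] [_ h2 _]; apply/eqP => xy; move: h1; rewrite xy ltNge ltW. Qed.

Let gain_in M x y : P M x -> Q M y -> 0 < gain M (x, y).
Proof.
move=> Px Qy; rewrite /gain/= !indicE (mem_set Px) (mem_set Qy) !mul1r.
have xy := PQ_neq Px Qy; case: Px Qy => [Xx h1 _] [Xy h2 _].
rewrite !mulr_gt0 ?subr_gt0//.
by apply: (kern_lt s0); [rewrite subr_eq0|exact: (rf_lt F)].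
Qed.

Let gain_out M x y : ~ (P M x /\ Q M y) -> gain M (x, y) = 0.
Proof.
move=> h; rewrite /gain/= !indicE.
have [/set_mem Px|_] := boolP (x \in P M); last by rewrite !mul0r.
have [/set_mem Qy|_] := boolP (y \in Q M); last by rewrite mulr0 mul0r.
by exfalso; apply: h.
Qed.

Let gain_ge0 M p : 0 <= gain M p.
Proof.
case: p => x y; have [[Px Qy]|h] := pselect (P M x /\ Q M y).
  exact/ltW/gain_in.
by rewrite gain_out.
Qed.

Let measurable_gain M : measurable_fun setT (gain M).
Proof.
have m1 : measurable_fun setT (fun p : E * E => sg p.2) by exact: (measurableT_comp msg).
apply: measurable_funM.
  apply: measurable_funM.
  - exact: (measurableT_comp (measurable_indic (mP M))).
  - exact: (measurableT_comp (measurable_indic (mQ M))).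
apply: measurable_funM.
  apply: measurable_funM => //; apply: measurable_funB; apply: measurable_kern.
    exact: measurable_diff.
  exact: measurable_rVB.
apply: measurable_funM; apply: measurable_funB.
- exact: (measurableT_comp mu_).
- exact: (measurableT_comp musg).
- exact: (measurableT_comp musg).
- exact: (measurableT_comp mu_).
Qed.

Let orbit_gain M k p : (M <= k)%N ->
  orbit_sum sg (edens s (polarize X sg (uk k))) p + gain M p <=
  orbit_sum sg (edens s (uk k)) p.
Proof.
move=> Mk; case: p => x y; have [[Px Qy]|h] := pselect (P M x /\ Q M y); last first.
  by rewrite gain_out// addr0; exact: (polarize_orbit s0 F).
have xy := PQ_neq Px Qy; case: (Px) (Qy) => [Xx h1 uxM] [Xy h2 uyM].
have := polarize_orbit_half s0 F (uk k) (or_introl Xx) (or_introl Xy) xy.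
have Mk' : M%:R <= k%:R :> R by rewrite ler_nat.
rewrite !cutoff_id; last 4 first.
- by rewrite (le_trans (ltW h2))// (le_trans uyM).
- exact: le_trans uyM _.
- by rewrite (le_trans (ltW h1))// (le_trans uxM).
- exact: le_trans uxM _.
have -> : Num.max (u x - u (sg x)) 0 = u x - u (sg x).
  by apply/max_idPl; rewrite subr_ge0 ltW.
have -> : Num.max (u (sg y) - u y) 0 = u (sg y) - u y.
  by apply/max_idPl; rewrite subr_ge0 ltW.
by rewrite /gain/= !indicE (mem_set Px) (mem_set Qy) !mul1r.
Qed.

Let mpol k : measurable_fun setT (polarize X sg (uk k)).
Proof. exact: (measurable_polarize F (measurable_cutoff V k)). Qed.

Let measurable_orbit_sum (f : E * E -> R) : measurable_fun setT f ->
  measurable_fun setT (orbit_sum sg f).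
Proof.
move=> mf; rewrite /orbit_sum.
have m1 : measurable_fun setT (fun p : E * E => sg p.1) by exact: (measurableT_comp msg).
have m2 : measurable_fun setT (fun p : E * E => sg p.2) by exact: (measurableT_comp msg).
apply: measurable_funD; last first.
  exact: (measurableT_comp mf (measurable_fun_pair measurable_fst m2)).
apply: measurable_funD; last first.
  exact: (measurableT_comp mf (measurable_fun_pair m1 measurable_snd)).
apply: measurable_funD; first exact: mf.
exact: (measurableT_comp mf (measurable_fun_pair m1 m2)).
Qed.

Let gain_energy M k : (M <= k)%N ->
  (\int[mu2]_p (gain M p)%:E + 4%:E * energy s (polarize X sg (uk k)) <=
   0 + 4%:E * energy s (uk k))%E.
Proof.
move=> Mk; rewrite add0e addeC.
have me w : measurable_fun setT w -> measurable_fun setT (fun p => (edens s w p)%:E).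
  by move=> mw; apply/measurable_EFinP; exact: measurable_edens.
have morb w : measurable_fun setT w ->
    measurable_fun setT (fun p => (orbit_sum sg (edens s w) p)%:E).
  by move=> mw; apply/measurable_EFinP; exact: measurable_orbit_sum (measurable_edens s mw).
have orb0 w p : 0 <= orbit_sum sg (edens s w) p by rewrite !addr_ge0 ?edens_ge0.
have mk := measurable_cutoff V k.
rewrite (energyE s (mpol k)) (energyE s mk).
rewrite -(integral_orbit_sum F (measurable_edens s (mpol k)) (edens_ge0 _ _)).
rewrite -(integral_orbit_sum F (measurable_edens s mk) (edens_ge0 _ _)).
have mga : measurable_fun setT (fun p => (gain M p)%:E) by exact/measurable_EFinP.
have o1 p : setT p -> (0 <= (orbit_sum sg (edens s (polarize X sg (uk k))) p)%:E)%E.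
  by rewrite lee_fin orb0.
have o2 p : setT p -> (0 <= (gain M p)%:E)%E by rewrite lee_fin.
rewrite -(ge0_integralD mu2 measurableT o1 (morb _ (mpol k)) o2 mga).
apply: ge0_le_integral.
- exact: measurableT.
- by move=> p _; rewrite -EFinD lee_fin addr_ge0 ?orb0.
- by apply: emeasurable_funD; [exact: morb|exact: mga].
- exact: morb.
- by move=> p _; rewrite -EFinD lee_fin orbit_gain.
Qed.

Let polarize_test k : (energy s (polarize X sg (uk k)) < +oo)%E ->
  test_fun s Om (polarize X sg (uk k)).
Proof.
move=> fe; have w0 := cutoff_ge0 V k.
have wout := tf_out (cutoff_test V k).
split; [exact: mpol| | |exact: fe].
- exists k%:R => x.
  have [Xx|nX] := pselect (X x).
    rewrite (polarize_in _ _ Xx) ger0_norm; last by rewrite le_max w0.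
    by rewrite ge_max !cutoff_le.
  have wmin : 0 <= Num.min (uk k x) (uk k (sg x)) by rewrite le_min !w0.
  rewrite (polarize_out _ _ nX) (ger0_norm wmin).
  by apply: le_trans (cutoff_le u k x); rewrite ge_min lexx.
move=> x nOx; have [Xx|nX] := pselect (X x).
  rewrite (polarize_in _ _ Xx) !wout ?maxxx// => Osx; apply: nOx.
  by rewrite -(rf_K F x); apply: (rf_Om F) => //; exact: (rf_X F).
by rewrite (polarize_out _ _ nX) (wout _ nOx); apply/min_idPl.
Qed.

(** If [u] were strictly larger in [X] on one set and strictly smaller on another, then
    simultaneous polarization of [u] and [g] would lower the energy by a fixed positive
    amount without decreasing the mass. *)
Let P_or_Q M : mu (P M) = 0%E \/ mu (Q M) = 0%E.
Proof.
apply: contrapT => /not_orP[/eqP P0 /eqP Q0].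
have {}P0 : (0 < mu (P M))%E by rewrite lt0e P0 measure_ge0.
have {}Q0 : (0 < mu (Q M))%E by rewrite lt0e Q0 measure_ge0.
have gE := @gain_energy M; move: gE.
have : (0 < \int[mu2]_p (gain M p)%:E)%E.
  apply: (integral_gt0 (S := P M `*` Q M)).
  - exact/measurable_EFinP.
  - by move=> p; rewrite lee_fin.
  - exact: measurableX.
  - exact: product_gt0.
  - by move=> [x y] [Px Qy]; rewrite lte_fin gain_in.
move: (\int[mu2]_p (gain M p)%:E)%E => G G0 gE.
have fin k : (0 + 4%:E * energy s (uk k) < +oo)%E.
  by rewrite add0e lte_mul_pinfty//; exact: tf_fin (cutoff_test V k).
have pfin k : (M <= k)%N -> (energy s (polarize X sg (uk k)) < +oo)%E.
  move=> Mk; have := le_lt_trans (gE k Mk) (fin k); have := energy_ge0 s (polarize X sg (uk k)).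
  case: (energy _ _) => [r||] //; first by rewrite ltry.
  by rewrite gt0_muley// addey// gt_eqF// (lt_trans _ G0)// ltNy0.
have Gfin : (G < +oo)%E.
  apply: le_lt_trans (le_lt_trans (gE M (leqnn M)) (fin M)).
  by rewrite leeDl// mule_ge0// energy_ge0.
have G1 : 0 < fine G by rewrite fine_gt0// G0.
have e0 : 0 < c * fine G / 8 by rewrite divr_gt0// mulr_gt0// (op_c V).
have [k0 hk0] := op_attained V e0.
pose k := maxn k0 M; have Mk : (M <= k)%N by rewrite leq_maxr.
have tp := polarize_test (pfin k Mk).
have h1 : fine G + 4 * en s (polarize X sg (uk k)) <= fine (0%E : \bar R) + 4 * en s (uk k).
  apply: fine_le_lincomb (gE k Mk) => //; try exact: energy_ge0.
  - exact: ltW.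
  - exact: pfin.
  - exact: tf_fin (cutoff_test V k).
have h2 := op_min V (mpres_exchange F measurable_wrong_order)
  (exchange_Om F wrongE) tp.
have h3 := hk0 k (leq_maxl _ _).
have h4 : mass g (uk k) <= mass (fun x => g (tau x)) (polarize X sg (uk k)).
  apply: mass_polarize; [exact: (cutoff_test V)|exact: (cutoff_ge0 V)|].
  apply: rintegrable_mass tp; apply: (rintegrable_mpres _ (op_ig V)).
  exact: (mpres_exchange F measurable_wrong_order).
have h5 : lam * mass g (uk k) <= lam * mass (fun x => g (tau x)) (polarize X sg (uk k)).
  by rewrite ler_pM2l ?(op_lam V).
exact: (gain_contradiction (op_c V) G1 h1 h2 h3 h5).
Qed.

Lemma measure_bigcup_eq0 (A : nat -> set E) : (forall i, measurable (A i)) ->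
  (forall i, mu (A i) = 0%E) -> mu (\bigcup_i A i) = 0%E.
Proof.
move=> mA A0; apply/eqP; rewrite eq_le measure_ge0 andbT.
have mU : measurable (\bigcup_i A i) by exact: bigcup_measurable.
apply: le_trans (measure_sigma_subadditive mu mA mU (@subset_refl _ _)) _.
by rewrite (eq_eseriesr (g := cst 0%E)) ?eseries0// => i _; exact: A0.
Qed.

Hypothesis u_pos : mu [set x | Om x /\ u x = 0] = 0%E.

Let u_bad : set E := [set x | X x /\ u x < u (sg x)].

Let mu_bad : measurable u_bad.
Proof. by apply: measurableI; [exact: (rf_mX F)|exact: measurable_lt_set]. Qed.

Let leq_nat_bound (r : R) : exists M : nat, r <= M%:R.
Proof. by exists (Num.truncn r).+1; rewrite ltW// truncnS_gt. Qed.

(** If [u] were reversed rather than polarized, it would vanish on the part of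
    the half-space whose mirror image leaves the domain. *)
Lemma eigenfunction_polarized : mu [set x | X x /\ u x < u (sg x)] = 0%E.
Proof.
apply: contrapT => /eqP N0.
have [M0 QM0] : exists M0, mu (Q M0) <> 0%E.
  apply: contrapT => /forallNP h; move/eqP: N0; apply.
  have -> : [set x | X x /\ u x < u (sg x)] = \bigcup_M Q M.
    apply/seteqP; split => [x [Xx ux]|x [M _ [Xx ux _]]//].
    by have [M uM] := leq_nat_bound (u (sg x)); exists M.
  by apply: measure_bigcup_eq0 => // i; apply: contrapT; exact: h.
have PM M : mu (P (M0 + M)%N) = 0%E.
  have [//|Q0] := P_or_Q (M0 + M)%N; exfalso; apply: QM0.
  apply: (@subset_measure0 _ _ _ mu _ (Q (M0 + M)%N)) => //.
  move=> x [Xx ux uM]; split => //; apply: le_trans uM _.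
  by rewrite ler_nat leq_addr.
have mZ : measurable [set x | Om x /\ u x = 0].
  rewrite (_ : [set x | _] = Om `&` (u @^-1` [set 0]))//.
  apply: measurableI; first exact: (op_mO V).
  by rewrite -[X in measurable X]setTI; apply: (op_mu V).
have mB : measurable (\bigcup_M P (M0 + M)%N) by exact: bigcup_measurable.
have := rf_gt0 F; rewrite ltNge => /negP; apply.
apply: (@le_trans _ _ (mu ([set x | Om x /\ u x = 0] `|` \bigcup_M P (M0 + M)%N))).
  apply: le_measure; rewrite ?inE//.
  - rewrite (_ : [set x | _] = X `&` (Om `&` ~` (sg @^-1` Om)))//.
    apply: measurableI; first exact: (rf_mX F).
    by apply: measurableI; [exact: (op_mO V)|exact: measurableC].
  - exact: measurableU.
  move=> x /= [Xx [Ox nOsx]].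
  have [ux|/eqP ux] := eqVneq (u x) 0; first by left.
  right; have [M uM] := leq_nat_bound (u x); exists M => //; split => //.
    by rewrite (op_uout V nOsx) lt0r (op_u0 V) andbT; exact/eqP.
  by rewrite (le_trans uM)// ler_nat leq_addl.
have e1 : (mu [set x | Om x /\ u x = 0%R] <= 0)%E by rewrite u_pos.
have e2 : (mu (\bigcup_M P (M0 + M)%N) <= 0)%E by rewrite measure_bigcup_eq0.
apply: le_trans (measureU2 _ mZ mB) _; rewrite -(adde0 0%E).
by apply: leeD; [exact: e1|exact: e2].
Qed.

End polarized_eigenfunction.

(** * The weight is polarized *)
Lemma small_quadratic (R : realType) (J B : R) :
  (forall t e, 0 < e -> t * J <= e + t ^+ 2 * B) -> J = 0.
Proof.
move=> h; apply/eqP; case: (eqVneq J 0) => // J0; exfalso.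
have J2 : 0 < J ^+ 2 by rewrite exprn_even_gt0.
have B1 : 0 < `|B| + 1 by rewrite ltr_wpDl.
pose r := (2 * (`|B| + 1))^-1.
have r0 : 0 < r by rewrite invr_gt0 mulr_gt0.
have rB : r * B <= 2^-1.
  rewrite /r mulrC ler_pdivrMr ?mulr_gt0// mulrA mulVf// mul1r.
  by apply: le_trans (ler_norm _) _; rewrite lerDl.
have e0 : 0 < r * J ^+ 2 / 4 by rewrite divr_gt0// mulr_gt0.
have := h (r * J) _ e0.
have -> : r * J * J = r * J ^+ 2 by ring.
have -> : (r * J) ^+ 2 * B = r * J ^+ 2 * (r * B) by ring.
have rJ : 0 < r * J ^+ 2 by rewrite mulr_gt0.
rewrite -mulrDr -[X in X <= _]mulr1 ler_pM2l//; lra.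
Qed.

Lemma lincomb_lty (R : realType) (a b : \bar R) (r1 r2 : R) :
  (0 <= a)%E -> (a < +oo)%E -> (0 <= b)%E -> (b < +oo)%E ->
  (r1%:E * a + r2%:E * b < +oo)%E.
Proof. by case: a => [a||]; case: b => [b||] // *; rewrite -!EFinM -EFinD ltry. Qed.

Lemma fine_le_sum (R : realType) (a b k1 k2 : \bar R) (r1 r2 : R) :
  (0 <= a)%E -> (a < +oo)%E -> (0 <= k1)%E -> (k1 < +oo)%E ->
  (0 <= b)%E -> (b < +oo)%E -> (0 <= k2)%E -> (k2 < +oo)%E ->
  (a + b <= r1%:E * k1 + r2%:E * k2)%E ->
  fine a + fine b <= r1 * fine k1 + r2 * fine k2.
Proof. by case: a => [a||]; case: b => [b||]; case: k1 => [k1||]; case: k2 => [k2||]. Qed.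

(** The sum of the optimality conditions for [w + t phi] with the first weight and for
    [w - t phi] with the second one: the terms of the energy that are linear in [t]
    cancel. *)
Lemma variation_arith (R : realType) (c lam t e Gp Hp xg xh Ep Em Ek Eph Gk Hk : R) :
  lam * (Gk + 2 * t * xg + t ^+ 2 * Gp) <= c * Ep ->
  lam * (Hk + 2 * - t * xh + (- t) ^+ 2 * Hp) <= c * Em ->
  c * Ek <= lam * Gk + e / 2 -> lam * Gk <= lam * Hk ->
  c * (Ep + Em) <= c * (2 * Ek + 2 * t ^+ 2 * Eph) ->
  t * (2 * lam * (xg - xh)) <= e + t ^+ 2 * (2 * c * Eph - lam * (Gp + Hp)).
Proof. by move=> h1 h2 h3 h4 h5; rewrite sqrrN in h2; lra. Qed.

Section polarized_weight.
Context {R : realType} {n : nat}.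
Variable s : R.
Local Notation E := 'rV[R]_n.+1.
Local Notation mu := (@lebs R n.+1).
Local Notation mu2 := ((@lebs R n.+1) \x (@lebs R n.+1))%E.
Variables (Om : set E) (g u : E -> R) (lam c : R).
Hypothesis V : optimal_pair s Om g u lam c.
Local Notation uk := (cutoff u).

Definition perturb (w phi : E -> R) (t : R) (x : E) : R := w x + t * phi x.

Lemma test_fun_perturb w phi (t : R) : test_fun s Om w -> test_fun s Om phi ->
  (energy s (perturb w phi t) < +oo)%E ->
  test_fun s Om (perturb w phi t).
Proof.
move=> [mw [M wM] wo _] [mp [N pN] po _] fe; split => //.
- by apply: measurable_funD => //; exact: measurable_funM.
- exists (M + `|t| * N) => x; apply: le_trans (ler_normD _ _) _.
  by rewrite lerD// normrM ler_wpM2l.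
- by move=> x nx; rewrite /perturb wo// po// mulr0 addr0.
Qed.

(** In extended reals, so that it yields at the same time the finiteness of the energies
    of the perturbations. *)
Lemma energy_parallelogram w phi (t : R) :
  test_fun s Om w -> test_fun s Om phi ->
  (energy s (perturb w phi t) + energy s (perturb w phi (- t)) <=
   2%:E * energy s w + (2 * t ^+ 2)%:E * energy s phi)%E.
Proof.
move=> [mw _ _ _] [mp _ _ _].
have mDZ r : measurable_fun setT (perturb w phi r).
  by apply: measurable_funD => //; exact: measurable_funM.
pose D1 p := edens s (perturb w phi (- t)) p.
pose D2 p := edens s w p + 2 * t ^+ 2 * edens s phi p.
have mD1 : measurable_fun setT D1 by exact: measurable_edens.
have t0 : 0 <= 2 * t ^+ 2 by rewrite mulr_ge0// sqr_ge0.
have mt : measurable_fun setT (fun p => 2 * t ^+ 2 * edens s phi p).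
  by apply: measurable_funM => //; exact: measurable_edens.
have mD2 : measurable_fun setT D2.
  by apply: measurable_funD => //; exact: measurable_edens.
have D10 p : 0 <= D1 p by exact: edens_ge0.
have D20 p : 0 <= D2 p.
  exact: addr_ge0 (edens_ge0 s w p) (mulr_ge0 t0 (edens_ge0 s phi p)).
have par p : edens s (perturb w phi t) p + D1 p <= edens s w p + D2 p.
  rewrite /D1 /D2 /edens /perturb -mulrDl addrA -mulrDl mulrA -mulrDl ler_wpM2r ?kern_ge0//.
  by rewrite !expr2; lra.
have := energy_addl_le (mDZ t) mw mD1 D10 mD2 D20 par.
have e0 (v : E -> R) p : setT p -> (0 <= (edens s v p)%:E)%E by rewrite lee_fin edens_ge0.
have me (v : E -> R) : measurable_fun setT v -> measurable_fun setT (fun p => (edens s v p)%:E).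
  by move=> mv; apply/measurable_EFinP; exact: measurable_edens.
have mtE : measurable_fun setT (fun p => (2 * t ^+ 2 * edens s phi p)%:E).
  exact/measurable_EFinP.
have t0E p : setT p -> (0 <= (2 * t ^+ 2 * edens s phi p)%:E)%E.
  by rewrite lee_fin mulr_ge0// edens_ge0.
have I1 : (\int[mu2]_p (D1 p)%:E = energy s (perturb w phi (- t)))%E.
  by rewrite (energyE s (mDZ (- t))).
have I2 : (\int[mu2]_p (D2 p)%:E = energy s w + (2 * t ^+ 2)%:E * energy s phi)%E.
  rewrite (energyE s mw) (energyE s mp).
  transitivity (\int[mu2]_p ((edens s w p)%:E + (2 * t ^+ 2 * edens s phi p)%:E))%E.
    by [].
  rewrite (ge0_integralD mu2 measurableT (e0 w) (me _ mw) t0E mtE); congr (_ + _)%E.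
  under eq_integral do rewrite EFinM.
  by rewrite (ge0_integralZl mu2 measurableT (me _ mp) (e0 phi)).
rewrite I1 I2; move: (energy_ge0 s w).
move: (energy s w) (energy s phi) => a b a0 h; apply: le_trans h _.
rewrite addeA (_ : 2%:E * a = a + a)%E//.
case: a a0 => [r _|_|//]; first by rewrite -EFinM -EFinD; congr EFin; ring.
by rewrite gt0_muley.
Qed.

Definition cross (h w phi : E -> R) : R := \int[mu]_x (h x * (w x * phi x)).

Lemma rintegrable_cross h w phi : rintegrable mu h -> test_fun s Om w ->
  test_fun s Om phi -> rintegrable mu (fun x => h x * (w x * phi x)).
Proof.
move=> ih [mw [M wM] _ _] [mp [N pN] _ _].
apply: (rintegrableM (M := M * N)) => //; first exact: measurable_funM.
by move=> x; rewrite normrM ler_pM.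
Qed.

Lemma mass_perturb h w phi t : rintegrable mu h -> test_fun s Om w ->
  test_fun s Om phi ->
  mass h (perturb w phi t) = mass h w + (2 * t) * cross h w phi + t ^+ 2 * mass h phi.
Proof.
move=> ih tw tp.
have i1 := rintegrable_mass ih tw.
have i2 := rintegrable_cross ih tw tp.
have i3 := rintegrable_mass ih tp.
rewrite /mass /cross -!RintegralZl//.
have i2' := rintegrableZ (2 * t) i2; have i3' := rintegrableZ (t ^+ 2) i3.
rewrite -RintegralD// -RintegralD//; last exact: rintegrableD.
apply: eq_Rintegral => x _; rewrite /perturb; ring.
Qed.

Variables (X : set E) (sg : E -> E).
Hypothesis F : reflection Om X sg.
Hypothesis u_pos : mu [set x | Om x /\ u x = 0] = 0%E.
Hypothesis u_sorted : mu [set x | X x /\ u x < u (sg x)] = 0%E.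
Hypothesis dense : forall f, rintegrable mu f -> (forall x, ~ Om x -> f x = 0) ->
  (forall phi, test_fun s Om phi -> \int[mu]_x (f x * phi x) = 0) ->
  mu [set x | f x != 0] = 0%E.

Let mg : measurable_fun setT g := rintegrable_measurable (op_ig V).
Let mu_ : measurable_fun setT u := op_mu V.
Let musg := measurable_comp_sg F mu_.

Section bounded_part.
Variable M : nat.

(* On A the values of u are bounded, so that the exchanged weights differ from g only
   where every truncation of level at least M coincides with u. *)
Let A : set E := [set x |
  [/\ wrong_order Om g X sg x, u x <= M%:R & u (sg x) <= u x]].

Let mA : measurable A.
Proof.
rewrite (_ : A = wrong_order Om g X sg `&` [set x | u x <= M%:R] `&` [set x | u (sg x) <= u x]).
  apply: measurableI; last exact: measurable_le_set.
  apply: measurableI; last exact: measurable_le_set.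
  exact: (measurable_wrong_order V F).
by apply/seteqP; split => x /=; [case|case=> -[]].
Qed.

Let AE x : A x -> [/\ X x, Om x & Om (sg x)].
Proof. by case=> -[]. Qed.

Let tau := exchange sg A.
Let h x := g (tau x).

Let tau_mpres : mpres mu tau := mpres_exchange F mA.

Let ih : rintegrable mu h := rintegrable_mpres tau_mpres (op_ig V).

Let h_cases x : X x ->
  [/\ A x, h x = g (sg x) & h (sg x) = g x] \/
  [/\ ~ A x, h x = g x & h (sg x) = g (sg x)].
Proof.
move=> Xx; have nA := exchange_half F AE Xx.
have [Ax|nAx] := pselect (A x).
  by have [e1 e2] := exchange_in F Ax; left; rewrite /h /tau e1 e2.
by have [e1 e2] := exchange_out F nAx nA; right; rewrite /h /tau e1 e2.
Qed.

Let h_fix x : ~ X x -> sg x = x -> h x = g x.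
Proof.
move=> nX sx; have nA : ~ A x by case=> -[].
have nA' : ~ A (sg x) by rewrite sx.
by rewrite /h /tau (proj1 (exchange_out F nA nA')).
Qed.

Let mass_exchange k : mass g (uk k) <= mass h (uk k).
Proof.
have tk := cutoff_test V k.
apply: (le_Rintegral_sym (rf_mpres F)).
  exact: rintegrable_mass (op_ig V) tk.
  exact: rintegrable_mass ih tk.
have half x : X x -> g x * uk k x ^+ 2 + g (sg x) * uk k (sg x) ^+ 2 <=
    h x * uk k x ^+ 2 + h (sg x) * uk k (sg x) ^+ 2.
  move=> Xx; have [[[[_ _ _ lt] _ le] -> ->]|[_ -> ->]//] := h_cases Xx.
  have uu : uk k (sg x) <= uk k x by rewrite le_min !ge_min le lexx orbT.
  have := cutoff_ge0 V k (sg x) => u0.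
  have : 0 <= (g (sg x) - g x) * (uk k x ^+ 2 - uk k (sg x) ^+ 2).
    by rewrite mulr_ge0 ?subr_ge0 ?(ltW lt)// lerXn2r// nnegrE (le_trans u0).
  by move: (_ ^+ 2) (_ ^+ 2) (g _) (g _) => *; lra.
move=> x; have [/half//|nXx] := pselect (X x).
have [Xsx|sx] := rf_nX F nXx.
  by have := half _ Xsx; rewrite !(rf_K F) addrC [leRHS]addrC.
by rewrite sx (h_fix nXx sx).
Qed.

Let diff_cutoff k x : (M <= k)%N -> (g x - h x) * uk k x = (g x - h x) * u x.
Proof.
move=> Mk; have Mk' : M%:R <= k%:R :> R by rewrite ler_nat.
have half y : X y -> (g y - h y) * uk k y = (g y - h y) * u y /\
    (g (sg y) - h (sg y)) * uk k (sg y) = (g (sg y) - h (sg y)) * u (sg y).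
  move=> Xy; have [[[_ uM uu] _ _]|[_ -> ->]] := h_cases Xy; last first.
    by rewrite !subrr !mul0r.
  by rewrite !cutoff_id// ?(le_trans uM)// (le_trans uu)// (le_trans uM).
have [/half[]//|nXx] := pselect (X x).
have [/half[_]|sx] := rf_nX F nXx; first by rewrite (rf_K F).
by rewrite (h_fix nXx sx) subrr !mul0r.
Qed.

Let f x := (g x - h x) * u x.

Let f_int : rintegrable mu f.
Proof.
have -> : f = (fun x => (g x + -1 * h x) * uk M x).
  by apply/funext => x; rewrite mulN1r diff_cutoff.
apply: (rintegrableM (M := M%:R)); first exact: rintegrableD (op_ig V) (rintegrableZ _ ih).
  exact: measurable_cutoff V M.
by move=> x; rewrite (ger0_norm (cutoff_ge0 V M x)) cutoff_le.
Qed.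

(** The weight and its exchanged copy are both optimal for [u]; adding their first
    variations along [phi] and [- phi] eliminates the energy. *)
Let first_variation phi : test_fun s Om phi -> \int[mu]_x (f x * phi x) = 0.
Proof.
move=> tp; set J := \int[mu]_x _.
have crossJ k : (M <= k)%N -> cross g (uk k) phi - cross h (uk k) phi = J.
  move=> Mk; have tk := cutoff_test V k.
  have ig := rintegrable_cross (op_ig V) tk tp.
  have ihh := rintegrable_cross ih tk tp.
  rewrite /cross -RintegralB//; apply: eq_Rintegral => x _.
  by rewrite -mulrBl mulrA diff_cutoff.
suff : 2 * lam * J = 0.
  by move/eqP; rewrite !mulf_eq0 pnatr_eq0 (gt_eqF (op_lam V))/= => /eqP.
apply: (@small_quadratic _ _ (2 * c * en s phi - lam * (mass g phi + mass h phi))).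
move=> t e e0; have e20 : 0 < e / 2 by rewrite divr_gt0.
have [k0 hk0] := op_attained V e20.
pose k := maxn k0 M; have Mk : (M <= k)%N by rewrite leq_maxr.
have tk := cutoff_test V k.
have par := energy_parallelogram t tk tp.
have rhs_fin : (2%:E * energy s (uk k) + (2 * t ^+ 2)%:E * energy s phi < +oo)%E.
  exact: lincomb_lty (energy_ge0 _ _) (tf_fin tk) (energy_ge0 _ _) (tf_fin tp).
have lhs_fin := le_lt_trans par rhs_fin.
have fin1 : (energy s (perturb (uk k) phi t) < +oo)%E.
  by apply: le_lt_trans lhs_fin; rewrite leeDl// energy_ge0.
have fin2 : (energy s (perturb (uk k) phi (- t)) < +oo)%E.
  by apply: le_lt_trans lhs_fin; rewrite leeDr// energy_ge0.
have t1 := test_fun_perturb tk tp fin1.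
have t2 := test_fun_perturb tk tp fin2.
have m1 := op_min_id V t1.
have m2 := op_min V tau_mpres (exchange_Om F AE) t2.
have h3 := hk0 k (leq_maxl _ _).
have h4 : lam * mass g (uk k) <= lam * mass h (uk k).
  by rewrite ler_pM2l ?(op_lam V)// mass_exchange.
have h5 : en s (perturb (uk k) phi t) + en s (perturb (uk k) phi (- t)) <=
    2 * en s (uk k) + 2 * t ^+ 2 * en s phi.
  exact: fine_le_sum (energy_ge0 _ _) fin1 (energy_ge0 _ _) (tf_fin tk)
    (energy_ge0 _ _) fin2 (energy_ge0 _ _) (tf_fin tp) par.
rewrite (mass_perturb _ (op_ig V) tk tp) in m1.
rewrite -/h (mass_perturb _ ih tk tp) in m2.
rewrite -(crossJ k Mk); clear par rhs_fin lhs_fin fin1 fin2.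
have {}h5 : c * (en s (perturb (uk k) phi t) + en s (perturb (uk k) phi (- t))) <=
    c * (2 * en s (uk k) + 2 * t ^+ 2 * en s phi).
  by rewrite ler_pM2l// (op_c V).
exact: (variation_arith m1 m2 h3 h4 h5).
Qed.

(** The difference of the two weights times [u] is orthogonal to all test functions,
    hence zero, and [u] does not vanish in the domain. *)
Lemma weight_bounded_part :
  mu [set x | [/\ wrong_order Om g X sg x, u x <= M%:R & u (sg x) <= u x]] = 0%E.
Proof.
have f0 : mu [set x | f x != 0] = 0%E.
  apply: dense => //; move=> x nOx.
  by rewrite /f (op_uout V nOx) mulr0.
have mf : measurable [set x | f x != 0].
  rewrite (_ : [set x | _] = f @^-1` [set~ 0]); last first.
    by apply/seteqP; split => x /=; move/eqP.
  rewrite -[X in measurable X]setTI; apply: (rintegrable_measurable f_int) => //.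
  exact: measurableC.
have mZ : measurable [set x | Om x /\ u x = 0].
  rewrite (_ : [set x | _] = Om `&` (u @^-1` [set 0]))//.
  apply: measurableI; first exact: (op_mO V).
  by rewrite -[X in measurable X]setTI; apply: (op_mu V).
apply/eqP; rewrite eq_le measure_ge0 andbT.
apply: (@le_trans _ _ (mu ([set x | Om x /\ u x = 0%R] `|` [set x | f x != 0%R]))).
  apply: le_measure; rewrite ?inE//; first exact: measurableU.
  move=> x Ax; have [Xx Ox Osx] := AE Ax.
  have [ux|ux] := eqVneq (u x) 0; first by left.
  right; rewrite /= /f mulf_neq0//.
  have [[[[_ _ _ lt] _ _] -> _]|[nA]] := h_cases Xx; last by case: nA.
  by rewrite subr_eq0 lt_eqF.
have e1 : (mu [set x | Om x /\ u x = 0%R] <= 0)%E by rewrite u_pos.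
have e2 : (mu [set x | f x != 0%R] <= 0)%E by rewrite f0.
apply: le_trans (measureU2 _ mZ mf) _; rewrite -(adde0 0%E).
by apply: leeD; [exact: e1|exact: e2].
Qed.

End bounded_part.

Theorem weight_polarized : mu (wrong_order Om g X sg) = 0%E.
Proof.
have mW := measurable_wrong_order V F.
pose B M : set E := [set x |
    [/\ wrong_order Om g X sg x, u x <= M%:R & u (sg x) <= u x]].
pose N : set E := [set x | X x /\ u x < u (sg x)].
have mB M : measurable (B M).
  rewrite (_ : B M = wrong_order Om g X sg `&` [set x | u x <= M%:R] `&`
      [set x | u (sg x) <= u x]).
    by do 2 (apply: measurableI; last exact: measurable_le_set).
  by apply/seteqP; split => x /=; [case|case=> -[]].
have mN : measurable N.
  by apply: measurableI; [exact: (rf_mX F)|exact: measurable_lt_set].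
have mU : measurable (\bigcup_M B M) by exact: bigcup_measurable.
have e1 : (mu N <= 0)%E by rewrite u_sorted.
have e2 : (mu (\bigcup_M B M) <= 0)%E.
  by rewrite (measure_bigcup_eq0 mB weight_bounded_part).
apply/eqP; rewrite eq_le measure_ge0 andbT.
apply: (@le_trans _ _ (mu (N `|` \bigcup_M B M))).
  apply: le_measure; rewrite ?inE//; first exact: measurableU.
  move=> x Wx; have [lt|le] := ltP (u x) (u (sg x)).
    by left; split => //; case: Wx.
  right; exists (Num.truncn (u x)).+1 => //; split => //.
  by rewrite ltW// truncnS_gt.
apply: le_trans (measureU2 _ mN mU) _; rewrite -(adde0 0%E).
by apply: leeD; [exact: e1|exact: e2].
Qed.

End polarized_weight.

(** * Test functions separate integrable functions *)
Section distance_cutoff.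
Context {R : realType} {n : nat}.
Local Notation E := 'rV[R]_n.+1.
Implicit Types (A : set E) (x y : E).

Definition dist_out A x : R := inf [set `|x - y| | y in ~` A].

Lemma norm_le_enorm (z : E) : `|z| <= enorm z.
Proof.
have [->|z0] := eqVneq z 0; first by rewrite normr0 enorm_ge0.
rewrite -[`|z|]/(mx_norm z); have [|i ->] := @mx_norm_neq0 _ _ _ z.
  by apply: contra z0 => /eqP /mx_norm_eq0 ->.
by rewrite (ord1 i.1) coord_le_enorm.
Qed.

Section with_outside_point.
Variables (A : set E) (y0 : E).
Hypothesis nAy0 : ~ A y0.

Let has_inf_dist x : has_inf [set `|x - y| | y in ~` A].
Proof.
split; first by exists `|x - y0|; exists y0.
by exists 0 => _ [y _ <-].
Qed.

Lemma dist_out_ge0 x : 0 <= dist_out A x.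
Proof. by apply: lb_le_inf => [|_ [y _ <-]//]; exists `|x - y0|; exists y0. Qed.

Lemma dist_out_le x y : ~ A y -> dist_out A x <= `|x - y|.
Proof.
by move=> nAy; apply: ge_inf; [exact: (proj2 (has_inf_dist x))|exists y].
Qed.

Lemma dist_out_eq0 x : ~ A x -> dist_out A x = 0.
Proof.
move=> nAx; apply/eqP; rewrite eq_le dist_out_ge0 andbT.
by rewrite (le_trans (dist_out_le _ nAx))// subrr normr0.
Qed.

Lemma dist_out_gt0 x : open A -> A x -> 0 < dist_out A x.
Proof.
move=> oA Ax; have /nbhs_ballP[e /= e0 xeA] : nbhs x A by exact: open_nbhs_nbhs.
apply: (lt_le_trans e0); apply: lb_le_inf; first by exists `|x - y0|; exists y0.
move=> _ [y nAy <-]; rewrite leNgt; apply/negP => xy; apply: nAy; apply: xeA.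
by rewrite -ball_normE.
Qed.

Lemma dist_out_lip x y : dist_out A x - dist_out A y <= `|x - y|.
Proof.
rewrite lerBlDl -lerBlDr; apply: lb_le_inf; first by exists `|y - y0|; exists y0.
move=> _ [z nAz <-]; rewrite lerBlDr (le_trans (dist_out_le x nAz))//.
by rewrite [leRHS]addrC (ler_distD y).
Qed.

Lemma dist_out_lipN x y : `|dist_out A x - dist_out A y| <= `|x - y|.
Proof.
rewrite ler_norml dist_out_lip andbT lerNl opprB distrC.
exact: dist_out_lip.
Qed.

(** Lipschitz functions that increase to the indicator function of an open set. *)
Definition dist_cutoff (j : nat) (x : E) : R := Num.min 1 (j%:R * dist_out A x).

Lemma dist_cutoff01 j x : 0 <= dist_cutoff j x <= 1.
Proof. by rewrite le_min ler01 mulr_ge0 ?dist_out_ge0//= ge_min lexx. Qed.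

Lemma dist_cutoff_out j x : ~ A x -> dist_cutoff j x = 0.
Proof. by move=> nAx; rewrite /dist_cutoff dist_out_eq0// mulr0; apply/min_idPr. Qed.

Lemma dist_cutoff_lip j x y :
  `|dist_cutoff j x - dist_cutoff j y| <= j%:R * enorm (x - y).
Proof.
apply: le_trans (_ : `|j%:R * dist_out A x - j%:R * dist_out A y| <= _).
  rewrite /dist_cutoff; move: (j%:R * _) (j%:R * _) => a b.
  have := ler_norm (a - b); have := ler_norm (b - a); rewrite distrC => h1 h2.
  have := normr_ge0 (a - b).
  by have [ha|ha] := leP 1 a; have [hb|hb] := leP 1 b => h3;
    rewrite ler_norml; apply/andP; split; lra.
rewrite -mulrBr normrM ger0_norm// ler_wpM2l//.
exact: le_trans (dist_out_lipN _ _) (norm_le_enorm _).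
Qed.

Lemma continuous_dist_out : continuous (dist_out A).
Proof.
move=> x S /= /(nbhs_ballP (dist_out A x)) [e /= e0 es].
apply/nbhs_ballP; exists e => //= y; rewrite -ball_normE/= => xy; apply: es.
by rewrite /ball/= (le_lt_trans (dist_out_lipN x y)).
Qed.

Lemma measurable_dist_cutoff j : measurable_fun setT (dist_cutoff j).
Proof.
apply: measurable_minr => //; apply: measurable_funM => //.
by apply: continuous_measurable_rV; exact: continuous_dist_out.
Qed.

Lemma dist_cutoff_cvg x : open A -> dist_cutoff ^~ x @ \oo --> (\1_A x : R).
Proof.
move=> oA; have [Ax|nAx] := pselect (A x); last first.
  rewrite indicE memNset//= (_ : dist_cutoff^~ x = cst 0); first exact: cvg_cst.
  by apply/funext => j; rewrite dist_cutoff_out.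
have d0 := dist_out_gt0 oA Ax.
rewrite indicE mem_set//=; apply: (@cvg_trans _ ((fun=> 1) @ \oo)); last exact: cvg_cst.
apply: near_eq_cvg; near=> j; rewrite /dist_cutoff; apply/esym/min_idPl.
rewrite -ler_pdivrMr// div1r; near: j; exact: nbhs_infty_ger.
Unshelve. all: by end_near. Qed.

Lemma dist_cutoff_test (s : R) j (Om : set E) : 0 < s -> s < 1 ->
  A `<=` Om -> measurable Om -> (lebs n.+1 Om < +oo)%E ->
  test_fun s Om (dist_cutoff j).
Proof.
move=> s0 s1 AO mO fO; split.
- exact: measurable_dist_cutoff.
- exists 1 => x; have /andP[h1 h2] := dist_cutoff01 j x; by rewrite ger0_norm.
- by move=> x nOx; apply: dist_cutoff_out => /AO.
- apply: (energy_lipschitz s0 s1 mO fO (measurable_dist_cutoff j) (dist_cutoff01 j)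
    _ (ler0n _ j) (dist_cutoff_lip j)).
  by move=> x nOx; apply: dist_cutoff_out => /AO.
Qed.

End with_outside_point.

End distance_cutoff.

Section density.
Context {R : realType} {n : nat}.
Variable s : R.
Hypotheses (s0 : 0 < s) (s1 : s < 1).
Local Notation E := 'rV[R]_n.+1.
Local Notation mu := (@lebs R n.+1).
Variables (Om : set E) (y0 : E).
Hypotheses (oO : open Om) (fO : (mu Om < +oo)%E) (nOy0 : ~ Om y0).

Let mO : measurable Om := open_measurable_rV oO.

Lemma rintegrable_indic (h : E -> R) A : rintegrable mu h -> measurable A ->
  rintegrable mu (fun x => h x * \1_A x).
Proof.
move=> hi mA; apply: (rintegrableM (M := 1) hi).
  exact: (measurable_indic mA).
by move=> x; rewrite indicE; case: (_ \in _); rewrite ?normr1 ?normr0.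
Qed.

Section vanishing.
Variable f : E -> R.
Hypothesis fi : rintegrable mu f.
Hypothesis f_out : forall x, ~ Om x -> f x = 0.
Hypothesis f_test : forall phi, test_fun s Om phi -> \int[mu]_x (f x * phi x) = 0.

Lemma Rintegral_cvg0 (b_ : nat -> E -> R) (b : E -> R) :
  (forall j, measurable_fun setT (b_ j)) -> measurable_fun setT b ->
  (forall j x, `|b_ j x| <= 1) -> (forall x, b_ ^~ x @ \oo --> b x) ->
  (forall j, \int[mu]_x (f x * b_ j x) = 0) -> \int[mu]_x (f x * b x) = 0.
Proof.
move=> mb_ mb b1 bcvg I0; have mf := rintegrable_measurable fi.
have af : mu.-integrable setT (fun x => `|f x|%:E).
  by have := integrable_abse fi.
have [] := @dominated_convergence _ _ _ mu setT measurableT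
  (fun j x => (f x * b_ j x)%:E) (fun x => (f x * b x)%:E) (fun x => `|f x|%:E).
- by move=> j; apply/measurable_EFinP; exact: measurable_funM.
- by apply/measurable_EFinP; exact: measurable_funM.
- by apply: aeW => x _; apply: cvg_EFin; [exact: nearW|apply: cvgMr; exact: bcvg].
- exact: af.
- by apply: aeW => x j _; rewrite /= lee_fin normrM ler_piMr.
move=> _ _; rewrite (_ : [sequence _]_j = cst 0%E); last first.
  apply/funext => j /=.
  have ib : rintegrable mu (fun x => f x * b_ j x) by exact: (rintegrableM (M := 1)).
  have := I0 j; rewrite /Rintegral => h.
  by rewrite -[LHS]fineK ?h// integrable_fin_num.
move=> /cvg_lim h; rewrite /Rintegral -h// lim_cst//.
Qed.

Let vanish : set (set E) := [set A | measurable A /\ \int[mu]_x (f x * \1_A x) = 0].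

Let int1 A : measurable A -> rintegrable mu (fun x => f x * \1_A x).
Proof. exact: rintegrable_indic. Qed.

Let vanish_open A : open A -> vanish A.
Proof.
move=> oA; have mA := open_measurable_rV oA; split => //.
have oAO : open (A `&` Om) by exact: openI.
have nAO : ~ (A `&` Om) y0 by case.
rewrite (_ : (fun x => _) = (fun x => f x * \1_(A `&` Om) x)); last first.
  apply/funext => x; have [Ox|nOx] := pselect (Om x).
    by rewrite !indicE in_setI (mem_set Ox) andbT.
  by rewrite f_out// !mul0r.
apply: (Rintegral_cvg0 (b_ := dist_cutoff (A `&` Om))).
- by move=> j; exact: measurable_dist_cutoff nAO j.
- by apply: measurable_indic; exact: measurableI.
- by move=> j x; have /andP[h1 h2] := dist_cutoff01 nAO j x; rewrite ger0_norm.
- by move=> x; exact: dist_cutoff_cvg nAO x oAO.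
- by move=> j; apply: f_test; apply: (dist_cutoff_test nAO) => //; exact: subIsetr.
Qed.

Let vanish_lambda : lambda_system setT vanish.
Proof.
split => //.
- exact: (vanish_open (@openT _)).
- move=> A B BA [mA A0] [mB B0]; split; first exact: measurableD.
  rewrite (_ : (fun x => _) = (fun x => f x * \1_A x - f x * \1_B x)); last first.
    apply/funext => x; rewrite -mulrBr !indicE; congr (_ * _).
    have [Bx|nBx] := pselect (B x).
      by rewrite (mem_set Bx) (mem_set (BA _ Bx)) memNset ?subrr// => -[].
    rewrite (memNset nBx) subr0; have [Ax|nAx] := pselect (A x).
      by rewrite !mem_set.
    by rewrite !memNset// => -[].
  by rewrite RintegralB//; [rewrite A0 B0 subrr|exact: int1|exact: int1].
- move=> G ndG vG; have mG i : measurable (G i) by case: (vG i).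
  have mU : measurable (\bigcup_i G i) by exact: bigcup_measurable.
  split => //; apply: (Rintegral_cvg0 (b_ := fun i => \1_(G i))).
  + by move=> j; exact: measurable_indic.
  + exact: measurable_indic.
  + by move=> j x; rewrite indicE; case: (_ \in _); rewrite ?normr1 ?normr0.
  + move=> x; have [[i _ Gix]|nU] := pselect ((\bigcup_i G i) x).
      rewrite indicE mem_set; last by exists i.
      apply: (@cvg_trans _ ((fun=> 1) @ \oo)); last exact: cvg_cst.
      apply: near_eq_cvg; near=> j; rewrite indicE mem_set//.
      have ij : (i <= j)%N by near: j; exact: nbhs_infty_ge.
      by have /subsetPset := ndG _ _ ij; apply.
    rewrite indicE memNset// (_ : (fun i => _) = cst 0); first exact: cvg_cst.
    by apply/funext => i; rewrite indicE memNset// => Gix; apply: nU; exists i.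
  + by move=> j; case: (vG j).
Unshelve. all: by end_near. Qed.

Lemma integral_measurable_eq0 A : measurable A -> \int[mu]_x (f x * \1_A x) = 0.
Proof.
move=> mA; suff : vanish A by case.
have IO : setI_closed [set B : set E | open B] by move=> B C; exact: openI.
have OV : [set B : set E | open B] `<=` vanish by move=> B; exact: vanish_open.
apply: (lambda_system_subset IO vanish_lambda OV) => //.
by rewrite -measurable_rV_opens.
Qed.

Lemma sign_part_null (h : E -> R) : rintegrable mu h ->
  (\int[mu]_x (h x * \1_[set x | 0 < h x] x) = 0) -> mu [set x | 0 < h x] = 0%E.
Proof.
move=> hi I0; have mh := rintegrable_measurable hi.
have mP : measurable [set x | 0 < h x] by exact: measurable_lt_set.
pose p x := h x * \1_[set x | 0 < h x] x.
have mp : measurable_fun setT p.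
  by apply: measurable_funM => //; exact: measurable_indic.
have p0 x : (0 <= (p x)%:E)%E.
  rewrite lee_fin /p indicE; have [/set_mem hx|_] := boolP (_ \in _).
    by rewrite mulr1 ltW.
  by rewrite mulr0.
have ip : rintegrable mu p.
  exact: rintegrable_indic.
have Ip : (\int[mu]_x (p x)%:E = 0)%E.
  by rewrite -[LHS]fineK; [rewrite -/(Rintegral _ _ _) I0|exact: integrable_fin_num].
have mpE : measurable_fun setT (fun x => (p x)%:E) by exact/measurable_EFinP.
have [N [mN N0 hN]] := ge0_integral_eq0 mpE p0 Ip.
apply: (subset_measure0 mP mN _ N0) => x hx; apply: hN => /= -[].
by rewrite /p indicE mem_set// mulr1 => hx0; move: hx; rewrite /= hx0 ltxx.
Qed.

End vanishing.

(** The cutoffs increase to indicators of open sets, so that the integral of [f] vanishes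
    over every open set, and then over every Borel set by the monotone class argument. *)
Theorem test_fun_dense f : rintegrable mu f -> (forall x, ~ Om x -> f x = 0) ->
  (forall phi, test_fun s Om phi -> \int[mu]_x (f x * phi x) = 0) ->
  mu [set x | f x != 0] = 0%E.
Proof.
move=> fi fo ft.
have vm A : measurable A -> \int[mu]_x (f x * \1_A x) = 0.
  exact: (integral_measurable_eq0 fi fo ft).
have mf := rintegrable_measurable fi.
have mP : measurable [set x | 0 < f x] by exact: measurable_lt_set.
have mN : measurable [set x | 0 < - f x].
  by apply: measurable_lt_set => //; exact: measurable_funN.
have P0 := sign_part_null fi (vm _ mP).
have Nf : rintegrable mu (fun x => - f x).
  by have := rintegrableZ (-1) fi; under eq_fun do rewrite mulN1r.
have N0 : mu [set x | 0 < - f x] = 0%E.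
  apply: sign_part_null => //.
  have -> : (fun x => - f x * \1_[set x | 0 < - f x] x) =
      (fun x => -1 * (f x * \1_[set x | 0 < - f x] x)).
    by apply/funext => x; rewrite mulN1r mulNr.
  rewrite RintegralZl// ?(vm _ mN) ?mulr0//.
  exact: rintegrable_indic.
rewrite (_ : [set x | f x != 0] = [set x | 0 < f x] `|` [set x | 0 < - f x]).
  have e1 : (mu [set x | 0 < f x]%R <= 0)%E by rewrite P0.
  have e2 : (mu [set x | 0 < - f x]%R <= 0)%E by rewrite N0.
  apply/eqP; rewrite eq_le measure_ge0 andbT.
  apply: le_trans (measureU2 _ mP mN) _; rewrite -(adde0 0%E).
  by apply: leeD; [exact: e1|exact: e2].
apply/seteqP; split => x /=; rewrite oppr_gt0.
  by rewrite neq_lt => /orP[|]; [right|left].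
by move=> [/gt_eqF ->|/lt_eqF ->].
Qed.

End density.

(** * From reflections to Steiner symmetry *)
Section hyperplane_reflection.
Context {R : realType} {n : nat}.
Local Notation E := 'rV[R]_n.+1.
Implicit Types (x y : E) (A : set E).

(** The reflection about the hyperplane [lastc y = r / 2]. *)
Definition rho (r : R) (y : E) : E := snoc (firsts y, r - lastc y).

Lemma rhoK r : involutive (rho r).
Proof.
move=> y; rewrite /rho firsts_snoc lastc_snoc/= opprB addrC subrK.
exact: snocK.
Qed.

Lemma lastc_rho r y : lastc (rho r y) = r - lastc y.
Proof. by rewrite /rho lastc_snoc. Qed.

Lemma firsts_rho r y : firsts (rho r y) = firsts y.
Proof. by rewrite /rho firsts_snoc. Qed.

Lemma dot_snoc x y : dot x y = dot (firsts x) (firsts y) + lastc x * lastc y.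
Proof.
rewrite /dot big_ord_recr/=; congr (_ + _); apply: eq_bigr => i _.
by rewrite !mxE (_ : widen_ord _ i = lift ord_max i)//; apply/val_inj; rewrite /= /bump leqNgt ltn_ord.
Qed.

Lemma firstsB x y : firsts (x - y) = firsts x - firsts y.
Proof. by apply/rowP => i; rewrite !mxE. Qed.

Lemma lastcB x y : lastc (x - y) = lastc x - lastc y.
Proof. by rewrite /lastc !mxE. Qed.

Lemma rho_isometry r : Defs.isometry (rho r).
Proof.
move=> x y; rewrite /enorm; congr Num.sqrt.
rewrite !(dot_snoc (_ - _)) !firstsB !lastcB !firsts_rho !lastc_rho.
by rewrite (_ : r - lastc x - (r - lastc y) = - (lastc x - lastc y)) ?mulrNN//; ring.
Qed.

Lemma rho_mpres r : mpres (lebs n.+1) (rho r).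
Proof. exact: isometry_mpres (@rhoK r) (@rhoK r) (@rho_isometry r). Qed.

Lemma dot_rhoB r x y : dot (x - rho r y) (x - rho r y) =
  dot (x - y) (x - y) + (r - lastc x *+ 2) * (r - lastc y *+ 2).
Proof.
by rewrite !(dot_snoc (_ - _)) !firstsB !lastcB firsts_rho lastc_rho !mulr2n; ring.
Qed.

Lemma measurable_firsts : measurable_fun setT (@firsts R n).
Proof.
apply: measurable_fun_rVP => i; under eq_fun do rewrite mxE.
exact: measurable_rV_coord.
Qed.

Lemma measurable_lastc : measurable_fun setT (@lastc R n).
Proof. exact: measurable_rV_coord. Qed.

Definition section_measure (A : set E) (x' : 'rV[R]_n) : \bar R :=
  lebesgue_measure (line_section A x').

Lemma measurable_section_measure A : measurable A ->
  measurable_fun setT (section_measure A).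
Proof.
move=> mA; have mA' : measurable (@snoc R n @^-1` A).
  by rewrite -[X in measurable X]setTI; apply: measurable_snoc.
have := measurable_fun_xsection (lebesgue_measure) mA'.
by apply: eq_measurable_fun => x _ /=; rewrite xsectionE.
Qed.

Lemma measurable_line_section A (x' : 'rV[R]_n) : measurable A -> measurable (line_section A x').
Proof.
move=> mA; have mA' : measurable (@snoc R n @^-1` A).
  by rewrite -[X in measurable X]setTI; apply: measurable_snoc.
rewrite (_ : line_section A x' = xsection (@snoc R n @^-1` A) x').
  exact: measurable_xsection.
by rewrite xsectionE.
Qed.

Lemma lebs_section A : lebs n.+1 A = (\int[lebs n]_x section_measure A x)%E.
Proof. exact: lebs_snoc. Qed.

Lemma section_measure_ge0 A (x' : 'rV[R]_n) : (0 <= section_measure A x')%E.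
Proof. exact: measure_ge0. Qed.

Lemma section_measure_ae0 A : measurable A -> lebs n.+1 A = 0%E ->
  {ae lebs n, forall x' : 'rV[R]_n, section_measure A x' = 0%E}.
Proof.
move=> mA A0; apply: ge0_integral_eq0.
- exact: measurable_section_measure.
- exact: section_measure_ge0.
- by rewrite -lebs_section.
Qed.

End hyperplane_reflection.

Section one_dimensional_rearrangement.
Context {R : realType}.
Local Notation leb1 := (@lebesgue_measure R).
Variables (I : set R) (phi : R -> R) (a : R).
Hypothesis mI : forall c, measurable [set b | I b /\ c <= phi b].
Hypothesis I_ball : forall b, `|b| < `|a| -> I b.
Hypothesis outer_null : leb1 [set b | [/\ I b, `|a| < `|b| & phi a < phi b]] = 0%E.
Hypothesis inner_null : leb1 [set b | [/\ I b, `|b| < `|a| & phi b < phi a]] = 0%E.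
Hypothesis m_outer : measurable [set b | [/\ I b, `|a| < `|b| & phi a < phi b]].
Hypothesis m_inner : measurable [set b | [/\ I b, `|b| < `|a| & phi b < phi a]].

Let half_level (c : R) : \bar R := (2^-1%:E * leb1 [set b | I b /\ (c <= phi b)%R])%E.

Let half2 (r : R) : 2^-1 * (r *+ 2) = r.
Proof. by rewrite mulr2n; field. Qed.

Let sym_itv b1 b2 (r : R) : 0 <= r ->
  leb1 [set` Interval (BSide b1 (- r)) (BSide b2 r)] = (r *+ 2)%:E.
Proof.
rewrite le_eqVlt => /orP[/eqP <-|r0].
  by rewrite lebesgue_measure_itv/= oppr0 ltxx mul0rn.
by rewrite lebesgue_measure_itv/= lte_fin gtrN// -EFinD opprK mulr2n.
Qed.

(** Up to null sets, a superlevel set is contained in the interval of radius [|a|] if its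
    level is above [phi a], and contains it otherwise. *)
Lemma half_level_above c : phi a < c -> (half_level c <= `|a|%:E)%E.
Proof.
move=> ac; rewrite -[in leRHS](half2 `|a|) EFinM; apply: lee_wpmul2l.
  by rewrite lee_fin invr_ge0.
rewrite -(sym_itv true false (normr_ge0 a)).
pose O := [set b | [/\ I b, `|a| < `|b| & phi a < phi b]].
apply: (@le_trans _ _ (leb1 (`[- `|a|, `|a|]%classic `|` O))).
  apply: le_measure; rewrite ?inE; [exact: mI|exact: measurableU|].
  move=> b [Ib cb]; have [ba|ab] := leP `|b| `|a|; last first.
    by right; split => //; exact: lt_le_trans cb.
  by left; rewrite /= in_itv/= -ler_norml.
pose J : set R := `[- `|a|, `|a|]%classic.
apply: (@le_trans _ _ (leb1 J + leb1 O)%E).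
  exact: measureU2.
by rewrite [X in (_ + X)%E]outer_null adde0.
Qed.

Lemma half_level_below c : c <= phi a -> (`|a|%:E <= half_level c)%E.
Proof.
move=> ca; rewrite -[in leLHS](half2 `|a|) EFinM; apply: lee_wpmul2l.
  by rewrite lee_fin invr_ge0.
rewrite -(sym_itv false true (normr_ge0 a)).
pose N := [set b | [/\ I b, `|b| < `|a| & phi b < phi a]].
pose L := [set b | I b /\ c <= phi b].
apply: (@le_trans _ _ (leb1 (L `|` N))).
  apply: le_measure; rewrite ?inE; [exact: measurable_itv|by apply: measurableU => //; exact: mI|].
  move=> b; rewrite /= in_itv/= -ltr_norml => ba.
  have Ib := I_ball ba; have [cb|bc] := leP c (phi b); first by left.
  by right; split => //; exact: lt_le_trans ca.
apply: (@le_trans _ _ (leb1 L + leb1 N)%E).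
  by apply: measureU2 => //; exact: mI.
by rewrite [X in (_ + X)%E]inner_null adde0.
Qed.

(** Off the countably many radii where a level set has exactly the measure of the
    ball of that radius, a value that is sorted by distance to the origin is
    recovered from the measures of the level sets. *)
Lemma rearranged_value : I a ->
  (forall q : rat, half_level (ratr q) <> `|a|%:E) ->
  ereal_sup [set c%:E | c in [set c : R |
    (exists b, I b /\ c <= phi b) /\ (`|a|%:E < half_level c)%E]] = (phi a)%:E.
Proof.
move=> Ia nlev; set L := ereal_sup _.
have up : (L <= (phi a)%:E)%E.
  apply: ge_ereal_sup => _ [c [_ ac] <-]; rewrite lee_fin leNgt; apply/negP => lt.
  by have := lt_le_trans ac (half_level_above lt); rewrite ltxx.
have low (q : rat) : ratr q < phi a -> ((ratr q)%:E <= L)%E.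
  move=> qa; apply: ereal_sup_ubound; exists (ratr q) => //; split.
    by exists a; split => //; exact: ltW.
  rewrite lt_neqAle half_level_below ?ltW// andbT.
  by apply/eqP => /esym; exact: nlev.
apply/eqP; rewrite eq_le up/= leNgt; apply/negP => lt.
have [q qL qa] : exists2 q : rat, (L < (ratr q)%:E)%E & ratr q < phi a.
  move: lt up; case: L {low} => [r|//|].
    rewrite lte_fin => /rat_in_itvoo[q]; rewrite in_itv/= => /andP[rq qa] _.
    by exists q.
  move=> _ _; have /rat_in_itvoo[q] : phi a - 1 < phi a by rewrite ltrBlDr ltrDl.
  by rewrite in_itv/= => /andP[_ qa]; exists q => //; exact: ltNyr.
by have := lt_le_trans qL (low q qa); rewrite ltxx.
Qed.

End one_dimensional_rearrangement.

Section steiner_from_reflections.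
Context {R : realType} {n : nat}.
Local Notation E := 'rV[R]_n.+1.
Local Notation mu := (@lebs R n.+1).
Local Notation leb1 := (@lebesgue_measure R).
Variables (Om : set E) (f : E -> R).
Hypotheses (mO : measurable Om) (mf : measurable_fun setT f).
Hypothesis OmE : Om = steiner_set Om.

Definition unsorted (r : R) : set E := [set y |
  [/\ Om y, Om (rho r y), `|lastc y| < `|r - lastc y| & f y < f (rho r y)]].

Hypothesis sorted : forall r, mu (unsorted r) = 0%E.

Let bad (y : E) (b : R) : Prop := [/\ Om y, Om (snoc (firsts y, b)),
  `|lastc y| < `|b| & f y < f (snoc (firsts y, b))].

Let setbad : set (E * R) := [set p | bad p.1 p.2].

Let msn : measurable_fun setT (fun p : E * R => snoc (firsts p.1, p.2) : E).
Proof.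
apply: (measurableT_comp (@measurable_snoc _ R n)); apply: measurable_fun_pair => //.
exact: (measurableT_comp measurable_firsts).
Qed.

Let indic_pre (T U : Type) (B : set U) (h : T -> U) x :
  \1_B (h x) = \1_[set x | B (h x)] x :> R.
Proof. by rewrite !indicE; congr (_%:R); apply/idP/idP; rewrite !inE. Qed.

Let m1 : measurable_fun setT (fun p : E * R => lastc p.1).
Proof. exact: (measurableT_comp measurable_lastc). Qed.

Let mpre1 : measurable [set p : E * R | Om p.1].
Proof.
have := @measurable_fst _ _ E R measurableT Om mO; by rewrite setTI.
Qed.

Let mpre2 : measurable [set p : E * R | Om (snoc (firsts p.1, p.2))].
Proof. by have := msn measurableT mO; rewrite setTI. Qed.

Let msetbad : measurable setbad.
Proof.
rewrite (_ : setbad = [set p : E * R | Om p.1] `&`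
  [set p : E * R | Om (snoc (firsts p.1, p.2))] `&`
  [set p : E * R | `|lastc p.1| < `|p.2|] `&`
  [set p : E * R | f p.1 < f (snoc (firsts p.1, p.2))]).
  apply: measurableI; last first.
    apply: measurable_lt_set; first exact: (measurableT_comp mf).
    exact: (measurableT_comp mf msn).
  apply: measurableI; first exact: measurableI.
  apply: measurable_lt_set; first exact: (measurableT_comp _ m1).
  by apply: measurableT_comp.
by apply/seteqP; split => -[y b] /=; [case|case=> -[[]]].
Qed.

(** Fubini along the substitution [b = r - lastc y], which replaces the slice over a fixed
    point [y] by the traces on the graphs of the reflections. *)
Lemma null_slices (B : set (E * R)) : measurable B ->
  (forall r, mu [set y | B (y, r - lastc y)] = 0%E) ->
  {ae mu, forall y, leb1 [set b | B (y, b)] = 0%E}.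
Proof.
move=> mB B0; pose F (p : E * R) : \bar R := (\1_B p)%:E.
have mF : measurable_fun setT F by apply/measurable_EFinP; exact: measurable_indic.
have F0 p : (0 <= F p)%E by rewrite lee_fin.
pose shear (p : E * R) : E * R := (p.1, p.2 - lastc p.1).
have msh : measurable_fun setT shear.
  apply: measurable_fun_pair => //; apply: measurable_funB => //; exact: m1.
have mG : measurable_fun setT (F \o shear) by exact: (measurableT_comp mF msh).
have G0 p : (0 <= (F \o shear) p)%E by exact: F0.
have sliceE y : (leb1 [set b | B (y, b)] = \int[leb1]_r F (shear (y, r)))%E.
  have mFy : measurable_fun setT (fun b : R => F (y, b)) by exact: (measurableT_comp mF).
  transitivity (\int[leb1]_b F (y, b))%E; last first.
    by rewrite -(mpres_integral (mpres_shift_lebesgue (- lastc y)) mFy).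
  have mBy : measurable [set b | B (y, b)].
    rewrite (_ : [set b | _] = xsection B y); first exact: measurable_xsection.
    by rewrite xsectionE.
  rewrite -[LHS](congr1 leb1 (setIT _)) -(integral_indic leb1 measurableT mBy).
  by apply: eq_integral => b _; rewrite /F (indic_pre B (fun b => (y, b))).
have := @ge0_integral_eq0 _ _ _ mu (fun y => leb1 [set b | B (y, b)]).
apply.
- under eq_fun do rewrite sliceE.
  have K : measurable_fun setT (fubini_F leb1 (F \o shear)).
    by apply: measurable_fun_fubini_tonelli_F; [exact: mG|exact: G0].
  exact: K.
- by move=> y; exact: measure_ge0.
under eq_integral do rewrite sliceE.
rewrite (fubini_tonelli (m1 := mu) (m2 := leb1) (F \o shear) mG G0) /=.
rewrite (eq_integral (fun=> 0%E)) ?integral0// => r _.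
have mBr : measurable [set y | B (y, r - lastc y)].
  have mg : measurable_fun setT (fun y : E => (y, r - lastc y) : E * R).
    apply: measurable_fun_pair => //; apply: measurable_funB => //.
    exact: measurable_lastc.
  by have := mg measurableT B mB; rewrite setTI.
rewrite -[RHS](B0 r) -[RHS](congr1 mu (setIT _)) -(integral_indic mu measurableT mBr).
by apply: eq_integral => y _; rewrite /F/= (indic_pre B (fun y => (y, r - lastc y))).
Qed.

Let null_radius (A : set E) : measurable A ->
  {ae mu, forall y, 2^-1 * fine (section_measure A (firsts y)) <> `|lastc y|}.
Proof.
move=> mA; pose h y := 2^-1 * fine (section_measure A (firsts y)) - `|lastc y|.
have mh : measurable_fun setT h.
  apply: measurable_funB; last exact: (measurableT_comp _ measurable_lastc).
  apply: measurable_funM => //; apply: (measurableT_comp (@fine_measurable _ setT _)) => //.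
  exact: (measurableT_comp (measurable_section_measure mA) measurable_firsts).
have mC : measurable (h @^-1` [set 0]).
  by rewrite -[X in measurable X]setTI; apply: mh => //; exact: measurable_set1.
exists (h @^-1` [set 0]); split => //; last first.
  by move=> y /= /contrapT e; rewrite /h e subrr.
rewrite lebs_section (eq_integral (fun=> 0%E)) ?integral0// => x' _.
rewrite {1}/section_measure; pose r := 2^-1 * fine (section_measure A x').
apply: countable_lebesgue_measure0.
apply: (@sub_countable _ _ _ [set r; - r]); last exact: finite_set_countable.
apply: subset_card_le => t; rewrite /line_section/= /h firsts_snoc lastc_snoc/=.
move=> /eqP; rewrite subr_eq0 -/r => /eqP ->.
by have [_|_] := ger0P t; [left|right; rewrite opprK].
Qed.

Let slice_null : {ae mu, forall y, leb1 [set b | setbad (y, b)] = 0%E}.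
Proof. by apply: null_slices => // r; rewrite -[RHS](sorted r). Qed.

Lemma measurable_unsorted r : measurable (unsorted r).
Proof.
have mg : measurable_fun setT (fun y : E => (y, r - lastc y) : E * R).
  by apply: measurable_fun_pair => //; apply: measurable_funB => //; exact: measurable_lastc.
by have := mg measurableT _ msetbad; rewrite setTI.
Qed.

Let flip (p : E * R) : E * R := (snoc (firsts p.1, p.2), lastc p.1).

Let mflip : measurable (flip @^-1` setbad).
Proof.
rewrite -[X in measurable X]setTI.
by apply: (_ : measurable_fun setT flip) => //; exact: measurable_fun_pair.
Qed.

Let slice_null_flip : {ae mu, forall y, leb1 [set b | setbad (flip (y, b))] = 0%E}.
Proof.
apply: (null_slices mflip) => r; rewrite -[RHS](sorted r).
rewrite -[RHS]((rho_mpres r).2 _ (measurable_unsorted r)).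
have e y : flip (y, r - lastc y) = (rho r y, r - lastc (rho r y)).
  by rewrite /flip lastc_rho subKr.
by congr (lebs _ _); apply/seteqP; split => y; rewrite /preimage/= e.
Qed.

Let half_fine (x : \bar R) (r : R) : (2^-1%:E * x = r%:E)%E -> 2^-1 * fine x = r.
Proof.
case: x => [x [//]| |] /=.
  by rewrite mulry gtr0_sg ?invr_gt0// mul1e.
by rewrite mulrNy gtr0_sg ?invr_gt0// mul1e.
Qed.

(** Almost every point is compared with almost every point of its vertical line,
    so that on almost every line the level sets are centred intervals up to null sets. *)
Theorem steiner_of_sorted : steiner_sym_fun0 Om f.
Proof.
pose q_ (k : nat) : rat := odflt 0 (unpickle k).
have mL c : measurable [set y | Om y /\ c <= f y].
  apply: measurableI => //; have := mf measurableT (measurable_itv `[c, +oo[).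
  rewrite setTI; congr measurable; apply/seteqP; split => y /=; by rewrite in_itv/= andbT.
have lev : {ae mu, forall y k, 2^-1 * fine (section_measure
    [set y | Om y /\ ratr (q_ k) <= f y] (firsts y)) <> `|lastc y|}.
  by apply: ae_foralln => k; exact: null_radius.
move: slice_null slice_null_flip lev; apply: filterS3 => y s1 s2 lev Oy.
pose x' := firsts y; pose a := lastc y.
pose I := line_section Om x'; pose phi b := f (snoc (x', b)).
have ya : snoc (x', a) = y by exact: snocK.
have I_ball b : `|b| < `|a| -> I b.
  move=> ba; have : steiner_set Om y by rewrite -OmE.
  move=> [_ al]; rewrite /I /line_section OmE; split.
    by exists y => //; rewrite firsts_snoc.
  by rewrite lastc_snoc firsts_snoc; apply: le_lt_trans al; rewrite lee_fin ltW.
have mI c : measurable [set b | I b /\ c <= phi b].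
  exact: (measurable_line_section x' (mL c)).
have e1 : [set b | [/\ I b, `|a| < `|b| & phi a < phi b]] = [set b | setbad (y, b)].
  by rewrite /phi ya; apply/seteqP; split => b /=; [case|case].
have e2 : [set b | [/\ I b, `|b| < `|a| & phi b < phi a]] = [set b | setbad (flip (y, b))].
  apply/seteqP; split => b; rewrite /phi ya /setbad /flip/= /bad firsts_snoc lastc_snoc/= ya.
    by case.
  by case.
have m1' : measurable [set b | setbad (y, b)].
  by have := measurable_xsection y msetbad; rewrite xsectionE.
have m2' : measurable [set b | setbad (flip (y, b))].
  by have := measurable_xsection y mflip; rewrite xsectionE.
rewrite /steiner_fun -{1}ya.
rewrite -(@rearranged_value _ I phi a mI I_ball); rewrite ?e1 ?e2//; first last.
- move=> q hq; apply: (lev (pickle q)); rewrite /q_ pickleK/=.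
  exact: half_fine hq.
- by rewrite /I /line_section/= ya.
congr (ereal_sup (_ @` _)); apply/seteqP; split => c [H1 H2]; split => //.
  have [b [Ib cb]] := H1; by exists (snoc (x', b)) => //; rewrite firsts_snoc.
have [z [Oz cz] zx] := H1; exists (lastc z); rewrite /I /phi /line_section/=.
by rewrite -/x' in zx; rewrite -zx snocK.
Qed.

End steiner_from_reflections.

(** * Reflections of a Steiner symmetric domain *)
Lemma lebs_open_gt0 {R : realType} {n : nat} (O : set 'rV[R]_n) x :
  open O -> O x -> (0 < lebs n O)%E.
Proof.
move=> oO Ox; have /nbhs_ballP[e e0 eO] := open_nbhs_nbhs (conj oO Ox).
apply: (@lt_le_trans _ _ (lebs n ((fun y => y - x) @^-1` cube n e))).
  rewrite (mpres_shift (- x)).2; last exact: measurable_cube.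
  by rewrite [ltRHS]leb_cube ?ltW// lte_fin exprn_gt0// pmulrn_lgt0.
apply: le_measure; rewrite ?inE.
- have := (mpres_shift (- x)).1 measurableT _ (@measurable_cube R n e).
  by rewrite setTI.
- exact: open_measurable_rV.
move=> y /= yx; apply: eO; split => // i j; rewrite (ord1 i) /ball/= distrC.
by have := yx j; rewrite !mxE.
Qed.

Section steiner_overlap.
Context {R : realType} {n : nat}.
Local Notation E := 'rV[R]_n.+1.
Local Notation mu := (@lebs R n.+1).
Variables (Om : set E) (t : R).
Hypotheses (mO : measurable Om) (fO : (mu Om < +oo)%E).
Hypothesis OmE : Om = steiner_set Om.
Hypothesis t0 : t != 0.

Let W : set E := [set y | t * lastc y < t ^+ 2 /\ Om y /\ ~ Om (rho (2 * t) y)].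

(** Reflecting about [t] the end of the interval [- L, L] that is farther from [t] takes it
    out of the interval. *)
Lemma asymmetric_end (L : R) : 0 < L -> exists p q, p < q /\
  (forall b, p < b < q -> [/\ `|b| < L, t * b < t ^+ 2 & L <= `|2 * t - b|]).
Proof.
move=> L0; move: t0; rewrite neq_lt => /orP[tn|tp].
  exists (Num.max (Num.max t (- L)) (2 * t + L)), L; split.
    by rewrite !gt_max; lra.
  move=> b; rewrite !gt_max => /andP[/andP[/andP[h1 h2] h3] h4]; split.
  - by rewrite ltr_norml h2.
  - by rewrite expr2 ltr_nM2l.
  - by rewrite ler_normr; apply/orP; right; lra.
exists (- L), (Num.min (Num.min t L) (2 * t - L)); split.
  by rewrite !lt_min; lra.
move=> b; rewrite !lt_min => /andP[h4 /andP[/andP[h1 h2] h3]]; split.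
- by rewrite ltr_norml h2 h4.
- by rewrite expr2 ltr_pM2l.
- by rewrite ler_normr; apply/orP; left; lra.
Qed.

Lemma measurable_overlap : measurable W.
Proof.
have m1 : measurable [set y : E | t * lastc y < t ^+ 2].
  apply: measurable_lt_set => //; apply: measurable_funM => //.
  exact: measurable_lastc.
have m2 : measurable (@rho R n (2 * t) @^-1` Om).
  by rewrite -[X in measurable X]setTI; apply: (rho_mpres _).1.
by apply: measurableI => //; apply: measurableI => //; exact: measurableC.
Qed.

Let section_gt0 (x' : 'rV[R]_n) : (0 < section_measure Om x' < +oo)%E ->
  (0 < section_measure W x')%E.
Proof.
move=> /andP[m0 moo]; set m := section_measure Om x' in m0 moo.
have mfin : m \is a fin_num by rewrite ge0_fin_numE// ltW.
pose L := 2^-1 * fine m.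
have L0 : 0 < L by rewrite mulr_gt0 ?invr_gt0// fine_gt0// m0.
have OmL b : Om (snoc (x', b)) <-> `|b| < L.
  have sE : (2^-1%:E * m = L%:E)%E by rewrite /L EFinM fineK.
  rewrite {1}OmE /steiner_set/= lastc_snoc firsts_snoc/= -/(section_measure Om x').
  rewrite -/m sE lte_fin; split => [[]//|bL]; split => //.
  have : line_section Om x' !=set0.
    apply/set0P/eqP => s0; move: m0; by rewrite /m /section_measure s0 measure0 ltxx.
  by move=> [c Oc]; exists (snoc (x', c)) => //; rewrite firsts_snoc.
have [p [q [pq H]]] := asymmetric_end L0.
apply: (@lt_le_trans _ _ (lebesgue_measure `]p, q[%classic)).
  by rewrite lebesgue_measure_itv/= lte_fin pq -EFinB lte_fin subr_gt0.
apply: le_measure; rewrite ?inE; [exact: measurable_itv|exact: (measurable_line_section _ measurable_overlap)|].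
move=> b; rewrite /= in_itv/= => /H[h1 h2 h3]; rewrite /line_section/=; split.
  by rewrite lastc_snoc.
split; first exact/OmL.
by rewrite /rho firsts_snoc lastc_snoc/= => /OmL; rewrite ltNge h3.
Qed.

(** On each line that meets the domain in an interval of positive finite length, the
    reflection about [t] takes one end of that interval out of the domain. *)
Lemma steiner_overlap_gt0 : (0 < mu Om)%E -> (0 < mu W)%E.
Proof.
move=> Om0; rewrite lt_neqAle measure_ge0 andbT; apply/eqP => /esym W0.
have mS := measurable_section_measure mO.
have fin : {ae lebs n, forall x', setT x' -> section_measure Om x' \is a fin_num}.
  apply: integrable_ae => //; apply/integrableP; split => //.
  rewrite (eq_integral (section_measure Om)); first by rewrite -lebs_section.
  by move=> x' _; rewrite gee0_abs// section_measure_ge0.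
have O0 : {ae lebs n, forall x', setT x' -> section_measure Om x' = cst 0%E x'}.
  move: fin (section_measure_ae0 measurable_overlap W0); apply: filterS2 => x' /(_ I) fx wx _.
  apply/eqP; rewrite eq_le section_measure_ge0 andbT leNgt; apply/negP => s0.
  have : (0 < section_measure W x')%E.
    by apply: section_gt0; rewrite s0/= -ge0_fin_numE// section_measure_ge0.
  by rewrite wx ltxx.
have := @ae_eq_integral _ _ _ (lebs n) setT (cst 0%E) (section_measure Om) measurableT mS (measurable_cst 0%E) O0.
by rewrite -lebs_section integral0 => e; move: Om0; rewrite e ltxx.
Qed.

End steiner_overlap.

Lemma same_side_gap {R : realFieldType} (t a b : R) : t * a < t ^+ 2 -> t * b < t ^+ 2 ->
  0 < (2 * t - a *+ 2) * (2 * t - b *+ 2).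
Proof.
rewrite -subr_gt0 => ha; rewrite -subr_gt0 => hb.
have t2 : 0 < t ^+ 2.
  rewrite exprn_even_gt0//; apply: contraTneq ha => ->.
  by rewrite mul0r expr0n subr0 ltxx.
rewrite -(pmulr_rgt0 _ t2).
rewrite [ltRHS](_ : _ = 4 * ((t ^+ 2 - t * a) * (t ^+ 2 - t * b))).
  by rewrite !mulr_gt0.
by rewrite !mulr2n; ring.
Qed.

Lemma mirror_closer {R : realFieldType} (t a : R) : t ^+ 2 <= t * a -> `|2 * t - a| <= `|a|.
Proof.
move=> h; rewrite -ler_sqr ?nnegrE// !real_normK ?num_real// sqrrB.
by rewrite !expr2 !mulr2n in h *; lra.
Qed.

Section reflections_of_domain.
Context {R : realType} {n : nat}.
Local Notation E := 'rV[R]_n.+1.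
Local Notation mu := (@lebs R n.+1).
Variables (Om : set E) (T Ti : E -> E).
Hypotheses (TK : cancel T Ti) (TiK : cancel Ti T) (iT : Defs.isometry T).
Hypotheses (mO : measurable Om) (fO : (mu Om < +oo)%E) (Om0 : (0 < mu Om)%E).
Hypothesis OmE : T @` Om = steiner_set (T @` Om).

Let iTi : Defs.isometry Ti := isometry_inv TiK iT.
Let mT : mpres mu T := isometry_mpres TK TiK iT.
Let mTi : mpres mu Ti := isometry_mpres TiK TK iTi.

Lemma flat_domainE : T @` Om = Ti @^-1` Om.
Proof.
apply/seteqP; split => y /=; first by move=> [x Ox <-]; rewrite TK.
by move=> Oy; exists (Ti y) => //; rewrite TiK.
Qed.

Lemma measurable_flat : measurable (T @` Om).
Proof. by rewrite flat_domainE -[X in measurable X]setTI; apply: mTi.1. Qed.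

Lemma lebs_flat : mu (T @` Om) = mu Om.
Proof. by rewrite flat_domainE mTi.2. Qed.

Definition flat_reflection (t : R) (x : E) : E := Ti (rho (2 * t) (T x)).

(** With this inequality the side contains the hyperplane of symmetry for either sign
    of [t]. *)
Definition flat_side (t : R) : set E := [set x | t * lastc (T x) < t ^+ 2].

Lemma flat_reflectionP (t : R) : t != 0 ->
  reflection Om (flat_side t) (flat_reflection t).
Proof.
move=> t0.
have sK : involutive (flat_reflection t).
  by move=> x; rewrite /flat_reflection TiK rhoK TK.
have siso : Defs.isometry (flat_reflection t).
  by move=> x y; rewrite /flat_reflection iTi rho_isometry iT.
have t2 : 0 < t ^+ 2 by rewrite exprn_even_gt0.
have OmT x : Om x <-> (T @` Om) (T x) by rewrite flat_domainE /= TK.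
have lastT x : lastc (T (flat_reflection t x)) = 2 * t - lastc (T x).
  by rewrite /flat_reflection TiK lastc_rho.
split.
- exact: sK.
- exact: (isometry_mpres sK sK siso).
- exact: siso.
- apply: measurable_lt_set => //; apply: measurable_funM => //.
  exact: (measurableT_comp measurable_lastc mT.1).
- move=> x; rewrite /flat_side/= lastT; rewrite expr2 in t2 *; lra.
- move=> x /negP; rewrite /flat_side/= -leNgt le_eqVlt => /orP[/eqP e|h].
    right; rewrite /flat_reflection /rho.
    have -> : lastc (T x) = t.
      by apply: (mulfI t0); rewrite -e expr2.
    rewrite mulrC mulr_natr mulr2n addrK.
    have -> : snoc (firsts (T x), t) = T x.
      have <- : lastc (T x) = t by apply: (mulfI t0); rewrite -e expr2.
      exact: snocK.
    exact: TK.
  left; rewrite lastT; rewrite expr2 in h *; lra.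
- move=> x y; rewrite /flat_side/= => Xx Xy.
  rewrite -(iT x y) -(iT x) /flat_reflection TiK /enorm.
  have gap : 0 < (2 * t - lastc (T x) *+ 2) * (2 * t - lastc (T y) *+ 2).
    exact: same_side_gap.
  rewrite dot_rhoB ltr_sqrt ?ltrDl//; apply: lt_le_trans gap _.
  by rewrite lerDr dot_ge0.
- move=> x Ox nX; apply/OmT; rewrite /flat_reflection TiK.
  have := (OmT x).1 Ox; rewrite OmE; move=> [_ h]; split.
    by rewrite firsts_rho; exists (T x) => //; exact/OmT.
  rewrite firsts_rho lastc_rho; apply: le_lt_trans h; rewrite lee_fin.
  by apply: mirror_closer; rewrite leNgt; apply/negP.
have := @steiner_overlap_gt0 _ _ (T @` Om) t measurable_flat.
rewrite lebs_flat => /(_ fO OmE t0 Om0).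
set W := [set y | _] => W0.
have mW : measurable W by exact: measurable_overlap measurable_flat.
rewrite -(mT.2 _ mW) in W0; rewrite (_ : [set x | _] = T @^-1` W)//.
have OmS x : Om (flat_reflection t x) <-> (T @` Om) (rho (2 * t) (T x)).
  by rewrite OmT /flat_reflection TiK.
by apply/seteqP; split => x [h1 [h2 h3]]; (split; [by []|split; [exact/OmT|by move/OmS]]).
Qed.

End reflections_of_domain.

(** * Optimal pairs are Steiner symmetric *)
Section sorted_values.
Context {R : realType} {n : nat}.
Variable s : R.
Hypotheses (s0 : 0 < s) (s1 : s < 1).
Local Notation E := 'rV[R]_n.+1.
Local Notation mu := (@lebs R n.+1).
Variables (Om : set E) (g u : E -> R) (lam c : R).
Hypothesis V : optimal_pair s Om g u lam c.
Variables (x0 y0 : E).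
Hypotheses (oO : open Om) (Ox0 : Om x0) (nOy0 : ~ Om y0).
Hypothesis u_nz : (0 < mu [set x | (0 < u x)%R])%E.
Variables (T Ti : E -> E).
Hypotheses (TK : cancel T Ti) (TiK : cancel Ti T) (iT : Defs.isometry T).
Hypothesis OmE : T @` Om = steiner_set (T @` Om).

Let mO := op_mO V.
Let fO := op_fO V.
Let iTi : Defs.isometry Ti := isometry_inv TiK iT.
Let mT : mpres mu T := isometry_mpres TK TiK iT.
Let mTi : mpres mu Ti := isometry_mpres TiK TK iTi.
Let F (t : R) (t0 : t != 0) : reflection Om (flat_side T t) (flat_reflection T Ti t) :=
  flat_reflectionP TK TiK iT mO fO (lebs_open_gt0 oO Ox0) OmE t0.

Lemma unsorted_flat (h : E -> R) (r : R) : r != 0 -> unsorted (T @` Om) (h \o Ti) r `<=`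
  Ti @^-1` wrong_order Om h (flat_side T (r / 2)) (flat_reflection T Ti (r / 2)).
Proof.
move=> r0 y [Oy Ory ay hy].
have e : 2 * (r / 2) = r by rewrite mulrC divfK.
rewrite (flat_domainE _ TK TiK) in Oy Ory.
split; rewrite /flat_side /flat_reflection/= ?TiK ?e//.
rewrite ltNge; apply/negP => /mirror_closer; rewrite e => le.
by have := lt_le_trans ay le; rewrite ltxx.
Qed.

(** Every pair of points at different distances from the hyperplane of symmetry is
    exchanged by the reflection about a hyperplane other than it; here [t = r / 2]. *)
Lemma steiner_of_wrong_order (h : E -> R) : measurable_fun setT h ->
  (forall t : R, t != 0 ->
     mu.-negligible (wrong_order Om h (flat_side T t) (flat_reflection T Ti t))) ->
  steiner_sym_fun0 (T @` Om) (h \o Ti).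
Proof.
move=> mh H; have mOT := measurable_flat TK TiK iT mO.
apply: steiner_of_sorted => //; first exact: (measurableT_comp mh mTi.1).
move=> r; have [->|r0] := eqVneq r 0.
  rewrite (_ : unsorted _ _ _ = set0) ?measure0//; apply/seteqP; split => y //= [_ _].
  by rewrite sub0r normrN ltxx.
have r2 : r / 2 != 0 by rewrite mulf_neq0 ?invr_eq0.
apply: measure_negligible.
  by apply: measurable_unsorted => //; exact: (measurableT_comp mh mTi.1).
exact: negligibleS (unsorted_flat r0) (mpres_negligible mTi (H _ r2)).
Qed.

Lemma wrong_order_ae (h h' : E -> R) (t : R) : t != 0 ->
  {ae mu, forall x, Om x -> h x = h' x} ->
  mu.-negligible (wrong_order Om h (flat_side T t) (flat_reflection T Ti t)) ->
  mu.-negligible (wrong_order Om h' (flat_side T t) (flat_reflection T Ti t)).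
Proof.
move=> t0 hh' W0; pose N := ~` [set x | Om x -> h x = h' x].
have N0 : mu.-negligible N by exact: hh'.
have N1 := mpres_negligible (rf_mpres (F t0)) N0.
apply: negligibleS (negligibleU W0 (negligibleU N0 N1)) => x [Xx Ox Osx lt].
have [e|n1] := pselect (Om x -> h x = h' x); last by right; left.
have [e'|n2] := pselect (Om (flat_reflection T Ti t x) ->
  h (flat_reflection T Ti t x) = h' (flat_reflection T Ti t x)); last by right; right.
by left; split => //; rewrite e// e'.
Qed.

Let u_pos : mu [set x | Om x /\ u x = 0] = 0%E.
Proof.
apply: (optimal_pair_gt0 V (eta := dist_cutoff Om 1)) => //.
- exact: (dist_cutoff_test nOy0 _ s0 s1).
- exact: (dist_cutoff01 nOy0).
- move=> x Ox; rewrite /dist_cutoff lt_min ltr01 mul1r/=.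
  exact: (dist_out_gt0 nOy0).
Qed.

Let u_sorted (t : R) (t0 : t != 0) :
  mu [set x | flat_side T t x /\ u x < u (flat_reflection T Ti t x)] = 0%E.
Proof. exact: (eigenfunction_polarized s0 V (F t0) u_pos). Qed.

Theorem eigenfunction_steiner (v : E -> R) : measurable_fun setT v ->
  {ae mu, forall x, Om x -> u x = v x} -> steiner_sym_fun0 (T @` Om) (v \o Ti).
Proof.
move=> mv uv; apply: steiner_of_wrong_order => // t t0.
apply: (wrong_order_ae t0 uv).
apply: (@negligibleS _ _ _ mu [set x | flat_side T t x /\ u x < u (flat_reflection T Ti t x)] _).
  by move=> x [].
apply/negligibleP; last exact: u_sorted.
apply: measurableI; first exact: (rf_mX (F t0)).
apply: measurable_lt_set; first exact: (op_mu V).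
exact: (measurableT_comp (op_mu V) (rf_mpres (F t0)).1).
Qed.

Theorem weight_steiner (h : E -> R) : (forall x, Om x -> h x = g x) ->
  steiner_sym_fun0 (T @` Om) (h \o Ti).
Proof.
move=> hg; have : steiner_sym_fun0 (T @` Om) (g \o Ti).
  apply: steiner_of_wrong_order; first exact: rintegrable_measurable (op_ig V).
  move=> t t0; apply/negligibleP; first exact: (measurable_wrong_order V (F t0)).
  apply: (weight_polarized V (F t0) u_pos (u_sorted t0)).
  exact: (test_fun_dense s0 s1 oO fO nOy0).
rewrite /steiner_sym_fun0 (flat_domainE _ TK TiK); apply: filterS => y H Oy.
rewrite /= hg// [LHS](H Oy) /steiner_fun.
congr (ereal_sup (_ @` _)); apply/funext => a; congr (steiner_set _ y).
by apply/seteqP; split => z /= [Oz]; rewrite ?hg// => ?; rewrite -?hg.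
Qed.

End sorted_values.

(** * Integrability of rearrangements *)
Section integrability_on_finite_measure.
Context d (T : measurableType d) (R : realType).
Variable m : {measure set T -> \bar R}.
Variable D : set T.
Hypotheses (mD : measurable D) (fD : (m D < +oo)%E).

Lemma rintegrable_indic_fin : rintegrable m \1_D.
Proof.
apply/integrableP; split; first exact/measurable_EFinP/measurable_indic.
under eq_integral => x _ do rewrite gee0_abs ?lee_fin//.
by rewrite integral_indic// setIT.
Qed.

Lemma Lfun_rintegrable (q : \bar R) (f : T -> R) : (0 < m D)%E -> (1 < q)%E ->
  f \in Lfun m q -> (forall x, ~ D x -> f x = 0) -> rintegrable m f.
Proof.
move=> D0 q1 fq f0.
have mf : measurable_fun setT f by move: fq; rewrite inE => /andP[/[!inE]].
have iD := rintegrable_indic_fin.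
case: q q1 fq => [r|_|//].
- rewrite lte_fin => /ltW r1 fq.
  apply: (rintegrable_le (h := fun x => \1_D x + `|f x| `^ r)) => //.
    move=> x; have p0 : 0 <= `|f x| `^ r by exact: powR_ge0.
    have [Dx|nDx] := pselect (D x); last by rewrite f0// normr0.
    rewrite indicE mem_set// [leRHS]ger0_norm ?addr_ge0//.
    have [fx|/ltW fx] := leP `|f x| 1; first by rewrite -[leLHS]addr0 lerD.
    rewrite -[leLHS]add0r lerD// -[leLHS]powRr1//.
    exact: ler_powR.
  by apply: rintegrableD => //; exact: Lfun_integrable r1 fq.
- rewrite inE => /andP[_]; rewrite inE/= /finite_norm unlock/=.
  rewrite (lt_le_trans D0) ?le_measure ?inE//.
  move=> fin; have [M hM] := ess_sup_inf.ess_supr_bounded (f := fun x => `|f x|) fin.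
  apply/integrableP; split; first exact/measurable_EFinP.
  apply: (@le_lt_trans _ _ (\int[m]_x (`|M| * \1_D x)%:E)%E).
    apply: ae_ge0_le_integral => //.
    - by apply: measurableT_comp => //; exact/measurable_EFinP.
    - by apply/measurable_EFinP; apply: measurable_funM => //; exact: measurable_indic.
    apply: filterS hM => x fM _; rewrite /= lee_fin.
    have [Dx|nDx] := pselect (D x); last by rewrite f0// normr0 mulr_ge0.
    by rewrite indicE mem_set// mulr1 (le_trans fM)// ler_norm.
  have := rintegrableZ `|M| iD => /integrableP[_]; apply: le_lt_trans.
  apply: ge0_le_integral => //.
  - by apply/measurable_EFinP; apply: measurable_funM => //; exact: measurable_indic.
  - by apply/measurable_EFinP; apply: measurableT_comp => //; apply: measurable_funM => //; exact: measurable_indic.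
  by move=> x _; rewrite lee_fin ler_norm.
Qed.

Let integral_mrestr (h : T -> R) : (forall x, ~ D x -> h x = 0) ->
  (\int[m]_x `|(h x)%:E| = \int[mrestr m mD]_x `|(h x)%:E|)%E.
Proof.
move=> h0; have e : (fun x => `|(h x)%:E|)%E = (fun x => `|(h x)%:E|)%E \_ D.
  apply/funext => x; rewrite patchE; case: ifPn => // /negP.
  by rewrite in_setE => /h0 ->; rewrite /= normr0.
rewrite e -!(integral_mkcond D); apply: eq_measure_integral => A mA AD.
by rewrite -[in LHS](setIidl AD).
Qed.

Let nu (k : T -> R) : set R -> \bar R := pushforward (mrestr m mD) k.

Let nu_ray k t : nu k [set` `]t, +oo[ ] = m [set x | D x /\ t < k x].
Proof.
rewrite /nu /pushforward/= /mrestr; congr (m _); apply/seteqP.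
by split => x /=; rewrite in_itv/= andbT => -[].
Qed.

Let eq_distribution (f h : T -> R) : measurable_fun setT f -> measurable_fun setT h ->
  (forall t : R, m [set x | D x /\ t < h x] = m [set x | D x /\ t < f x]) ->
  forall A, measurable A -> nu f A = nu h A.
Proof.
move=> mf mh hf A mA; pose g_ k : set R := [set` `]- k%:R, +oo[ ].
have IG : setI_closed (@RGenOInfty.G R).
  move=> _ _ [x ->] [y ->]; exists (Num.max x y); apply/seteqP.
  split => z /=; rewrite !in_itv/= !andbT gt_max; first by case=> -> ->.
  by move=> /andP[].
have Gg k : @RGenOInfty.G R (g_ k) by exists (- k%:R).
have cover : \bigcup_k g_ k = setT.
  apply/seteqP; split => // x _; exists (Num.truncn `|x|).+1 => //.
  rewrite /g_ /= in_itv/= andbT ltrNl.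
  by rewrite (le_lt_trans (ler_norm _))// normrN truncnS_gt.
have rays B : @RGenOInfty.G R B -> nu f B = nu h B.
  by move=> [x ->]; rewrite [LHS]nu_ray [RHS]nu_ray.
have fin k : (nu f (g_ k) < +oo)%E.
  rewrite [ltLHS]nu_ray; apply: le_lt_trans fD; apply: le_measure; rewrite ?inE//.
    by apply: measurableI => //; exact: measurable_lt_set.
  by move=> x [].
have := measure_unique (@RGenOInfty.G R) g_ (@RGenOInfty.measurableE R) IG Gg cover
  (pushforward (mrestr m mD) f) (pushforward (mrestr m mD) h) rays fin.
by move=> /(_ mf mh A mA).
Qed.

(** Distributions on the line are determined by the rays, so that integrability of
    the absolute value passes to equidistributed functions. *)
Lemma equidistributed_rintegrable (f h : T -> R) :
  measurable_fun setT h -> (forall x, ~ D x -> h x = 0) ->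
  rintegrable m f -> (forall x, ~ D x -> f x = 0) ->
  (forall t : R, m [set x | D x /\ t < h x] = m [set x | D x /\ t < f x]) ->
  rintegrable m h.
Proof.
move=> mh h0 fi f0 hf; have mf := rintegrable_measurable fi.
apply/integrableP; split; first exact/measurable_EFinP.
have /integrableP[_] := fi; apply: le_lt_trans.
rewrite /= !integral_mrestr//.
have mabs : measurable_fun setT (fun y : R => (`|y|%:E)).
  by apply/measurable_EFinP; exact: normr_measurable.
have nuE (k : T -> R) : measurable_fun setT k ->
    (\int[nu k]_y `|y|%:E = \int[mrestr m mD]_x `|(k x)%:E|)%E.
  by move=> mk; rewrite (ge0_integral_pushforward mk (mrestr m mD) measurableT).
rewrite -!nuE// le_eqVlt; apply/orP; left; apply/eqP.
by apply: eq_measure_integral => A mA _; exact/esym/eq_distribution.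
Qed.

End integrability_on_finite_measure.

(** * First eigenfunctions *)
Section seminorm.
Context {R : realType} {n : nat}.
Variable s : R.
Local Notation E := 'rV[R]_n.+1.
Local Notation mu := (@lebs R n.+1).
Local Notation mu2 := ((@lebs R n.+1) \x (@lebs R n.+1))%E.
Implicit Types (Om : set E) (h w v : E -> R).

Lemma gagliardoE w : gagliardo s w = (energy s w `^ 2^-1)%E.
Proof. by []. Qed.

Lemma gagliardo_lty w : (gagliardo s w < +oo)%E <-> (energy s w < +oo)%E.
Proof.
rewrite gagliardoE; split; last exact: poweR_lty.
by apply: lty_poweRy; rewrite invr_eq0 pnatr_eq0.
Qed.

Lemma gagliardo_sqr w : (energy s w < +oo)%E -> fine (gagliardo s w) ^+ 2 = en s w.
Proof.
rewrite gagliardoE /en; have := @energy_ge0 R n s w.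
case: (energy s w) => [e e0 _| |]//=.
by rewrite powR12_sqrt// sqr_sqrtr.
Qed.

Lemma Lfun2_sqr w : measurable_fun setT w -> rintegrable mu (fun x => w x ^+ 2) ->
  w \in Lfun (leb n.+1) 2%:E.
Proof.
move=> mw /integrableP[_ fin]; rewrite inE; apply/andP; split; rewrite inE//=.
rewrite /finite_norm unlock/=; apply: poweR_lty; apply: le_lt_trans fin.
rewrite le_eqVlt; apply/orP; left; apply/eqP; apply: eq_integral => x _.
rewrite /=; congr EFin.
by rewrite powR_mulrn// normrX.
Qed.

Lemma test_fun_sqr Om w : measurable Om -> (mu Om < +oo)%E -> test_fun s Om w ->
  rintegrable mu (fun x => w x ^+ 2).
Proof.
move=> mO fO [mw [M wM] w0 _].
apply: (rintegrable_le (h := fun x => M ^+ 2 * \1_Om x)).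
- exact: measurable_funX.
- move=> x; have [Ox|nOx] := pselect (Om x); last by rewrite w0// expr0n normr0.
  rewrite indicE mem_set// mulr1 normrX [leRHS]ger0_norm ?sqr_ge0//.
  by rewrite lerXn2r ?nnegrE// (le_trans _ (wM x)).
by apply: rintegrableZ; exact: rintegrable_indic_fin.
Qed.

Lemma energy_ae w v : measurable_fun setT w -> measurable_fun setT v ->
  {ae mu, forall x, w x = v x} -> energy s w = energy s v.
Proof.
move=> mw mv [N [mN N0 wv]].
have out x : ~ N x -> w x = v x by move=> nN; apply: contrapT => /wv.
rewrite !energyE//; apply: ge0_ae_eq_integral => //.
- by apply/measurable_EFinP; exact: measurable_edens.
- by apply/measurable_EFinP; exact: measurable_edens.
- by move=> p _; rewrite lee_fin edens_ge0.
- by move=> p _; rewrite lee_fin edens_ge0.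
have mT1 : measurable [set: E] by [].
exists ((N `*` setT) `|` (setT `*` N)); split.
- by apply: measurableU; exact: measurableX.
- have e1 : (mu2 (N `*` setT) <= 0)%E.
    by rewrite product_measure1E// [X in (X * _)%E](N0 : mu N = 0%E) mul0e.
  have e2 : (mu2 (setT `*` N) <= 0)%E.
    by rewrite product_measure1E// [X in (_ * X)%E](N0 : mu N = 0%E) mule0.
  apply/eqP; rewrite eq_le measure_ge0 andbT.
  apply: le_trans (measureU2 _ (measurableX mN mT1) (measurableX mT1 mN)) _.
  by rewrite -(adde0 0%E); apply: leeD; [exact: e1|exact: e2].
move=> [x y] /= /not_implyP[_ ne].
have [Nx|nNx] := pselect (N x); first by left.
have [Ny|nNy] := pselect (N y); first by right.
by exfalso; apply: ne; rewrite /edens/= !out.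
Qed.

Let sign_gain (a b : R) :
  (`|a| - `|b|) ^+ 2 + 4 * (Num.max a 0 * Num.max (- b) 0) <= (a - b) ^+ 2 + 0.
Proof.
have alt (x : R) : 0 <= x \/ x < 0.
  by have [|] := boolP (0 <= x); rewrite -?ltNge; [left|right].
have [a0|a0] := alt a; have [b0|b0] := alt b.
- have -> : Num.max (- b) 0 = 0 by apply/max_idPr; rewrite oppr_le0.
  by rewrite !mulr0 !addr0 !ger0_norm.
- have -> : Num.max (- b) 0 = - b by apply/max_idPl; rewrite oppr_ge0 ltW.
  rewrite (ger0_norm a0) (ltr0_norm b0) (_ : Num.max a 0 = a); last exact/max_idPl.
  by rewrite !expr2; lra.
- have -> : Num.max a 0 = 0 by apply/max_idPr; rewrite ltW.
  rewrite mul0r mulr0 !addr0 (ltr0_norm a0) (ger0_norm b0).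
  have : 0 <= - a * b by rewrite mulr_ge0// oppr_ge0 ltW.
  by rewrite !expr2; lra.
have -> : Num.max a 0 = 0 by apply/max_idPr; rewrite ltW.
by rewrite mul0r mulr0 !addr0 !ltr0_norm// !expr2; lra.
Qed.

Let fine_ltD (a b c : \bar R) : (b < +oo)%E -> (a + c <= b)%E -> (0 < c)%E ->
  (0 <= b)%E -> (0 <= a)%E -> fine a < fine b.
Proof.
case: a b c => [a| |] [b| |] [c| |]//= _; rewrite -EFinD lee_fin lte_fin => h1 h2 _ _.
by rewrite (lt_le_trans _ h1)// ltrDl.
Qed.

(** Where [v] changes sign the absolute value decreases the increments, and the
    kernel does not vanish. *)
Lemma energy_abs_lt v : measurable_fun setT v -> (energy s v < +oo)%E ->
  (0 < mu [set x | (0 < v x)%R])%E -> (0 < mu [set x | (v x < 0)%R])%E ->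
  en s (fun x => `|v x|) < en s v.
Proof.
move=> mv fv P0 N0.
have mav : measurable_fun setT (fun x => `|v x|) by exact: measurableT_comp.
pose G (p : E * E) := 4 * (Num.max (v p.1) 0 * Num.max (- v p.2) 0) * kern s (p.1 - p.2).
have mG : measurable_fun setT G.
  apply: measurable_funM; last by apply: measurable_kern; exact: measurable_diff.
  apply: measurable_funM => //; apply: measurable_funM; apply: measurable_maxr => //.
    exact: (measurableT_comp mv).
  by apply: measurable_funN; exact: (measurableT_comp mv).
have G0 p : 0 <= G p.
  by rewrite /G !mulr_ge0 ?kern_ge0// le_max lexx orbT.
have gain := @energy_addl_le _ _ s _ _ G (fun=> 0) mav mv mG G0 (measurable_cst (0 : R)) (fun=> lexx 0).
have {}gain : (energy s (fun x => `|v x|%R) + \int[mu2]_p (G p)%:E <= energy s v)%E.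
  rewrite -[leRHS]adde0 -[X in (_ <= _ + X)%E](integral0 mu2 setT).
  apply: gain => p; rewrite /edens /G addr0 -mulrDl ler_wpM2r ?kern_ge0//.
  by have := sign_gain (v p.1) (v p.2); rewrite addr0.
have mP : measurable [set x | 0 < v x] by exact: measurable_lt_set.
have mN : measurable [set x | v x < 0] by exact: measurable_lt_set.
have Gp : (0 < \int[mu2]_p (G p)%:E)%E.
  apply: (integral_gt0 (S := [set x | 0 < v x] `*` [set x | v x < 0])).
  - exact/measurable_EFinP.
  - by move=> p; rewrite lee_fin.
  - exact: measurableX.
  - exact: product_gt0.
  move=> [x y] [/= vx vy]; rewrite lte_fin /G/= !mulr_gt0 ?lt_max ?vx ?oppr_gt0 ?vy//.
  apply: kern_gt0; rewrite subr_eq0; apply/eqP => xy.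
  by have := lt_trans vx; rewrite xy => /(_ _ vy); rewrite ltxx.
exact: (fine_ltD fv gain Gp (energy_ge0 _ _) (energy_ge0 _ _)).
Qed.

Lemma mass_ae h w v : measurable_fun setT h -> measurable_fun setT w -> measurable_fun setT v ->
  {ae mu, forall x, w x ^+ 2 = v x ^+ 2} -> mass h w = mass h v.
Proof.
move=> mh mw mv wv; rewrite /mass /Rintegral; congr fine.
apply: ae_eq_integral => //.
- by apply/measurable_EFinP; apply: measurable_funM => //; exact: measurable_funX.
- by apply/measurable_EFinP; apply: measurable_funM => //; exact: measurable_funX.
by apply: filterS wv => x -> _.
Qed.

Lemma mass_neq0 h w : measurable_fun setT h -> measurable_fun setT w ->
  mass h w != 0 -> (0 < mu [set x | w x != 0%R])%E.
Proof.
move=> mh mw; apply: contraNT; rewrite -leNgt => le0.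
have mW : measurable [set x | w x != 0].
  rewrite (_ : [set x | _] = w @^-1` (~` [set 0])).
    by rewrite -[X in measurable X]setTI; apply: mw => //; apply: measurableC; exact: measurable_set1.
  by apply/seteqP; split => x /= /eqP.
apply/eqP; rewrite (@mass_ae h w (fun=> 0))//.
  rewrite /mass (_ : (fun x => _) = fun=> 0) ?Rintegral_cst ?mul0r//.
  by apply/funext => x; rewrite expr0n mulr0.
exists [set x | w x != 0]; split => //.
  by apply/eqP; rewrite eq_le le0 measure_ge0.
by move=> x /= ne; apply/eqP => wx; apply: ne; rewrite wx.
Qed.

Lemma weighted_massE Om h w :
  weighted_mass Om h w = mass (h \_ Om) w.
Proof.
rewrite /weighted_mass Rintegral_mkcond /mass.
rewrite -[LHS]/(\int[mu]_x ((fun x => h x * `|w x| ^+ 2) \_ Om) x).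
congr (Rintegral _ _ _); apply/funext => x; rewrite !patchE.
by case: ifP => _; rewrite ?mul0r// real_normK ?num_real.
Qed.

End seminorm.

Lemma rayleighE {R : realType} {n : nat} Om s (g u : 'rV[R]_n.+1 -> R) :
  (energy s u < +oo)%E ->
  rayleigh Om s g u = @frac_const R n s / 2 * en s u / mass (g \_ Om) u.
Proof. by move=> fu; rewrite /rayleigh gagliardo_sqr// weighted_massE. Qed.

Lemma en_gt0 {R : realType} {n : nat} s (w : 'rV[R]_n.+1 -> R) :
  (energy s w < +oo)%E -> (0 < energy s w)%E -> 0 < en s w.
Proof. by move=> fw w0; rewrite fine_gt0// w0. Qed.

Lemma ge0_fine_le {R : realType} (a b : \bar R) : (0 <= a)%E -> (a <= b)%E ->
  (b < +oo)%E -> fine a <= fine b.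
Proof. by case: a b => [a| |] [b| |]. Qed.

Lemma en_le {R : realType} {n : nat} s (w v : 'rV[R]_n.+1 -> R) :
  (energy s w <= energy s v)%E -> (energy s v < +oo)%E -> en s w <= en s v.
Proof. exact: ge0_fine_le (energy_ge0 _ _). Qed.

Lemma en_ae {R : realType} {n : nat} s (w v : 'rV[R]_n.+1 -> R) :
  energy s w = energy s v -> en s w = en s v.
Proof. by rewrite /en => ->. Qed.

(** The real-valued integral of a function that is not integrable is zero. *)
Lemma Rintegral_gt0_integrable d (T : measurableType d) (R : realType)
    (m : {measure set T -> \bar R}) (f : T -> R) : measurable_fun setT f ->
  0 < \int[m]_x f x -> rintegrable m f.
Proof.
rewrite /Rintegral integralE => mf; set p := (\int[m]_x _)%E; set q := (\int[m]_x _)%E => pq.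
have mF : measurable_fun setT (EFin \o f) by exact/measurable_EFinP.
have p0 : (0 <= p)%E by exact: integral_ge0.
have q0 : (0 <= q)%E by exact: integral_ge0.
apply/integrableP; split => //.
have -> : (\int[m]_x `|(EFin \o f) x| = p + q)%E.
  rewrite /p /q -ge0_integralD//; [|exact: measurable_funepos|exact: measurable_funeneg].
  by apply: eq_integral => x _; rewrite -[LHS]/((abse \o (EFin \o f)) x) fune_abse.
by move: p q p0 q0 pq => [p| |] [q| |]//=; rewrite ?ltxx// => *; exact: ltry.
Qed.

Section first_eigenfunctions.
Context {R : realType} {n : nat}.
Variable s : R.
Hypotheses (s0 : 0 < s) (s1 : s < 1).
Local Notation E := 'rV[R]_n.+1.
Local Notation mu := (@lebs R n.+1).
Variables (Om : set E) (g0 g u : E -> R).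
Hypotheses (mO : measurable Om) (fO : (mu Om < +oo)%E) (cO : (0 < mu (~` Om))%E).
Hypothesis gi : rintegrable mu (g \_ Om).
Hypothesis hg : minimizing_weight Om s g0 g.
Hypothesis hu : first_eigenfunction Om s g u.

Let lam : R := rayleigh Om s g u.
Let c : R := @frac_const R n s / 2.
Let gO := g \_ Om.
Let v := u \_ Om.
Let mgO : measurable_fun setT gO := rintegrable_measurable gi.

Let c_gt0 : 0 < c.
Proof. by rewrite divr_gt0// frac_const_gt0. Qed.

Lemma eigenfunction_measurable : measurable_fun setT u.
Proof. by have [[[+ _ _] _] _] := hu; rewrite inE => /andP[/[!inE]]. Qed.

Let mu_ := eigenfunction_measurable.

Let mv : measurable_fun setT v.
Proof. by apply/(measurable_restrictT _ _).1 => //; exact: measurable_funS mu_. Qed.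

Let v_out x : ~ Om x -> v x = 0.
Proof. by move=> nOx; rewrite /v patchE memNset. Qed.

Let v_in x : Om x -> v x = u x.
Proof. by move=> Ox; rewrite /v patchE mem_set. Qed.

Let uv : {ae mu, forall x, u x = v x}.
Proof.
have [[[_ _ +] _] _] := hu; apply: filterS => x u0.
by have [Ox|nOx] := pselect (Om x); [rewrite v_in|rewrite v_out// u0].
Qed.

Let fu : (energy s u < +oo)%E.
Proof. by have [[[_ + _] _] _] := hu => /gagliardo_lty. Qed.

Lemma en_restrict : en s u = en s v.
Proof. exact: en_ae (energy_ae s mu_ mv uv). Qed.

Lemma mass_restrict : mass gO u = mass gO v.
Proof. by apply: mass_ae => //; apply: filterS uv => x ->. Qed.

Let mass_gt0 : 0 < mass gO v.
Proof. by have [[_ +] _] := hu; rewrite weighted_massE -/gO mass_restrict. Qed.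

Let fv : (energy s v < +oo)%E.
Proof. by rewrite -(energy_ae s mu_ mv uv). Qed.

Lemma quotient_attained : lam * mass gO v = c * en s v.
Proof.
by rewrite /lam rayleighE// -/gO mass_restrict en_restrict divfK ?gt_eqF.
Qed.

Let v_nz : (0 < mu [set x | v x != 0%R])%E.
Proof. by apply: (mass_neq0 mgO mv); rewrite gt_eqF. Qed.

Lemma eigenfunction_neq0 : (0 < mu [set x | (0 < `|v x|)%R])%E.
Proof.
rewrite (_ : [set x | _] = [set x | v x != 0]); first exact: v_nz.
by apply/seteqP; split => x /=; rewrite normr_gt0.
Qed.

Let m_nz : measurable [set x | v x != 0].
Proof.
rewrite (_ : [set x | _] = v @^-1` (~` [set 0])).
  by rewrite -[X in measurable X]setTI; apply: mv => //; apply: measurableC; exact: measurable_set1.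
by apply/seteqP; split => x /= /eqP.
Qed.

(** Any competitor jumps between the domain and its complement. *)
Let env_gt0 : 0 < en s v.
Proof.
apply: en_gt0 => //; rewrite energyE//.
apply: (integral_gt0 (S := [set x | v x != 0] `*` (~` Om))).
- by apply/measurable_EFinP; exact: measurable_edens.
- by move=> p; rewrite lee_fin edens_ge0.
- by apply: measurableX => //; exact: measurableC.
- by apply: product_gt0 => //; exact: measurableC.
move=> [x y] [/= vx nOy]; rewrite lte_fin /edens/= (v_out nOy) subr0.
rewrite mulr_gt0 ?exprn_even_gt0//; apply: kern_gt0; rewrite subr_eq0.
by apply: contraNneq vx => ->; rewrite v_out.
Qed.

Let lam_gt0 : 0 < lam.
Proof. by rewrite -(pmulr_lgt0 _ mass_gt0) quotient_attained mulr_gt0. Qed.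

Let rayleigh_min (h w : E -> R) : rearrangement_class Om g0 h ->
  measurable_fun setT w -> rintegrable mu (fun x => w x ^+ 2) ->
  (energy s w < +oo)%E -> (forall x, ~ Om x -> w x = 0) ->
  lam * mass (h \_ Om) w <= c * en s w.
Proof.
move=> hh mw iw fw w0; have [M0|M0] := leP (mass (h \_ Om) w) 0.
  apply: (@le_trans _ _ 0); first by rewrite pmulr_rle0.
  by rewrite mulr_ge0 ?en_ge0 1?ltW.
have adm : admissible Om s h w.
  split; last by rewrite weighted_massE.
  split; [exact: Lfun2_sqr|exact/gagliardo_lty|].
  by apply: aeW => x; exact: w0.
have : ((rayleigh Om s g u)%:E <= (rayleigh Om s h w)%:E)%E.
  rewrite hu.2; apply: le_trans (hg.2 h hh) _.
  by apply: ereal_inf_lbound; exists w.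
rewrite lee_fin -/lam [X in _ <= X](rayleighE _ _ fw).
by rewrite ler_pdivlMr.
Qed.

(* The modulus is a competitor that is nonnegative everywhere. *)
Let w_ (x : E) : R := `|v x|.

Let mw : measurable_fun setT w_.
Proof. exact: measurableT_comp. Qed.

Lemma mass_abs_restrict : mass gO w_ = mass gO v.
Proof. by apply: mass_ae => //; apply: aeW => x; rewrite /w_ real_normK ?num_real. Qed.

Let enw : (energy s w_ <= energy s v)%E.
Proof. by apply: energy_le => // x y; exact: ler_dist_dist. Qed.

Let fw : (energy s w_ < +oo)%E.
Proof. exact: le_lt_trans enw fv. Qed.

Let v2i : rintegrable mu (fun x => v x ^+ 2).
Proof.
have [[[+ _ _] _] _] := hu => /Lfun2_integrable_sqr ui.
apply: (rintegrable_le (h := fun x => u x ^+ 2)) => //; first exact: measurable_funX.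
move=> x; have [Ox|nOx] := pselect (Om x); first by rewrite v_in.
by rewrite v_out// expr0n normr0.
Qed.

(** The absolute value is an admissible competitor with the same mass, and it has
    strictly smaller energy when the sign of [u] changes. *)
Lemma eigenfunction_signed :
  {ae mu, forall x, Om x -> w_ x = u x} \/ {ae mu, forall x, Om x -> w_ x = - u x}.
Proof.
have mP : measurable [set x | 0 < v x] by exact: measurable_lt_set.
have mN : measurable [set x | v x < 0] by exact: measurable_lt_set.
have [P0|P0] := eqVneq (mu [set x | 0 < v x]) 0%E.
  right; exists [set x | 0 < v x]; split => // x /= /not_implyP[Ox ne].
  rewrite ltNge; apply/negP => v0; apply: ne.
  by rewrite /w_ ler0_norm// v_in.
have [N0|N0] := eqVneq (mu [set x | v x < 0]) 0%E.
  left; exists [set x | v x < 0]; split => // x /= /not_implyP[Ox ne].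
  rewrite ltNge; apply/negP => v0; apply: ne.
  by rewrite /w_ ger0_norm// v_in.
have lt : en s w_ < en s v.
  by apply: (energy_abs_lt mv fv); rewrite lt_neqAle measure_ge0 andbT eq_sym.
have := rayleigh_min hg.1 mw _ fw _; rewrite -/gO mass_abs_restrict quotient_attained.
rewrite ler_pM2l// leNgt lt => H; exfalso; apply: (notF (H _ _)).
  by under eq_fun do rewrite real_normK ?num_real//.
by move=> x nOx; rewrite /w_ v_out// normr0.
Qed.

Let gv2 (x : E) : R := gO x * v x ^+ 2.

Let mgv2 : measurable_fun setT gv2.
Proof. by apply: measurable_funM => //; exact: measurable_funX. Qed.

Let mass_cutoff_cvg : mass gO (cutoff w_ k) @[k --> \oo] --> mass gO v.
Proof.
have mc k : measurable_fun setT (cutoff w_ k) by exact: measurable_minr.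
have w0 x : 0 <= w_ x by exact: normr_ge0.
have ig : rintegrable mu gv2 by exact: Rintegral_gt0_integrable mgv2 mass_gt0.
have [] := @dominated_convergence _ _ _ mu setT measurableT
  (fun k x => (gO x * cutoff w_ k x ^+ 2)%:E) (fun x => (gv2 x)%:E) (fun x => `|gv2 x|%:E).
- by move=> k; apply/measurable_EFinP; apply: measurable_funM => //; exact: measurable_funX.
- exact/measurable_EFinP.
- apply: aeW => x _; apply: cvg_EFin; first exact: nearW.
  apply: cvg_near_cst; exists (Num.truncn (w_ x)).+1 => // k /= hk.
  by rewrite /cutoff min_l ?real_normK ?num_real// (le_trans (ltW (truncnS_gt _)))// ler_nat.
- by have := integrable_abse ig.
- apply: aeW => x k _; rewrite /= lee_fin normrM [leRHS]normrM ler_wpM2l//.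
  rewrite !normrX lerXn2r ?nnegrE// -[leRHS]/(w_ x) ger0_norm ?ge_min ?lexx//.
  by rewrite le_min w0 ler0n.
move=> _ _; have fin := integrable_fin_num measurableT ig.
by rewrite -(fineK fin) => /fine_cvg.
Qed.

(** Composing [g] with a measure-preserving map of the domain gives a rearrangement of
    [g], and the truncations of [w_] have at most the energy of [w_] and converge to it
    in mass. *)
Lemma optimal_pair_eigenfunction : optimal_pair s Om gO w_ lam c.
Proof.
split => //.
- by move=> x nOx; rewrite /gO patchE memNset.
- by move=> x; exact: normr_ge0.
- by move=> x nOx; rewrite /w_ v_out// normr0.
- move=> tau mt tO w tw.
  have e : (fun x => g (tau x)) \_ Om = (fun x => gO (tau x)).
    apply/funext => x; rewrite /gO !patchE; have [Ox|nOx] := pselect (Om x).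
      by rewrite !mem_set//; exact/tO.
    by rewrite !memNset// => /tO.
  have := @rayleigh_min (fun x => g (tau x)) w; rewrite e; apply.
  - have [[mg hgt] _] := hg; split.
      apply/(measurable_restrictT _ mO); rewrite e.
      exact: (measurableT_comp mgO mt.1).
    move=> t; rewrite -hgt.
    have mS : measurable [set x | Om x /\ t < g x].
      rewrite (_ : [set x | _] = Om `&` [set x | t < gO x]).
        by apply: measurableI => //; exact: measurable_lt_set.
      apply/seteqP; split => x [Ox]; rewrite /= /gO patchE mem_set//.
    rewrite -[RHS](mt.2 _ mS); congr (lebs _ _).
    by apply/seteqP; split => x /= [Ox gt]; split => //; exact/tO.
  - exact: tf_meas tw.
  - exact: test_fun_sqr tw.
  - exact: tf_fin tw.
  - exact: tf_out tw.
move=> e e0; have el : 0 < e / lam by rewrite divr_gt0.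
have /cvgrPdist_le/(_ _ el)[k0 _ hk] := mass_cutoff_cvg.
exists k0 => k k0k; apply: (@le_trans _ _ (c * en s v)).
  rewrite (ler_pM2l c_gt0); apply: en_le fv.
  exact: le_trans (energy_cutoff_le _ _ mw) enw.
rewrite -quotient_attained -lerBlDl -mulrBr mulrC -ler_pdivlMr//.
exact: le_trans (ler_norm _) (hk k k0k).
Qed.

End first_eigenfunctions.

(** * Steiner symmetry of minimizing weights and eigenfunctions *)
Section bounded_domains.
Context {R : realType} {n : nat}.
Local Notation E := 'rV[R]_n.+1.
Local Notation mu := (@lebs R n.+1).
Variable A : set E.
Hypothesis bA : bounded_set A.

Let bound : exists M : R, 0 < M /\ forall x i, A x -> `|x ord0 i| < M.
Proof.
have [M [_ hM]] := bA; exists (Num.max M 0 + 2); split.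
  by rewrite ltr_wpDl// le_max lexx orbT.
move=> x i Ax; apply: (@le_lt_trans _ _ (Num.max M 0 + 1)); last by rewrite ltrD2l ltr1n.
apply: (@le_trans _ _ `|x|); last first.
  by apply: hM => //; rewrite (@le_lt_trans _ _ (Num.max M 0)) ?le_max ?lexx// ltrDl.
rewrite [leRHS]mx_normrE.
exact: (le_bigmax _ (fun p : 'I_1 * 'I_n.+1 => `|x p.1 p.2|) (ord0, i)).
Qed.

Lemma bounded_lebs_fin : measurable A -> (mu A < +oo)%E.
Proof.
move=> mA; have [M [M0 hM]] := bound.
apply: (@le_lt_trans _ _ (mu (cube n.+1 M))).
  by apply: le_measure; rewrite ?inE//; [exact: measurable_cube|move=> x Ax i; exact: hM].
by rewrite [ltLHS]leb_cube ?ltW// ltry.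
Qed.

Lemma bounded_setC_gt0 : measurable A -> (0 < mu (~` A))%E.
Proof.
move=> mA; have [M [M0 hM]] := bound.
pose O : set E := [set x | M < x ord0 ord0].
have oO : open O.
  exact: (open_comp (fun x _ => @coord_continuous R 1 n.+1 ord0 ord0 x) (@open_gt R M)).
apply: (@lt_le_trans _ _ (mu O)).
  by apply: (@lebs_open_gt0 _ _ O (const_mx (M + 1))) => //; rewrite /O/= mxE ltrDl.
apply: le_measure; rewrite ?inE; [exact: open_measurable_rV|exact: measurableC|].
move=> x Ox Ax; have := hM x ord0 Ax.
by rewrite ltNge (le_trans (ltW Ox))// ler_norm.
Qed.

End bounded_domains.

(** As [s < 1] and the dimension is at least two, [q > 1]. *)
Lemma rearrangement_integrable {R : realType} {n : nat} (Om : set 'rV[R]_n.+1) (s : R)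
    (q : \bar R) (g0 g : 'rV[R]_n.+1 -> R) :
  (0 < n)%N -> 0 < s -> s < 1 -> measurable Om -> (0 < lebs n.+1 Om < +oo)%E ->
  ((n.+1%:R / (2 * s))%:E < q)%E -> g0 \_ Om \in Lfun (leb n.+1) q ->
  rearrangement_class Om g0 g -> rintegrable (lebs n.+1) (g \_ Om).
Proof.
move=> n0 s0 s1 mO /andP[gO0 fO] hq g0q [mg gg0].
have out : forall (h : 'rV[R]_n.+1 -> R) x, ~ Om x -> (h \_ Om) x = 0.
  by move=> h x nOx; rewrite patchE memNset.
have q1 : (1 < q)%E.
  apply: le_lt_trans hq; rewrite lee_fin ler_pdivlMr ?mulr_gt0// mul1r.
  apply: (@le_trans _ _ 2); last by rewrite ler_nat.
  by rewrite -[leRHS]mulr1 ler_pM2l// ltW.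
have gi : rintegrable (lebs n.+1) (g0 \_ Om).
  exact: (@Lfun_rintegrable _ _ _ (leb n.+1) Om mO fO q _ gO0 q1 g0q (out g0)).
apply: (equidistributed_rintegrable mO fO _ (out g) gi (out g0)).
  exact/(measurable_restrictT _ mO).
have e : forall (h : 'rV[R]_n.+1 -> R) (t : R), [set x | Om x /\ t < (h \_ Om) x] = [set x | Om x /\ t < h x].
  by move=> h t; apply/seteqP; split => x /= -[Ox]; rewrite patchE mem_set.
by move=> t; rewrite !e; exact: gg0.
Qed.

Unset Implicit Arguments.

Theorem theorem1p2 (R : realType) (n : nat) (hN : (2 <= n.+1)%N)
    (s : R) (hs0 : 0 < s) (hs1 : s < 1)
    (Omega : set 'rV[R]_n.+1) (hOmega : smooth_bounded_domain Omega)
    (q : \bar R) (hq : ((n.+1%:R / (2 * s))%:E < q)%E)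
    (g0 : 'rV[R]_n.+1 -> R)
    (hg0 : (g0 \_ Omega) \in Lfun (leb n.+1) q)
    (hg0pos :
      ~ {ae leb n.+1, forall x, Omega x -> Num.max (g0 x) 0 = 0})
    (g : 'rV[R]_n.+1 -> R) (hg : minimizing_weight Omega s g0 g)
    (u : 'rV[R]_n.+1 -> R) (hu : first_eigenfunction Omega s g u)
    (H : set 'rV[R]_n.+1) (hH : open_half_space H) (hH0 : closure H 0)
    (hsym : steiner_sym_set (boundary H) Omega) :
  ((ae_nonneg Omega u /\ steiner_sym_fun (boundary H) Omega u) \/
   (ae_nonneg Omega (\- u) /\ steiner_sym_fun (boundary H) Omega (\- u))) /\
  steiner_sym_fun (boundary H) Omega g.
Proof.
have [oO _ [x0 Ox0] bO _] := hOmega.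
have mO := open_measurable_rV oO.
have fO := bounded_lebs_fin bO mO.
have cO := bounded_setC_gt0 bO mO.
have [y0 nOy0] : exists y0, ~ Omega y0.
  apply: contrapT => h; have C0 : ~` Omega = set0.
    by apply/seteqP; split => y // nOy; apply: h; exists y.
  by move: cO; rewrite C0 measure0 ltxx.
have O0 : (0 < lebs n.+1 Omega)%E by exact: lebs_open_gt0 oO Ox0.
have [T [Ti [[TK TiK iT TP] OE]]] := hsym.
have gi : rintegrable (lebs n.+1) (g \_ Omega).
  by apply: (rearrangement_integrable _ hs0 hs1 mO _ hq hg0 hg.1) => //; rewrite O0 fO.
have V := optimal_pair_eigenfunction hs0 hs1 mO fO cO gi hg hu.
have mu_ := eigenfunction_measurable hu.
have nz := eigenfunction_neq0 mO gi hu.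
split; last first.
  exists T, Ti; split => //.
  apply: (weight_steiner hs0 hs1 V oO Ox0 nOy0 nz TK TiK iT OE).
  by move=> x Ox; rewrite patchE mem_set.
have [wu|wu] := eigenfunction_signed hs0 hs1 mO cO gi hg hu; [left|right]; split.
- by apply: filterS wu => x + Ox => <-//.
- exists T, Ti; split => //.
  exact: (eigenfunction_steiner hs0 hs1 V oO Ox0 nOy0 nz TK TiK iT OE mu_ wu).
- by apply: filterS wu => x + Ox => /= <-//.
- exists T, Ti; split => //.
  apply: (eigenfunction_steiner hs0 hs1 V oO Ox0 nOy0 nz TK TiK iT OE _ wu).
  exact: measurable_funN.
Qed.
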